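(* Let $\mathcal{C}$ be a rigid C$^*$-tensor category and let $A$ be a pre-C$^*$-algebra object in $\mathrm{Vec}(\mathcal{C})$. Then the fiberwise completion of $A$ with respect to the Hilbert module structure over $A_0=A(1_{\mathcal{C}})$ is a C$^*$-algebra object.
   Context: $\mathcal{C}$ is strict with simple unit $1_{\mathcal{C}}$. For each $U\in\mathcal{C}$ fix a dual $\bar U$ and standard solutions $R_U\colon1_{\mathcal{C}}\to\bar U\otimes U$, $\bar R_U\colon1_{\mathcal{C}}\to U\otimes\bar U$ of the conjugate equations. $\mathrm{Vec}(\mathcal{C})$ is the monoidal category of contravariant linear functors from $\mathcal{C}$ to vector spaces. An algebra object $A$ is the same as a lax monoidal functor $\mathcal{C}^{\mathrm{op}}\to\mathrm{Vec}$; the product of $a\in A(U)$ and $b\in A(V)$ is written $a\cdot b\in A(V\otimes U)$, and $A_0=A(1_{\mathcal{C}})$ is a unital algebra with unit $1_{A_0}$. The associated right $\mathcal{C}$-module category $\mathcal{M}_A$ is the idempotent completion of the category with objects $X_A$ ($X\in\mathcal{C}$), morphisms $\mathcal{M}_A(X_A,Y_A)=A(X\otimes\bar Y)$, composition $g\circ f=A(\mathrm{id}_X\otimes R_Y\otimes\mathrm{id}_{\bar Z})(g\cdot f)$ for $f\in A(X\otimes\bar Y)$, $g\in A(Y\otimes\bar Z)$, and $X_A\triangleleft U=(X\otimes U)_A$; on morphisms $T\triangleleft\mathrm{id}_V$, for $T\in A(X\otimes\bar Y)$, is $A(\mathrm{id}_X\otimes\bar R_V^*\otimes\mathrm{id}_{\bar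 Y})(T)$. A $*$-algebra object is an algebra object $A$ with conjugate linear maps $A(U)\to A(\bar U)$, $a\mapsto a^\natural$, such that: $A(T)(a)^\natural=A(T^{*\vee})(a^\natural)$ for $T\in\mathcal{C}(U,V)$, $a\in A(V)$, where $T^{*\vee}\in\mathcal{C}(\bar U,\bar V)$ is characterized by $(\mathrm{id}_U\otimes T^{*\vee})\bar R_U=(T^*\otimes\mathrm{id}_{\bar V})\bar R_V$; $(a^\natural)^\natural=a$ up to $\bar{\bar U}\simeq U$; $1_{A_0}^\natural=1_{A_0}$; and $a^\natural\cdot b^\natural=(b\cdot a)^\natural$ up to $\bar U\otimes\bar V\simeq\overline{V\otimes U}$. This induces an involution $\mathcal{M}_A(X_A,Y_A)\to\mathcal{M}_A(Y_A,X_A)$, making $\mathcal{M}_A$ a dagger category. A pre-C$^*$-algebra object is a $*$-algebra object $A$ such that $A_0$ (with involution $\natural$) is a C$^*$-algebra and the $A_0$-valued sesquilinear form on the left $A_0$-module $A(U)$, $${}_{A_0}\langle a,b\rangle=A(R_U)(a\cdot b^\natural),$$ satisfies ${}_{A_0}\langle a,a\rangle\ge0$ for all $U\in\mathcal{C}$, $a\in A(U)$. The fiberwise completion replaces each $A(U)$ by its (separated) completion for $\|a\|=\|{}_{A_0}\langle a,a\rangle\|^{1/2}$. A C$^*$-algebra object is an algebra object $A$ such that $\mathcal{M}_A$ admits a compatible structure of C$^*$-category (so that it is a C$^*$-$\mathcal{C}$-module category); here the involution is the one induced by $\natural$. *)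

(* Defs.v *)
From HB Require Import structures.
From mathcomp Require Import all_boot all_order all_algebra.
From mathcomp Require Import complex.
From mathcomp Require Import all_classical all_reals all_analysis.

Set Implicit Arguments.
Unset Strict Implicit.
Unset Printing Implicit Defensive.

Import Order.TTheory GRing.Theory Num.Theory numFieldNormedType.Exports.

Local Open Scope classical_set_scope.
Local Open Scope ring_scope.
Local Open Scope complex_scope.

Declare Scope cat_scope.
Delimit Scope cat_scope with cat.
Local Open Scope cat_scope.

Reserved Notation "g ∘ f" (at level 40, left associativity).
Reserved Notation "X ⊗ Y" (at level 38, left associativity).
Reserved Notation "f ⊠ g" (at level 38, left associativity).
Reserved Notation "f ^†" (at level 2, format "f ^†").
Reserved Notation "a ⋅ b" (at level 37, left associativity).
Reserved Notation "a ^♮" (at level 2, format "a ^♮").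

Record lincat (R : realType) := LinCat {
  obj :> Type;
  hom : obj -> obj -> lmodType R[i];
  idm : forall X, hom X X;
  comp : forall X Y Z, hom Y Z -> hom X Y -> hom X Z;
  compA : forall X Y Z W (h : hom Z W) (g : hom Y Z) (f : hom X Y),
    comp h (comp g f) = comp (comp h g) f;
  compm1 : forall X Y (f : hom X Y), comp f (idm X) = f;
  comp1m : forall X Y (f : hom X Y), comp (idm Y) f = f;
  comp_linl : forall X Y Z k (g g' : hom Y Z) (f : hom X Y),
    comp (k *: g + g') f = k *: comp g f + comp g' f;
  comp_linr : forall X Y Z k (g : hom Y Z) (f f' : hom X Y),
    comp g (k *: f + f') = k *: comp g f + comp g f'
}.
Arguments hom {R l}.
Arguments idm {R l}.
Notation "g ∘ f" := (comp g f) : cat_scope.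

Definition dagger R (D : lincat R) := forall X Y : D, hom X Y -> hom Y X.

Record is_dagger R (D : lincat R) (dag : dagger D) : Prop := IsDagger {
  dag_antilin : forall (X Y : D) k (f g : hom X Y),
    dag _ _ (k *: f + g) = k^* *: dag _ _ f + dag _ _ g;
  dagK : forall (X Y : D) (f : hom X Y), dag _ _ (dag _ _ f) = f;
  dag_comp : forall (X Y Z : D) (g : hom Y Z) (f : hom X Y),
    dag _ _ (g ∘ f) = dag _ _ f ∘ dag _ _ g
}.

Record is_complete_norm (R : realType) (V : lmodType R[i]) (nrm : V -> R) : Prop :=
  IsCompleteNorm {
  nrm_triangle : forall v w, nrm (v + w) <= nrm v + nrm w;
  nrm_scale : forall k v, nrm (k *: v) = complex.Re `|k| * nrm v;
  nrm_eq0 : forall v, nrm v = 0 -> v = 0;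
  nrm_complete : forall u : nat -> V,
    (forall e : R, 0 < e ->
      \forall m \near \oo & n \near \oo, nrm (u m - u n) < e) ->
    exists v, nrm (u n - v) @[n --> \oo] --> (0 : R)
}.

Record is_Cstar_category R (D : lincat R) (dag : dagger D)
    (nrm : forall X Y : D, hom X Y -> R) : Prop := IsCstarCategory {
  Cstar_dagger : is_dagger dag;
  Cstar_norm : forall X Y, is_complete_norm (@nrm X Y);
  Cstar_submul : forall X Y Z (g : hom Y Z) (f : hom X Y),
    nrm _ _ (g ∘ f) <= nrm _ _ g * nrm _ _ f;
  Cstar_identity : forall X Y (f : hom X Y),
    nrm _ _ (dag _ _ f ∘ f) = nrm _ _ f ^+ 2;
  Cstar_positive : forall X Y (f : hom X Y),
    exists g : hom X X, dag _ _ f ∘ f = dag _ _ g ∘ g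
}.

(* The identity of X, seen as a morphism between the equal objects X and Y;
   these are the coherence isomorphisms of a strict monoidal category. *)
Definition eqm R (D : lincat R) (X Y : D) (e : X = Y) : hom X Y :=
  ecast Z (hom X Z) e (idm X).

Record strict_moncat (R : realType) := StrictMoncat {
  mon_cat :> lincat R;
  one_ob : mon_cat;
  tens : mon_cat -> mon_cat -> mon_cat;
  tensm : forall X X' Y Y' : mon_cat,
    hom X X' -> hom Y Y' -> hom (tens X Y) (tens X' Y');
  tensm_linl : forall X X' Y Y' k (f f' : hom X X') (g : hom Y Y'),
    tensm (k *: f + f') g = k *: tensm f g + tensm f' g;
  tensm_linr : forall X X' Y Y' k (f : hom X X') (g g' : hom Y Y'),
    tensm f (k *: g + g') = k *: tensm f g + tensm f g';
  tensm1 : forall X Y, tensm (idm X) (idm Y) = idm (tens X Y);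
  tensm_comp : forall X X' X'' Y Y' Y''
      (f' : hom X' X'') (f : hom X X') (g' : hom Y' Y'') (g : hom Y Y'),
    tensm (f' ∘ f) (g' ∘ g) = tensm f' g' ∘ tensm f g;
  tensA : forall X Y Z, tens X (tens Y Z) = tens (tens X Y) Z;
  tens1o : forall X, tens one_ob X = X;
  tenso1 : forall X, tens X one_ob = X;
  tensmA : forall X X' Y Y' Z Z' (f : hom X X') (g : hom Y Y') (h : hom Z Z'),
    eqm (tensA X' Y' Z') ∘ tensm f (tensm g h)
      = tensm (tensm f g) h ∘ eqm (tensA X Y Z);
  tensm1o : forall X X' (f : hom X X'),
    eqm (tens1o X') ∘ tensm (idm one_ob) f = f ∘ eqm (tens1o X);
  tensmo1 : forall X X' (f : hom X X'),
    eqm (tenso1 X') ∘ tensm f (idm one_ob) = f ∘ eqm (tenso1 X)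
}.
Arguments one_ob {R s}.
Arguments tensA {R s}.
Arguments tens1o {R s}.
Arguments tenso1 {R s}.
Notation "X ⊗ Y" := (tens X Y) : cat_scope.
Notation "f ⊠ g" := (tensm f g) : cat_scope.

Section Zigzag.
Variables (R : realType) (C : strict_moncat R) (dag : dagger C).
Local Notation "f ^†" := (dag f).

(* (r^† ⊗ id_E)(id_D ⊗ s) : D -> D ⊗ U ⊗ E -> E *)
Definition zigzag (D U E : C) (r : hom one_ob (D ⊗ U)) (s : hom one_ob (U ⊗ E)) :
    hom D E :=
  eqm (tens1o E) ∘ (r^† ⊠ idm E) ∘ eqm (tensA D U E)
    ∘ (idm D ⊠ s) ∘ eqm (esym (tenso1 D)).

Definition conjugate_eqs (U D : C) (r : hom one_ob (D ⊗ U))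
    (rb : hom one_ob (U ⊗ D)) : Prop :=
  zigzag rb r = idm U /\ zigzag r rb = idm D.

End Zigzag.

(* A strict rigid C*-tensor category with simple unit, together with a choice
   of a dual and of a standard solution of the conjugate equations (one that
   is balanced and minimizes ‖r‖‖rb‖ among all solutions) for each object. *)
Record rigid_Cstar_tensor_category (R : realType) := RigidCstar {
  rigid_cat :> strict_moncat R;
  dag : dagger rigid_cat;
  nrm : forall X Y : rigid_cat, hom X Y -> R;
  rigid_Cstar : is_Cstar_category dag nrm;
  dag_tens : forall (X X' Y Y' : rigid_cat) (f : hom X X') (g : hom Y Y'),
    dag (f ⊠ g) = dag f ⊠ dag g;
  unit_simple : forall f : hom (one_ob : rigid_cat) one_ob,
    exists k : R[i], f = k *: idm one_ob;
  unit_neq0 : idm (one_ob : rigid_cat) <> 0;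
  dual : rigid_cat -> rigid_cat;
  ev : forall U, hom one_ob (dual U ⊗ U);
  evb : forall U, hom one_ob (U ⊗ dual U);
  ev_conj : forall U, conjugate_eqs dag (ev U) (evb U);
  ev_balanced : forall U, nrm (ev U) = nrm (evb U);
  ev_minimal : forall (U D : rigid_cat) (r : hom one_ob (D ⊗ U))
      (rb : hom one_ob (U ⊗ D)),
    conjugate_eqs dag r rb -> nrm (ev U) * nrm (evb U) <= nrm r * nrm rb
}.
Arguments dual {R _}.
Arguments ev {R _}.
Arguments evb {R _}.
Notation "f ^†" := (dag f) : cat_scope.

(* Morphisms with varying source and target, so that identities between
   composites hold on the nose, without the coherence morphisms eqm. *)
Module Strict.
Section Strict.
Variables (R : realType) (C : strict_moncat R).

Definition mor := {X : C & {Y : C & hom X Y}}.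
Definition pack X Y (f : hom X Y) : mor := existT _ X (existT _ Y f).
Definition src (a : mor) : C := projT1 a.
Definition tgt (a : mor) : C := projT1 (projT2 a).
Definition arr (a : mor) : hom (src a) (tgt a) := projT2 (projT2 a).
Definition pid (X : C) := pack (idm X).
Definition ptens (a b : mor) := pack (arr a ⊠ arr b).
Definition pcomp (b a : mor) : mor :=
  match pselect (tgt a = src b) with
  | left e => pack (arr b ∘ eqm e ∘ arr a)
  | right _ => b
  end.

Lemma eqm_id (X : C) (e : X = X) : eqm e = idm X.
Proof. by rewrite (Prop_irrelevance e erefl). Qed.

Lemma pack_inj X Y (f g : hom X Y) : pack f = pack g -> f = g.
Proof.
move=> h.
have key (a b : mor) : a = b -> exists (p : src b = src a) (q : tgt a = tgt b),
    eqm q ∘ arr a ∘ eqm p = arr b.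
  by move=> ->; exists erefl, erefl; rewrite compm1 comp1m.
by have [p [q]] := key _ _ h; rewrite !eqm_id /= comp1m compm1.
Qed.

Lemma packM X Y Z (g : hom Y Z) (f : hom X Y) :
  pack (g ∘ f) = pcomp (pack g) (pack f).
Proof.
rewrite /pcomp; case: pselect => [e|] /=; last by [].
by rewrite eqm_id compm1.
Qed.

Lemma packT X X' Y Y' (f : hom X X') (g : hom Y Y') :
  pack (f ⊠ g) = ptens (pack f) (pack g).
Proof. by []. Qed.

Lemma pack_eqm (X Y : C) (e : X = Y) : pack (eqm e) = pid X.
Proof. by case: Y / e. Qed.

Lemma pack_eqmr (X Y Z : C) (f : hom Y Z) (e : X = Y) :
  pack (f ∘ eqm e) = pack f.
Proof. by case: Y / e f => f; rewrite compm1. Qed.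

Lemma pack_eqml (X Y Z : C) (e : Y = Z) (f : hom X Y) :
  pack (eqm e ∘ f) = pack f.
Proof. by case: Z / e; rewrite comp1m. Qed.

Lemma ptensA a b c : ptens a (ptens b c) = ptens (ptens a b) c.
Proof.
case: a b c => [X [X' f]] [Y [Y' g]] [Z [Z' h]]; rewrite /ptens /=.
by rewrite -(pack_eqml (tensA X' Y' Z')) tensmA pack_eqmr.
Qed.

Lemma ptens1 a : ptens (pid one_ob) a = a.
Proof.
case: a => X [Y f]; rewrite /ptens /=.
by rewrite -(pack_eqml (tens1o Y)) tensm1o pack_eqmr.
Qed.

Lemma ptensm1 a : ptens a (pid one_ob) = a.
Proof.
case: a => X [Y f]; rewrite /ptens /=.
by rewrite -(pack_eqml (tenso1 Y)) tensmo1 pack_eqmr.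
Qed.

Lemma ptens_id X Y : ptens (pid X) (pid Y) = pid (X ⊗ Y).
Proof. by rewrite /ptens /= tensm1. Qed.

Lemma pcomp1 X a : src a = X -> pcomp a (pid X) = a.
Proof. by case: a => Y [Z f] /= <-; rewrite -packM compm1. Qed.

Lemma p1comp X a : tgt a = X -> pcomp (pid X) a = a.
Proof. by case: a => Y [Z f] /= <-; rewrite -packM comp1m. Qed.

Lemma pcompA a b c : src a = tgt b -> src b = tgt c ->
  pcomp a (pcomp b c) = pcomp (pcomp a b) c.
Proof.
case: a b c => [X [X' f]] [Y [Y' g]] [Z [Z' h]]; rewrite /src /tgt /= => e1 e2.
by case: Y' / e1 g; case: Z' / e2 h => h g; rewrite -!packM compA.
Qed.

Lemma src_pcomp a b : src a = tgt b -> src (pcomp a b) = src b.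
Proof. by move=> e; rewrite /pcomp; case: pselect => // n; case: n. Qed.

Lemma tgt_pcomp a b : tgt (pcomp a b) = tgt a.
Proof. by rewrite /pcomp; case: pselect. Qed.

Lemma src_ptens a b : src (ptens a b) = src a ⊗ src b. Proof. by []. Qed.
Lemma tgt_ptens a b : tgt (ptens a b) = tgt a ⊗ tgt b. Proof. by []. Qed.

(* interchange law *)
Lemma ptens_comp a b c d : src a = tgt b -> src c = tgt d ->
  ptens (pcomp a b) (pcomp c d) = pcomp (ptens a c) (ptens b d).
Proof.
case: a b c d => [X [X' f]] [Y [Y' g]] [Z [Z' h]] [W [W' k]].
rewrite /src /tgt /= => e1 e2.
case: Y' / e1 g; case: W' / e2 k => k g.
change (ptens (pcomp (pack f) (pack g)) (pcomp (pack h) (pack k))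
  = pcomp (ptens (pack f) (pack h)) (ptens (pack g) (pack k))).
by rewrite -!packM /ptens /= tensm_comp.
Qed.

Lemma ptens_split a b : ptens a b = pcomp (ptens a (pid (tgt b))) (ptens (pid (src a)) b).
Proof. by rewrite -ptens_comp // pcomp1 // p1comp. Qed.

Lemma ptens_split' a b : ptens a b = pcomp (ptens (pid (tgt a)) b) (ptens a (pid (src b))).
Proof. by rewrite -ptens_comp // pcomp1 // p1comp. Qed.

End Strict.

Ltac ends := do ?rewrite (src_ptens, tgt_ptens); rewrite ?src_pcomp ?tgt_pcomp;
  rewrite /src /tgt /=; by do ?rewrite (tens1o, tenso1, tensA).

End Strict.

Section Duality.
Variables (R : realType) (C : rigid_Cstar_tensor_category R).
Implicit Types X Y Z U V D E : C.

(* id_X ⊗ r ⊗ id_Z *)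
Definition insert X Z D U (r : hom one_ob (D ⊗ U)) :
    hom (X ⊗ Z) ((X ⊗ D) ⊗ (U ⊗ Z)) :=
  eqm (tensA X D (U ⊗ Z))
    ∘ (idm X ⊠ (eqm (esym (tensA D U Z)) ∘ (r ⊠ idm Z) ∘ eqm (esym (tens1o Z)))).

(* If D is dual to U and E is dual to V, through r and s respectively, then
   E ⊗ D is dual to U ⊗ V, through (id_E ⊗ r ⊗ id_V) s. *)
Definition nest U V D E (r : hom one_ob (D ⊗ U)) (s : hom one_ob (E ⊗ V)) :
    hom one_ob ((E ⊗ D) ⊗ (U ⊗ V)) :=
  insert E V r ∘ s.

Definition dual_one : hom one_ob (dual (one_ob : C)) :=
  eqm (tens1o (dual one_ob)) ∘ evb one_ob.

(* Canonical isomorphisms between two duals D and D' of an object W, with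
   solutions (r, rb) and (r', rb'): [zigzag r rb'] is the unique t : D -> D'
   such that (id_W ⊗ t) rb = rb'. In the next three definitions, (D, W) is
   (U, dual U), (dual V ⊗ dual U, U ⊗ V) and (Y ⊗ dual X, X ⊗ dual Y). *)
Definition dual_dual U : hom U (dual (dual U)) :=
  zigzag (@dag _ C) (evb U) (evb (dual U)).

Definition dual_tens U V : hom (dual V ⊗ dual U) (dual (U ⊗ V)) :=
  zigzag (@dag _ C) (nest (ev U) (ev V)) (evb (U ⊗ V)).

Definition dual_hom X Y : hom (Y ⊗ dual X) (dual (X ⊗ dual Y)) :=
  zigzag (@dag _ C) (nest (ev X) (evb Y)) (evb (X ⊗ dual Y)).

End Duality.

Record algebra_object R (C : rigid_Cstar_tensor_category R) := AlgebraObject {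
  fiber :> C -> lmodType R[i];
  amap : forall U V : C, hom U V -> fiber V -> fiber U;
  amap_linl : forall U V k (S T : hom U V) a,
    amap (k *: S + T) a = k *: amap S a + amap T a;
  amap_linr : forall U V k (T : hom U V) a b,
    amap T (k *: a + b) = k *: amap T a + amap T b;
  amap1 : forall U (a : fiber U), amap (idm U) a = a;
  amap_comp : forall U V W (S : hom V W) (T : hom U V) a,
    amap (S ∘ T) a = amap T (amap S a);
  amul : forall U V : C, fiber U -> fiber V -> fiber (V ⊗ U);
  amul_linl : forall U V k a a' b,
    @amul U V (k *: a + a') b = k *: amul a b + amul a' b;
  amul_linr : forall U V k a b b',
    @amul U V a (k *: b + b') = k *: amul a b + amul a b';
  amul_nat : forall U U' V V' (T : hom U' U) (S : hom V' V) a b,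
    amul (amap T a) (amap S b) = amap (S ⊠ T) (amul a b);
  amulA : forall U V W (a : fiber U) (b : fiber V) (c : fiber W),
    amap (eqm (tensA W V U)) (amul a (amul b c)) = amul (amul a b) c;
  aone : fiber one_ob;
  amul1 : forall U (a : fiber U), amap (eqm (esym (tens1o U))) (amul a aone) = a;
  a1mul : forall U (a : fiber U), amap (eqm (esym (tenso1 U))) (amul aone a) = a
}.
Arguments aone {R C a} : rename.
Notation "a ⋅ b" := (amul a b) : cat_scope.

Section StrictDuality.
Import Strict.
Variables (R : realType) (C : rigid_Cstar_tensor_category R).
Implicit Types X Y Z U V D E : C.

Let dagC := Cstar_dagger (rigid_Cstar C).

Lemma dag1 X : (idm X)^† = idm X.
Proof.
have h : (idm X)^† = ((idm X)^† ∘ idm X)^†.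
  by rewrite (dag_comp dagC) (dagK dagC) compm1.
by rewrite h compm1 (dagK dagC).
Qed.

Lemma dag_eqm (X Y : C) (e : X = Y) : (eqm e)^† = eqm (esym e).
Proof. by case: Y / e; rewrite /= dag1. Qed.

Lemma pack_insert X Z D U (r : hom one_ob (D ⊗ U)) :
  pack (insert X Z r) = ptens (pid X) (ptens (pack r) (pid Z)).
Proof. by rewrite /insert pack_eqml packT pack_eqmr pack_eqml. Qed.

Lemma pack_insertV X Z D U (r : hom one_ob (D ⊗ U)) :
  pack (insert X Z r)^† = ptens (pid X) (ptens (pack r^†) (pid Z)).
Proof.
rewrite /insert !(dag_comp dagC) !dag_tens !(dag_comp dagC) !dag_eqm !dag_tens.
by rewrite pack_eqmr packT dag1 compA pack_eqmr pack_eqml dag1.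
Qed.

Lemma pack_nest U V D E (r : hom one_ob (D ⊗ U)) (s : hom one_ob (E ⊗ V)) :
  pack (nest r s) = pcomp (ptens (pid E) (ptens (pack r) (pid V))) (pack s).
Proof. by rewrite /nest packM pack_insert. Qed.

Lemma pack_zigzag (U D E : C) (r : hom one_ob (D ⊗ U)) (s : hom one_ob (U ⊗ E)) :
  pack (zigzag (@dag _ C) r s)
  = pcomp (ptens (pack r^†) (pid E)) (ptens (pid D) (pack s)).
Proof. by rewrite /zigzag pack_eqmr packM pack_eqmr pack_eqml. Qed.

Lemma pack_zigzagV (U D E : C) (r : hom one_ob (D ⊗ U)) (s : hom one_ob (U ⊗ E)) :
  pack (zigzag (@dag _ C) r s)^†
  = pcomp (ptens (pid D) (pack s^†)) (ptens (pack r) (pid E)).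
Proof.
rewrite /zigzag !(dag_comp dagC) !dag_eqm !dag_tens !dag1 (dagK dagC).
by rewrite !compA pack_eqmr packM pack_eqmr pack_eqml.
Qed.

Lemma conj_l U : pcomp (ptens (pack (evb U)^†) (pid U)) (ptens (pid U) (pack (ev U)))
  = pid U.
Proof. by rewrite -pack_zigzag (ev_conj U).1. Qed.

Lemma conj_rV U :
  pcomp (ptens (pid (dual U)) (pack (evb U)^†)) (ptens (pack (ev U)) (pid (dual U)))
  = pid (dual U).
Proof. by rewrite -pack_zigzagV (ev_conj U).2 dag1. Qed.

Lemma zigzagV_ev D W (r : hom one_ob (D ⊗ W)) :
  pcomp (ptens (pack (zigzag (@dag _ C) r (evb W))^†) (pid W)) (pack (ev W)) = pack r.
Proof.
rewrite pack_zigzagV.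
rewrite -[pid W](@pcomp1 _ _ W) // ptens_comp; try ends.
rewrite -pcompA; try ends.
rewrite -[ptens (ptens _ (pid (dual W))) _]ptensA ptens_id.
rewrite -[pack (ev W)]ptens1 -ptens_comp // pcomp1 // p1comp //.
rewrite [ptens (pack r) _]ptens_split' [ptens (pack r) _]ptensm1.
rewrite -[tgt (pack r)]/(D ⊗ W) -!ptens_id -!ptensA.
rewrite pcompA; try ends.
rewrite -ptens_comp; try ends.
by rewrite conj_l p1comp ?ptens_id ?p1comp.
Qed.

Lemma evb_ev_evb Y V (e := pack (ev Y)) (b := pack (evb V)^†) :
  pcomp (ptens b (ptens (pid (dual Y ⊗ Y)) b))
    (ptens (pid V) (ptens (pcomp (ptens (pid (dual V)) (ptens e (pid V)))
                             (pack (ev V)))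
                      (pid (dual V))))
  = pcomp e b.
Proof.
have -> : ptens (pid V) (ptens (pcomp (ptens (pid (dual V)) (ptens e (pid V)))
              (pack (ev V))) (pid (dual V))) =
    pcomp (ptens (pid (V ⊗ dual V)) (ptens e (pid (V ⊗ dual V))))
          (ptens (pid V) (ptens (pack (ev V)) (pid (dual V)))).
  rewrite -[X in ptens (pid V) (ptens (pcomp _ _) X)](@pcomp1 _ _ (dual V)) //.
  rewrite ptens_comp; try ends.
  rewrite -[X in ptens X (pcomp _ _)](@pcomp1 _ _ V) // ptens_comp; try ends.
  by rewrite -!ptens_id -!ptensA.
rewrite pcompA; try ends.
have -> : pcomp (ptens b (ptens (pid (dual Y ⊗ Y)) b))
    (ptens (pid (V ⊗ dual V)) (ptens e (pid (V ⊗ dual V)))) = pcomp e (ptens b b).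
  rewrite -!ptens_comp; try ends.
  rewrite !pcomp1 // p1comp //.
  rewrite -{2}[e]ptens1 -{2}[e]ptensm1 -{4}[b]ptens1.
  by rewrite -!ptens_comp ?pcomp1 ?p1comp //; try ends.
rewrite [ptens b b]ptens_split' -!pcompA; try ends.
rewrite -[tgt b]/one_ob ptens1 -[src b]/(V ⊗ dual V).
have -> : pcomp (ptens b (pid (V ⊗ dual V)))
  (ptens (pid V) (ptens (pack (ev V)) (pid (dual V)))) = pid (V ⊗ dual V).
  rewrite -ptens_id !ptensA -ptens_comp; try ends.
  by rewrite conj_l p1comp ?ptens_id.
by rewrite pcomp1.
Qed.

Lemma dual_tens_ev U V :
  pcomp (ptens (pack (dual_tens U V)^†) (pid (U ⊗ V))) (pack (ev (U ⊗ V)))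
  = pack (nest (ev U) (ev V)).
Proof. exact: zigzagV_ev. Qed.

End StrictDuality.

Section ModuleCategory.
Variables (R : realType) (C : rigid_Cstar_tensor_category R).
Variable A : algebra_object C.
Implicit Types X Y Z U V : C.

Definition mhom X Y : lmodType R[i] := A (X ⊗ dual Y).

Definition mid X : mhom X X := amap (evb X)^† aone.

Definition mcomp X Y Z (g : mhom Y Z) (f : mhom X Y) : mhom X Z :=
  amap (insert X (dual Z) (ev Y)) (g ⋅ f).

(* The action of C on the morphisms of M_A through X |-> X_A. *)
Definition membed X Y (T : hom X Y) : mhom X Y :=
  amap ((evb Y)^† ∘ (T ⊠ idm (dual Y))) aone.

(* f ◁ id_V : A (X ⊗ Y^) -> A (X ⊗ V ⊗ V^ ⊗ Y^) -> A (X ⊗ V ⊗ (Y ⊗ V)^), writing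
   ^ for duals; the adjoint of dual_tens Y V is its inverse. *)
Definition mact X Y (f : mhom X Y) V : mhom (X ⊗ V) (Y ⊗ V) :=
  amap ((insert X (dual Y) (evb V))^† ∘ (idm (X ⊗ V) ⊠ (dual_tens Y V)^†)) f.

Import Strict.

Let pack_simpl := (@pack_insert R C, @pack_insertV R C, @packT R C,
  @pack_eqml R C, @packM R C).

Lemma mcompA X Y Z W (h : mhom Z W) (g : mhom Y Z) (f : mhom X Y) :
  mcomp h (mcomp g f) = mcomp (mcomp h g) f.
Proof.
rewrite /mcomp -[in LHS](amap1 h) -[in RHS](amap1 f) !amul_nat -!amap_comp.
rewrite -amulA -amap_comp; congr amap; apply: pack_inj.
rewrite !pack_simpl.
have -> : pack (idm (Z ⊗ dual W)) = ptens (pid Z) (pid (dual W)).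
  by rewrite ptens_id.
have -> : pack (idm (X ⊗ dual Y)) = ptens (pid X) (pid (dual Y)).
  by rewrite ptens_id.
transitivity
  (ptens (pid X) (ptens (pack (ev Y)) (ptens (pack (ev Z)) (pid (dual W))))).
  rewrite -[X in pcomp _ (ptens _ X) = _]ptens1 -!ptensA -ptens_comp; try ends.
  rewrite p1comp // -ptens_comp; try ends.
  by rewrite pcomp1 // !ptens_id p1comp //; ends.
rewrite -!ptensA -ptens_comp; try ends.
rewrite p1comp // [ptens (pid (dual Y)) _]ptensA ptens_id -ptens_comp; try ends.
by rewrite p1comp // pcomp1 //; ends.
Qed.

Lemma mcompm1 X Y (f : mhom X Y) : mcomp f (mid X) = f.
Proof.
rewrite /mcomp /mid -{1}(amap1 f) amul_nat -amap_comp.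
rewrite -[RHS]amul1; congr amap; apply: pack_inj.
rewrite pack_eqm packM packT pack_insert.
rewrite -[pack (idm (X ⊗ dual Y))]/(pid _) -ptens_id !ptensA.
by rewrite -ptens_comp ?conj_l ?p1comp; try ends.
Qed.

Lemma mcomp1m X Y (f : mhom X Y) : mcomp (mid Y) f = f.
Proof.
rewrite /mcomp /mid -{1}(amap1 f) amul_nat -amap_comp.
rewrite -[RHS]a1mul; congr amap; apply: pack_inj.
rewrite pack_eqm packM packT pack_insert.
rewrite -[pack (idm (X ⊗ dual Y))]/(pid _) -ptens_id -!ptensA.
by rewrite -ptens_comp ?conj_rV ?p1comp; try ends.
Qed.

Lemma mact_comp X Y Z (g : mhom Y Z) (f : mhom X Y) V :
  mcomp (mact g V) (mact f V) = mact (mcomp g f) V.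
Proof.
rewrite /mcomp /mact amul_nat -!amap_comp; congr amap; apply: pack_inj.
rewrite !pack_simpl.
rewrite -[pack (idm (X ⊗ V))]/(pid _) -[pack (idm (Y ⊗ V))]/(pid _).
rewrite ptens_comp; try ends.
rewrite -pcompA; try ends.
set n1 := pack (dual_tens Y V)^†; set n2 := pack (dual_tens Z V)^†.
have -> : pcomp (ptens (ptens (pid (X ⊗ V)) n1) (ptens (pid (Y ⊗ V)) n2))
      (ptens (pid (X ⊗ V)) (ptens (pack (ev (Y ⊗ V))) (pid (dual (Z ⊗ V)))))
    = ptens (pid (X ⊗ V)) (ptens (pcomp (ptens n1 (pid (Y ⊗ V)))
                                     (pack (ev (Y ⊗ V)))) n2).
  rewrite -[ptens (ptens (pid (X ⊗ V)) n1) _]ptensA -ptens_comp; try ends.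
  rewrite p1comp // [ptens n1 (ptens _ _)]ptensA -ptens_comp; try ends.
  by rewrite (pcomp1 (a := n2)).
rewrite dual_tens_ev pack_nest; set w := pcomp _ (pack (ev V)).
have sw : src w = one_ob by rewrite src_pcomp //; ends.
have tw : tgt w = dual V ⊗ (dual Y ⊗ Y ⊗ V) by rewrite tgt_pcomp; ends.
have -> : ptens (pid (X ⊗ V)) (ptens w n2) =
    pcomp (ptens (pid (X ⊗ V)) (ptens w (pid (dual V ⊗ dual Z))))
          (ptens (pid (X ⊗ V)) n2).
  rewrite -ptens_comp; try (by rewrite ?src_ptens ?tgt_ptens ?sw ?tw; ends).
  rewrite p1comp // -[X in pcomp (ptens w _) X]ptens1 -ptens_comp //.
  by rewrite pcomp1 // p1comp.
rewrite !pcompA; try (by rewrite ?src_ptens ?tgt_ptens ?sw ?tw; ends).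
congr pcomp.
rewrite -[RHS]ptens_comp // -[in RHS]ptens_comp // !p1comp //.
rewrite -evb_ev_evb -/w.
have -> : ptens (ptens (pid X) (ptens (pack (evb V)^†) (pid (dual Y))))
      (ptens (pid Y) (ptens (pack (evb V)^†) (pid (dual Z))))
   = ptens (pid X) (ptens (ptens (pack (evb V)^†)
       (ptens (pid (dual Y ⊗ Y)) (pack (evb V)^†))) (pid (dual Z))).
  by rewrite -!ptens_id -!ptensA.
have -> : ptens (pid (X ⊗ V)) (ptens w (pid (dual V ⊗ dual Z)))
   = ptens (pid X) (ptens (ptens (pid V) (ptens w (pid (dual V)))) (pid (dual Z))).
  by rewrite -!ptens_id -!ptensA.
rewrite -[LHS]ptens_comp; try (by rewrite ?src_ptens ?tgt_ptens ?sw ?tw; ends).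
rewrite p1comp //; congr ptens.
rewrite -[LHS]ptens_comp; try (by rewrite ?src_ptens ?tgt_ptens ?sw ?tw; ends).
by rewrite p1comp.
Qed.

End ModuleCategory.

Section FreeModules.
Variables (R : realType) (C : rigid_Cstar_tensor_category R).
Variable A : algebra_object C.

Lemma mcomp_linl (X Y Z : C) k (g g' : mhom A Y Z) (f : mhom A X Y) :
  mcomp (k *: g + g') f = k *: mcomp g f + mcomp g' f.
Proof. by rewrite /mcomp amul_linl amap_linr. Qed.

Lemma mcomp_linr (X Y Z : C) k (g : mhom A Y Z) (f f' : mhom A X Y) :
  mcomp g (k *: f + f') = k *: mcomp g f + mcomp g f'.
Proof. by rewrite /mcomp amul_linr amap_linr. Qed.

(* The object X of this category is X_A. *)
Definition free_modules : lincat R :=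
  LinCat (@mcompA R C A) (@mcompm1 R C A) (@mcomp1m R C A) mcomp_linl mcomp_linr.

End FreeModules.

Section IdempotentCompletion.
Variables (R : realType) (D : lincat R).

Record kar_ob := KarOb {
  kob : D;
  kidem : hom kob kob;
  kidemP : kidem ∘ kidem = kidem
}.

Definition kar_pred (E F : kar_ob) : {pred hom (kob E) (kob F)} :=
  [pred f | kidem F ∘ f ∘ kidem E == f].

Record kar_hom (E F : kar_ob) := KarHom {
  kmor :> hom (kob E) (kob F);
  kmorP : kmor \in @kar_pred E F
}.

HB.instance Definition _ E F := [isSub of kar_hom E F for @kmor E F].
HB.instance Definition _ E F := [Choice of kar_hom E F by <:].

Lemma kar_pred_submod E F : submod_closed (@kar_pred E F).
Proof.
split=> [|k f g]; rewrite !inE.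
  have cr0 (X Y Z : D) (h : hom Y Z) : h ∘ (0 : hom X Y) = 0.
    by have := comp_linr 1 h 0 (0 : hom X Y);
       rewrite !scale1r addr0 => /eqP; rewrite -subr_eq subrr eq_sym => /eqP.
  have c0r (X Y Z : D) (h : hom X Y) : (0 : hom Y Z) ∘ h = 0.
    by have := comp_linl 1 0 (0 : hom Y Z) h;
       rewrite !scale1r addr0 => /eqP; rewrite -subr_eq subrr eq_sym => /eqP.
  by rewrite cr0 c0r.
by move=> /eqP hf /eqP hg; rewrite comp_linr comp_linl hf hg.
Qed.

HB.instance Definition _ E F :=
  GRing.isSubmodClosed.Build R[i] (hom (kob E) (kob F)) (@kar_pred E F)
    (@kar_pred_submod E F).
HB.instance Definition _ E F :=
  [SubChoice_isSubLmodule of kar_hom E F by <:].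

Lemma cut_subproof E F (f : hom (kob E) (kob F)) :
  kidem F ∘ f ∘ kidem E \in @kar_pred E F.
Proof. by rewrite inE !compA kidemP -!compA kidemP. Qed.

(* The morphism of the completion induced by a morphism of D. *)
Definition cut E F (f : hom (kob E) (kob F)) : kar_hom E F :=
  KarHom (@cut_subproof E F f).

Lemma kar_homl E F (f : kar_hom E F) : kidem F ∘ f = f.
Proof. by have /eqP <- := kmorP f; rewrite !compA kidemP. Qed.

Lemma kar_homr E F (f : kar_hom E F) : f ∘ kidem E = f.
Proof. by have /eqP <- := kmorP f; rewrite -!compA kidemP. Qed.

Lemma kid_subproof E : kidem E \in @kar_pred E E.
Proof. by rewrite inE !kidemP. Qed.

Definition kid E : kar_hom E E := KarHom (kid_subproof E).

Lemma kcomp_subproof E F G (g : kar_hom F G) (f : kar_hom E F) :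
  kmor g ∘ kmor f \in @kar_pred E G.
Proof. by rewrite inE compA kar_homl -compA kar_homr. Qed.

Definition kcomp E F G (g : kar_hom F G) (f : kar_hom E F) : kar_hom E G :=
  KarHom (kcomp_subproof g f).

Lemma kcompA E F G H (h : kar_hom G H) (g : kar_hom F G) (f : kar_hom E F) :
  kcomp h (kcomp g f) = kcomp (kcomp h g) f.
Proof. by apply: val_inj; rewrite /= compA. Qed.

Lemma kcompm1 E F (f : kar_hom E F) : kcomp f (kid E) = f.
Proof. by apply: val_inj; rewrite /= kar_homr. Qed.

Lemma kcomp1m E F (f : kar_hom E F) : kcomp (kid F) f = f.
Proof. by apply: val_inj; rewrite /= kar_homl. Qed.

Lemma kcomp_linl E F G k (g g' : kar_hom F G) (f : kar_hom E F) :
  kcomp (k *: g + g') f = k *: kcomp g f + kcomp g' f.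
Proof. by apply: val_inj; rewrite /= comp_linl. Qed.

Lemma kcomp_linr E F G k (g : kar_hom F G) (f f' : kar_hom E F) :
  kcomp g (k *: f + f') = k *: kcomp g f + kcomp g f'.
Proof. by apply: val_inj; rewrite /= comp_linr. Qed.

Definition idempotent_completion : lincat R :=
  LinCat kcompA kcompm1 kcomp1m kcomp_linl kcomp_linr.

End IdempotentCompletion.

Section ModuleCategoryAction.
Variables (R : realType) (C : rigid_Cstar_tensor_category R).
Variable A : algebra_object C.

Definition module_category : lincat R := idempotent_completion (free_modules A).
Implicit Types E F : module_category.

Lemma kact_subproof E (V : C) :
  (mact (kidem E) V : hom (_ : free_modules A) _) ∘ mact (kidem E) V
  = mact (kidem E) V.
Proof. by rewrite /= mact_comp; exact: (congr1 (fun f => mact f V) (kidemP E)). Qed.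

(* E ◁ V *)
Definition kact_ob E (V : C) : module_category :=
  @KarOb R (free_modules A) (kob E ⊗ V) (mact (kidem E) V) (kact_subproof E V).

(* f ◁ T = (id ◁ T)(f ◁ id) *)
Definition kact E F (f : hom E F) (U V : C) (T : hom U V) :
    hom (kact_ob E U) (kact_ob F V) :=
  @cut R (free_modules A) (kact_ob E U) (kact_ob F V)
    (mcomp (membed A (idm (kob F : C) ⊠ T)) (mact (kmor f) U)).

Definition kassoc E (U V : C) :
    hom (kact_ob E (U ⊗ V)) (kact_ob (kact_ob E U) V) :=
  @cut R (free_modules A) (kact_ob E (U ⊗ V)) (kact_ob (kact_ob E U) V)
    (membed A (eqm (tensA (kob E : C) U V))).

Definition kunit E : hom (kact_ob E one_ob) E :=
  @cut R (free_modules A) (kact_ob E one_ob) E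
    (membed A (eqm (tenso1 (kob E : C)))).

End ModuleCategoryAction.

Definition is_unitary R (D : lincat R) (dag : dagger D) (X Y : D) (u : hom X Y) :=
  dag _ _ u ∘ u = idm X /\ u ∘ dag _ _ u = idm Y.

Record star_algebra_object R (C : rigid_Cstar_tensor_category R) :=
  StarAlgebraObject {
  star_algebra :> algebra_object C;
  natural : forall U, star_algebra U -> star_algebra (dual U);
  natural_antilin : forall U k (a b : star_algebra U),
    natural (k *: a + b) = k^* *: natural a + natural b;
  natural_amap : forall (U V : C) (T : hom U V) (Tv : hom (dual U) (dual V))
      (a : star_algebra V),
    (idm U ⊠ Tv) ∘ evb U = (T^† ⊠ idm (dual V)) ∘ evb V ->
    natural (amap T a) = amap Tv (natural a);
  naturalK : forall U (a : star_algebra U),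
    amap (dual_dual U) (natural (natural a)) = a;
  natural1 : amap (dual_one C) (natural aone) = aone;
  natural_mul : forall U V (a : star_algebra U) (b : star_algebra V),
    natural a ⋅ natural b = amap (dual_tens U V) (natural (b ⋅ a))
}.
Notation "a ^♮" := (natural a) : cat_scope.

Section PreCstar.
Variables (R : realType) (C : rigid_Cstar_tensor_category R).
Variable A : star_algebra_object C.

Definition mul0 (a b : A one_ob) : A one_ob :=
  amap (eqm (esym (tens1o one_ob))) (a ⋅ b).

Definition star0 (a : A one_ob) : A one_ob := amap (dual_one C) a^♮.

Record is_Cstar_norm0 (nrm0 : A one_ob -> R) : Prop := IsCstarNorm0 {
  nrm0_complete : is_complete_norm nrm0;
  nrm0_submul : forall a b, nrm0 (mul0 a b) <= nrm0 a * nrm0 b;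
  nrm0_Cstar : forall a, nrm0 (mul0 (star0 a) a) = nrm0 a ^+ 2
}.

Definition inner0 U (a b : A U) : A one_ob := amap (ev U) (a ⋅ b^♮).

(* The involution M_A(X_A, Y_A) -> M_A(Y_A, X_A). *)
Definition mstar X Y (f : mhom A X Y) : mhom A Y X := amap (dual_hom X Y) f^♮.

(* A dagger on M_A is compatible when it extends the involution induced by ♮
   (on the X_A, and more generally between self-adjoint idempotents) and makes
   the action of C a bifunctor of dagger categories, with unitary structure
   isomorphisms. The objects of M_A are all idempotents, self-adjoint or not. *)
Record is_module_dagger (dg : dagger (module_category A)) : Prop :=
  IsModuleDagger {
  module_dagger_mstar : forall (E F : module_category A) (f : hom E F),
    mstar (kidem E) = kidem E -> mstar (kidem F) = kidem F ->
    kmor (dg _ _ f) = mstar (kmor f);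
  module_dagger_act : forall (E F : module_category A) (f : hom E F)
      (U V : C) (T : hom U V),
    dg _ _ (kact f T) = kact (dg _ _ f) T^†;
  module_dagger_assoc : forall (E : module_category A) (U V : C),
    is_unitary dg (kassoc E U V);
  module_dagger_unit : forall E : module_category A, is_unitary dg (kunit E)
}.

Definition is_Cstar_algebra_object : Prop :=
  exists (dg : dagger (module_category A))
    (nm : forall E F : module_category A, hom E F -> R),
    is_Cstar_category dg nm /\ is_module_dagger dg.

End PreCstar.

Record pre_Cstar_algebra_object R (C : rigid_Cstar_tensor_category R) :=
  PreCstarAlgebraObject {
  pre_Cstar_star :> star_algebra_object C;
  norm0 : pre_Cstar_star one_ob -> R;
  norm0P : is_Cstar_norm0 norm0;
  inner0_ge0 : forall U (a : pre_Cstar_star U),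
    exists x, inner0 a a = mul0 (star0 x) x
}.

Definition fiber_norm R (C : rigid_Cstar_tensor_category R)
    (A : pre_Cstar_algebra_object C) U (a : A U) : R :=
  Num.sqrt (norm0 (inner0 a a)).

Record is_star_morphism R (C : rigid_Cstar_tensor_category R)
    (A B : star_algebra_object C) (phi : forall U, A U -> B U) : Prop :=
  IsStarMorphism {
  morph_lin : forall U k (a b : A U), phi U (k *: a + b) = k *: phi U a + phi U b;
  morph_amap : forall (U V : C) (T : hom U V) (a : A V),
    phi U (amap T a) = amap T (phi V a);
  morph_mul : forall U V (a : A U) (b : A V), phi _ (a ⋅ b) = phi U a ⋅ phi V b;
  morph_one : phi _ aone = aone;
  morph_natural : forall U (a : A U), phi _ a^♮ = (phi U a)^♮
}.

(* B U, with the norm nm, is the separated completion of A U, and the structure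
   of B is the continuous extension of that of A. *)
Record is_fiberwise_completion R (C : rigid_Cstar_tensor_category R)
    (A : pre_Cstar_algebra_object C) (B : star_algebra_object C)
    (iota : forall U, A U -> B U) (nm : forall U, B U -> R) : Prop :=
  IsFiberwiseCompletion {
  completion_morph : is_star_morphism iota;
  completion_norm : forall U, is_complete_norm (nm U);
  completion_isometry : forall U (a : A U), nm U (iota U a) = fiber_norm a;
  completion_dense : forall U (b : B U) (e : R), 0 < e ->
    exists a : A U, nm U (b - iota U a) < e;
  completion_amap : forall (U V : C) (T : hom U V),
    exists M : R, forall b : B V, nm U (amap T b) <= M * nm V b;
  completion_mul : forall U V : C, exists M : R, forall (a : B U) (b : B V),
    nm (V ⊗ U) (a ⋅ b) <= M * nm U a * nm V b;
  completion_natural : forall U : C, exists M : R, forall b : B U,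
    nm (dual U) b^♮ <= M * nm U b
}.

(* Main.v *)
From HB Require Import structures.
Require Import Defs.
From mathcomp Require Import all_boot all_order all_algebra.
From mathcomp Require Import complex all_classical all_reals all_analysis.
From mathcomp Require Import ring lra.
Require Import Defs.

Set Implicit Arguments.
Unset Strict Implicit.
Unset Printing Implicit Defensive.

Import Order.TTheory GRing.Theory Num.Theory numFieldNormedType.Exports.

Local Open Scope classical_set_scope.
Local Open Scope ring_scope.
Local Open Scope complex_scope.
Local Open Scope cat_scope.

(** The fiberwise completion exists because the structure maps of A are bounded for
    the norms of the Hilbert modules A(U): see [amap_bound], [amul_bound] and
    [natural_bound], where each bound comes from a square root in a C*-algebra, or
    from the Cauchy-Schwarz inequality. They extend to the completion, which is
    built inside the space of maps from A(U) to A_0, and the axioms hold there by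
    density ([completion_exists]). Any completion B is again a pre-C*-algebra
    object, with the given norms as its fiber norms ([completion_pre],
    [completion_fiber_norm]); hence it is enough to treat a pre-C*-algebra object
    with complete fibers.

    For such an object the morphisms from X to Y are elements of the Hilbert module
    A(X ⊗ dual Y), and <g f, h> = <g, h f^†> ([inner0_mcomp_adj]). So f acts by right
    composition as an adjointable operator on the modules of morphisms into any Z.
    Its operator norm satisfies the C*-identity; it is largest when Z is the source of f
    ([rnorm_src]), and then it is equivalent to the norm of the fiber, hence a
    complete norm. That f^† f is a positive element follows from the positivity of
    <a f^†, a f^†> ([mdag_positive]). This makes the free modules a C*-category.

    The idempotents of the module category need not be self-adjoint. In a C*-algebra
    every idempotent e has a range projection p ([range_proj]), isomorphic to e, and
    the adjoint of h : e -> f is defined as p h^† f ([karoubi_Cstar]). Since the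
    range projection is unique, it is preserved by the action of C ([kproj_act]),
    and compatibility of the dagger with the action only has to be proved on free
    modules.

    The identities used on free modules, such as (g f)^† = f^† g^† or the compatibility
    of the involution with the action, compare different duals of the same object,
    and need the canonical isomorphisms between these duals to be unitary. For this
    the solutions of the conjugate equations must be tracial: the left and right
    traces that they define must agree. A solution that is balanced and minimizes the
    product of the norms is tracial, by a first variation argument ([ev_solution]);
    tensor products of tracial solutions are tracial ([solution_nest]); and for
    tracial solutions left and right transposes agree ([sphericality]), which gives
    the unitarity ([zigzag_isometry]).

    The facts on C*-algebras that are needed (square roots, the theorem of Kelley and
    Vaught that x^† x is positive, range projections) are derived directly from the
    axioms. *)

(** * Complete norms *)
Section CompleteNorm.
Variable R : realType.

Lemma Re_norm_real (t : R) : complex.Re `|t%:C| = `|t|.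
Proof. by rewrite normc_def /= expr0n addr0 sqrtr_sqr. Qed.

Lemma norm_ReE (k : R[i]) : `|k| = (complex.Re `|k|)%:C.
Proof. by rewrite normc_def. Qed.

Lemma Re_normM (k l : R[i]) : complex.Re `|k * l| = complex.Re `|k| * complex.Re `|l|.
Proof. by rewrite normrM (norm_ReE k) (norm_ReE l) -rmorphM. Qed.

Lemma Re_norm_ge0 (k : R[i]) : 0 <= complex.Re `|k|.
Proof. by rewrite normc_def /= sqrtr_ge0. Qed.

Lemma Re_norm_conj (k : R[i]) : complex.Re `|k^*%R| = complex.Re `|k|.
Proof. by rewrite norm_conjC. Qed.

Definition cauchy (V : zmodType) (nrm : V -> R) (u : nat -> V) :=
  forall e : R, 0 < e -> exists N, forall m n, (N <= m)%N -> (N <= n)%N ->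
    nrm (u m - u n) < e.

Definition tends (V : zmodType) (nrm : V -> R) (u : nat -> V) (v : V) :=
  forall e : R, 0 < e -> exists N, forall n, (N <= n)%N -> nrm (u n - v) < e.

Variables (V : lmodType R[i]) (nrm : V -> R).

Lemma complete_norm_intro :
  (forall v w, nrm (v + w) <= nrm v + nrm w) ->
  (forall k v, nrm (k *: v) = complex.Re `|k| * nrm v) ->
  (forall v, nrm v = 0 -> v = 0) ->
  (forall u, cauchy nrm u -> exists v, tends nrm u v) ->
  is_complete_norm nrm.
Proof.
move=> hD hZ h0 hc.
have n0 : nrm 0 = 0 by rewrite -(scale0r (0 : V)) hZ normr0 mul0r.
have hN v : nrm (- v) = nrm v.
  by rewrite -scaleN1r hZ normrN normr1 mul1r.
have hge v : 0 <= nrm v.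
  have := hD v (- v); rewrite subrr n0 hN => h.
  by rewrite -(pmulrn_lge0 _ (isT : 0 < 2)%N) mulr2n.
split=> // u hu.
have cu : cauchy nrm u.
  move=> e e0; have [[P Q] [/= [N1 _ h1] [N2 _ h2]] h] := hu e e0.
  exists (maxn N1 N2) => m n; rewrite !geq_max => /andP[m1 _] /andP[_ n2].
  by apply: (h (m, n)); split; [apply: h1|apply: h2].
have [v hv] := hc u cu; exists v.
apply/cvgrPdist_lt => e e0; have [N hN'] := hv e e0.
by exists N => //= n /= nN; rewrite sub0r normrN ger0_norm // hN'.
Qed.

Hypothesis hn : is_complete_norm nrm.

Lemma cn0 : nrm 0 = 0.
Proof. by rewrite -(scale0r (0 : V)) (nrm_scale hn) normr0 mul0r. Qed.

Lemma cnN v : nrm (- v) = nrm v.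
Proof. by rewrite -scaleN1r (nrm_scale hn) normrN normr1 mul1r. Qed.

Lemma cn_ge0 v : 0 <= nrm v.
Proof.
have := nrm_triangle hn v (- v); rewrite subrr cn0 cnN => h.
by rewrite -(pmulrn_lge0 _ (isT : 0 < 2)%N) mulr2n.
Qed.

Lemma cnB v w : nrm (v - w) <= nrm v + nrm w.
Proof. by rewrite -(cnN w); exact: nrm_triangle. Qed.

Lemma cnC v w : nrm (v - w) = nrm (w - v).
Proof. by rewrite -cnN opprB. Qed.

Lemma cnZr (t : R) v : nrm (t%:C *: v) = `|t| * nrm v.
Proof. by rewrite (nrm_scale hn) Re_norm_real. Qed.

Lemma cn_tri u v w : nrm (u - w) <= nrm (u - v) + nrm (v - w).
Proof. by rewrite -[u - w](subrKA v); exact: nrm_triangle. Qed.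

Lemma cn_dist v w : `|nrm v - nrm w| <= nrm (v - w).
Proof.
rewrite ler_norml; apply/andP; split.
  rewrite lerNl opprB lerBlDr cnC -[X in nrm X <= _](subrK v).
  exact: nrm_triangle.
by rewrite lerBlDr -[X in nrm X <= _](subrK w); exact: nrm_triangle.
Qed.

Lemma cn_small_eq0 v : (forall e : R, 0 < e -> nrm v <= e) -> v = 0.
Proof.
move=> h; apply: (nrm_eq0 hn); apply/eqP; rewrite eq_le cn_ge0 andbT.
by apply/ler_addgt0Pr => e e0; rewrite add0r h.
Qed.

Lemma complete_tends u : cauchy nrm u -> exists v, tends nrm u v.
Proof.
move=> hu; have [|v hv] := nrm_complete hn (u := u).
  move=> e e0; have [N hN] := hu e e0.
  exists ([set m | (N <= m)%N], [set m | (N <= m)%N]) => /=.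
    by split; exists N.
  by move=> [m n] [/= m1 n1]; apply: hN.
exists v => e e0; have /cvgrPdist_lt /(_ e e0) [N _ hN] := hv.
exists N => n nN; have := hN n nN; rewrite /= sub0r normrN ger0_norm //.
exact: cn_ge0.
Qed.

Lemma tends_unique u v w : tends nrm u v -> tends nrm u w -> v = w.
Proof.
move=> hv hw; apply/eqP; rewrite -subr_eq0; apply/eqP/cn_small_eq0 => e e0.
have e2 : 0 < e / 2 by rewrite divr_gt0.
have [N1 h1] := hv _ e2; have [N2 h2] := hw _ e2.
pose n := maxn N1 N2.
have /ltW a1 := h1 n (leq_maxl _ _); have /ltW a2 := h2 n (leq_maxr _ _).
by rewrite (le_trans (cn_tri _ (u n) _)) // cnC [e]splitr lerD.
Qed.

Lemma tends_norm_le u v (M : R) : tends nrm u v -> (forall n, nrm (u n) <= M) ->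
  nrm v <= M.
Proof.
move=> hv hM; apply/ler_addgt0Pr => e e0; have [N hN] := hv e e0.
have := hN N (leqnn _); rewrite cnC => /ltW h.
rewrite -[v](subrK (u N)) (le_trans (nrm_triangle hn _ _)) // addrC lerD //.
Qed.

End CompleteNorm.

(** * C*-algebras *)

(** The norm of the unit is not fixed, so that the zero algebra, for instance the
    endomorphisms of a zero object, is included. *)
Record cstar (R : realType) := CStar {
  cs_car : lmodType R[i];
  cs_mul : cs_car -> cs_car -> cs_car;
  cs_one : cs_car;
  cs_star : cs_car -> cs_car;
  cs_norm : cs_car -> R;
  cs_mulA : forall a b c, cs_mul a (cs_mul b c) = cs_mul (cs_mul a b) c;
  cs_mul1 : forall a, cs_mul a cs_one = a;
  cs_1mul : forall a, cs_mul cs_one a = a;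
  cs_linl : forall k a b c,
    cs_mul (k *: a + b) c = k *: cs_mul a c + cs_mul b c;
  cs_linr : forall k a b c,
    cs_mul a (k *: b + c) = k *: cs_mul a b + cs_mul a c;
  cs_antilin : forall k a b,
    cs_star (k *: a + b) = k^* *: cs_star a + cs_star b;
  cs_starK : forall a, cs_star (cs_star a) = a;
  cs_starM : forall a b, cs_star (cs_mul a b) = cs_mul (cs_star b) (cs_star a);
  cs_normP : is_complete_norm cs_norm;
  cs_submul : forall a b, cs_norm (cs_mul a b) <= cs_norm a * cs_norm b;
  cs_Cstar : forall a, cs_norm (cs_mul (cs_star a) a) = cs_norm a ^+ 2
}.

Definition celt (R : realType) (A : cstar R) : Type := cs_car A.

HB.instance Definition _ (R : realType) (A : cstar R) :=
  GRing.Zmodule.copy (celt A) (cs_car A).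

Section CstarRing.
Variables (R : realType) (A : cstar R).

Fact celt_mulDl : left_distributive (@cs_mul R A : celt A -> celt A -> celt A) +%R.
Proof. by move=> a b c; have := cs_linl 1 a b c; rewrite !scale1r. Qed.

Fact celt_mulDr : right_distributive (@cs_mul R A : celt A -> celt A -> celt A) +%R.
Proof. by move=> a b c; have := cs_linr 1 a b c; rewrite !scale1r. Qed.

HB.instance Definition _ := GRing.Zmodule_isPzRing.Build (celt A)
  (@cs_mulA R A) (@cs_1mul R A) (@cs_mul1 R A) celt_mulDl celt_mulDr.

End CstarRing.

Reserved Notation "k **: a" (at level 40, left associativity).

Section CstarTheory.
Variables (R : realType) (A : cstar R).
Implicit Types (a b c h x y : celt A) (k : R[i]) (s t : R).

Definition nr (a : celt A) : R := cs_norm a.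
Definition st (a : celt A) : celt A := cs_star a.

Definition sc k a : celt A := k *: (a : cs_car A).
Local Notation "k **: a" := (sc k a).

Lemma nrP : is_complete_norm (nr : cs_car A -> R). Proof. exact: cs_normP. Qed.

Lemma csZl k a b : (k **: a) * b = k **: (a * b).
Proof.
have := cs_linl k a 0 b; rewrite addr0 => h.
rewrite -[LHS]/(cs_mul (GRing.scale k (a : cs_car A)) b) h.
by rewrite -[cs_mul 0 b]/((0 : celt A) * b) mul0r addr0.
Qed.

Lemma csZr k a b : a * (k **: b) = k **: (a * b).
Proof.
have := cs_linr k a b 0; rewrite addr0 => h.
rewrite -[LHS]/(cs_mul a (GRing.scale k (b : cs_car A))) h.
by rewrite -[cs_mul a 0]/(a * (0 : celt A)) mulr0 addr0.
Qed.

Lemma csZDr k a b : k **: (a + b) = k **: a + k **: b. Proof. exact: scalerDr. Qed.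
Lemma csZBr k a b : k **: (a - b) = k **: a - k **: b. Proof. exact: scalerBr. Qed.
Lemma csZDl k l a : (k + l) **: a = k **: a + l **: a. Proof. exact: scalerDl. Qed.
Lemma csZA k l a : k **: (l **: a) = (k * l)%R **: a. Proof. exact: scalerA. Qed.
Lemma cs1Z a : 1 **: a = a. Proof. exact: scale1r. Qed.
Lemma csZN k a : k **: (- a) = - (k **: a). Proof. exact: scalerN. Qed.

Lemma stD a b : st (a + b) = st a + st b.
Proof. by have := cs_antilin 1 a b; rewrite conjC1 !scale1r. Qed.

Lemma st0 : st 0 = 0.
Proof. by apply: (addrI (st 0)); rewrite -stD !addr0. Qed.

Lemma stZ k a : st (k **: a) = k^*%R **: st a.
Proof.
have := cs_antilin k a 0; rewrite addr0 => h.
rewrite -[LHS]/(cs_star (GRing.scale k (a : cs_car A))) h.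
by rewrite -[cs_star 0]/(st 0) st0 addr0.
Qed.

Lemma stZr t a : st (t%:C **: a) = t%:C **: st a.
Proof. by rewrite stZ conj_Creal // complex_real. Qed.

Lemma stN a : st (- a) = - st a.
Proof. by apply: (addIr (st a)); rewrite -stD !addNr st0. Qed.

Lemma stB a b : st (a - b) = st a - st b.
Proof. by rewrite stD stN. Qed.

Lemma stK a : st (st a) = a. Proof. exact: cs_starK. Qed.

Lemma stM a b : st (a * b) = st b * st a. Proof. exact: cs_starM. Qed.

Lemma st1 : st 1 = 1.
Proof. by rewrite -[RHS]stK -[st 1]mulr1 stM stK mulr1. Qed.

Lemma nrM a b : nr (a * b) <= nr a * nr b. Proof. exact: cs_submul. Qed.
Lemma nrC a : nr (st a * a) = nr a ^+ 2. Proof. exact: cs_Cstar. Qed.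

Lemma nr_ge0 a : 0 <= nr a. Proof. exact: cn_ge0 nrP a. Qed.
Lemma nr0 : nr 0 = 0. Proof. exact: cn0 nrP. Qed.
Lemma nrN a : nr (- a) = nr a. Proof. exact: cnN nrP a. Qed.
Lemma nrD a b : nr (a + b) <= nr a + nr b. Proof. exact: nrm_triangle nrP a b. Qed.
Lemma nrZ t a : nr (t%:C **: a) = `|t| * nr a. Proof. exact: cnZr nrP t a. Qed.
Lemma nr_eq0 a : nr a = 0 -> a = 0. Proof. exact: nrm_eq0 nrP a. Qed.

Lemma nr_st_le a : nr a <= nr (st a).
Proof.
have [/eqP->|a0] := boolP (a == 0); first by rewrite st0 nr0.
have na : 0 < nr a.
  by rewrite lt_def nr_ge0 andbT; apply: contraNN a0 => /eqP/nr_eq0 ->.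
by rewrite -(ler_pM2r na) -expr2 -nrC nrM.
Qed.

Lemma nr_st a : nr (st a) = nr a.
Proof. by apply/eqP; rewrite eq_le nr_st_le -{2}[a]stK nr_st_le. Qed.

Lemma nr_le1 : nr 1 <= 1.
Proof.
have := nrC 1; rewrite st1 mulr1 => h.
have [->|n0] := eqVneq (nr 1) 0; first exact: ler01.
have := h; rewrite expr2 -{1}[nr 1]mulr1 => /(mulfI n0) <- //.
Qed.

Lemma sqr_sa h : st h = h -> nr (h * h) = nr h ^+ 2.
Proof. by move=> hh; rewrite -nrC hh. Qed.

Lemma sa_sqr_eq0 h : st h = h -> h * h = 0 -> h = 0.
Proof.
move=> sh h2; apply: nr_eq0; apply/eqP; rewrite -sqrf_eq0; apply/eqP.
by rewrite -sqr_sa // h2 nr0.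
Qed.

(** ** Square roots *)

Lemma tendsM (u v : nat -> celt A) x y :
  tends nr u x -> tends nr v y -> tends nr (fun n => u n * v n) (x * y).
Proof.
move=> hu hv e e0.
have [N1 h1] := hu 1 ltr01.
pose B := nr x + 1; have B0 : 0 < B by rewrite ltr_wpDl // nr_ge0.
pose D := nr y + 1; have D0 : 0 < D by rewrite ltr_wpDl // nr_ge0.
have [N2 h2] := hv (e / 2 / B) (divr_gt0 (divr_gt0 e0 (ltr0Sn R 1)) B0).
have [N3 h3] := hu (e / 2 / D) (divr_gt0 (divr_gt0 e0 (ltr0Sn R 1)) D0).
exists (maxn N1 (maxn N2 N3)) => n; rewrite !geq_max => /and3P[n1 n2 n3].
have -> : u n * v n - x * y = u n * (v n - y) + (u n - x) * y.
  by rewrite mulrBr mulrBl subrKA.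
apply: le_lt_trans (nrD _ _) _; rewrite [e]splitr.
have un : nr (u n) <= B.
  rewrite -[u n](subrK x) (le_trans (nrD _ _)) // addrC lerD //.
  by apply: ltW; apply: h1.
apply: ltr_leD.
  apply: le_lt_trans (nrM _ _) _.
  apply: le_lt_trans (ler_wpM2r (nr_ge0 _) un) _.
  by rewrite mulrC -ltr_pdivlMr // h2.
apply: le_trans (nrM _ _) _.
apply: le_trans (ler_wpM2l (nr_ge0 _) (_ : nr y <= D)) _.
  by rewrite lerDl ler01.
by rewrite -ler_pdivlMr // ltW // h3.
Qed.

Lemma tends_cst x : tends nr (fun=> x) x.
Proof. by move=> e e0; exists 0%N => n _; rewrite subrr nr0. Qed.

Lemma tendsD (u v : nat -> celt A) x y :
  tends nr u x -> tends nr v y -> tends nr (fun n => u n + v n) (x + y).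
Proof.
move=> hu hv e e0; have e2 : 0 < e / 2 by rewrite divr_gt0.
have [N1 h1] := hu _ e2; have [N2 h2] := hv _ e2.
exists (maxn N1 N2) => n; rewrite geq_max => /andP[n1 n2].
rewrite opprD addrACA (le_lt_trans (nrD _ _)) // [e]splitr ltrD ?h1 ?h2 //.
Qed.

Lemma tendsZ k (u : nat -> celt A) x :
  tends nr u x -> tends nr (fun n => k **: u n) (k **: x).
Proof.
move=> hu e e0; have B0 : 0 < complex.Re `|k| + 1 by rewrite ltr_wpDl // Re_norm_ge0.
have [N hN] := hu (e / (complex.Re `|k| + 1)) (divr_gt0 e0 B0).
exists N => n nN; rewrite -csZBr [nr _](nrm_scale nrP).
apply: le_lt_trans (_ : (complex.Re `|k| + 1) * nr (u n - x) < e).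
  by rewrite ler_wpM2r ?nr_ge0 // lerDl ler01.
by rewrite mulrC -ltr_pdivlMr // hN.
Qed.

Lemma tends_st (u : nat -> celt A) x :
  tends nr u x -> tends nr (fun n => st (u n)) (st x).
Proof.
move=> hu e e0; have [N hN] := hu e e0.
by exists N => n nN; rewrite -stB nr_st hN.
Qed.

Lemma tends_shift (u : nat -> celt A) x :
  tends nr u x -> tends nr (fun n => u n.+1) x.
Proof.
move=> hu e e0; have [N hN] := hu e e0; exists N => n nN.
by apply: hN; rewrite (leq_trans nN).
Qed.

(** Iteration of y |-> (h + y^2) / 2; at a fixed point y, 1 - y is a square root
    of 1 - h. *)
Fixpoint sqit h n : celt A :=
  if n is m.+1 then (2^-1)%:C **: (h + sqit h m * sqit h m) else 0.

(** The same iteration for the real number 1: it increases, is bounded by 1, and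
    majorizes both the iterates and their increments for any h of norm at most 1. *)
Fixpoint sqmaj n : R := if n is m.+1 then 2^-1 * (1 + sqmaj m ^+ 2) else 0.

Lemma sqmaj_bnd n : 0 <= sqmaj n <= 1.
Proof. elim: n => [|n /andP[h0 h1]] /=; first by rewrite lexx ler01. nra. Qed.

Lemma sqit_comm h x n : x * h = h * x -> x * sqit h n = sqit h n * x.
Proof.
move=> xh; elim: n => [|n IH] /=; first by rewrite mulr0 mul0r.
rewrite csZr csZl mulrDr mulrDl xh; congr (_ **: (_ + _)).
by rewrite mulrA IH -mulrA IH mulrA.
Qed.

Lemma sqit_sa h n : st h = h -> st (sqit h n) = sqit h n.
Proof.
move=> hh; elim: n => [|n IH] /=; first exact: st0.
by rewrite stZr stD stM hh IH.
Qed.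

Lemma half_ge0 : 0 <= 2^-1 :> R. Proof. by rewrite invr_ge0. Qed.

Lemma sqit_norm h n : nr h <= 1 -> nr (sqit h n) <= sqmaj n.
Proof.
move=> h1; elim: n => [|n IH] /=; first by rewrite nr0.
rewrite nrZ ger0_norm ?half_ge0 // ler_wpM2l ?half_ge0 //.
rewrite (le_trans (nrD _ _)) // lerD // (le_trans (nrM _ _)) // expr2.
by rewrite ler_pM ?nr_ge0.
Qed.

(** The increments factor as (y - y') (y + y') / 2, since the iterates commute. *)
Lemma sqit_step h n : nr h <= 1 ->
  nr (sqit h n.+1 - sqit h n) <= sqmaj n.+1 - sqmaj n.
Proof.
move=> h1; elim: n => [|n IH].
  rewrite [sqit h 0]/= [sqmaj 0]/= !subr0; exact: sqit_norm h 1 h1.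
have -> : sqit h n.+2 - sqit h n.+1 = (2^-1)%:C **:
    ((sqit h n.+1 - sqit h n) * (sqit h n.+1 + sqit h n)).
  rewrite [X in X - _ = _](_ : _ = (2^-1)%:C **: (h + sqit h n.+1 * sqit h n.+1)) //.
  rewrite [X in _ - X = _](_ : _ = (2^-1)%:C **: (h + sqit h n * sqit h n)) //.
  rewrite -csZBr opprD addrACA subrr add0r mulrBl !mulrDr.
  have c : sqit h n.+1 * sqit h n = sqit h n * sqit h n.+1.
    apply: sqit_comm; symmetry; exact: sqit_comm.
  by rewrite c opprD addrACA subrKA.
have -> : sqmaj n.+2 - sqmaj n.+1 =
    2^-1 * ((sqmaj n.+1 - sqmaj n) * (sqmaj n.+1 + sqmaj n)).
  rewrite [X in X - _ = _](_ : _ = 2^-1 * (1 + sqmaj n.+1 ^+ 2)) //.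
  rewrite [X in _ - X = _](_ : _ = 2^-1 * (1 + sqmaj n ^+ 2)) //.
  rewrite -mulrBr; congr (_ * _).
  by rewrite opprD addrACA subrr add0r -subr_sqr.
rewrite nrZ ger0_norm ?half_ge0 // ler_wpM2l ?half_ge0 //.
rewrite (le_trans (nrM _ _)) // ler_pM ?nr_ge0 //.
by rewrite (le_trans (nrD _ _)) // lerD ?sqit_norm.
Qed.

Lemma sqit_step_n h m n : nr h <= 1 ->
  nr (sqit h (n + m) - sqit h n) <= sqmaj (n + m) - sqmaj n.
Proof.
move=> h1; elim: m => [|m IH]; first by rewrite addn0 !subrr nr0.
rewrite addnS -[sqit h (n + m).+1](subrK (sqit h (n + m))) -addrA.
rewrite (le_trans (nrD _ _)) // -[sqmaj (n + m).+1](subrK (sqmaj (n + m))).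
by rewrite -addrA lerD ?sqit_step.
Qed.

Lemma sqit_cauchy h : nr h <= 1 -> cauchy nr (sqit h).
Proof.
move=> h1 e e0; pose E := [set sqmaj n | n in setT].
have hE : has_sup E.
  split; first by exists (sqmaj 0), 0%N.
  by exists 1 => _ [n _ <-]; have /andP[] := sqmaj_bnd n.
have e2 : 0 < e / 2 by rewrite divr_gt0.
have [_ [N _ <-] hN] := sup_adherent e2 hE; exists N.
have near n : (N <= n)%N -> nr (sqit h n - sqit h N) < e / 2.
  move=> nN; rewrite -(subnKC nN); apply: le_lt_trans (sqit_step_n _ _ h1) _.
  rewrite subnKC // ltrBlDr (le_lt_trans (_ : _ <= sup E)) //.
    by apply: ub_le_sup; [exact: hE.2|exists n].
  by rewrite addrC -ltrBlDr.
move=> m n /near hm /near hn.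
apply: le_lt_trans (cn_tri nrP _ (sqit h N) _) _.
by rewrite [X in _ + X](cnC nrP) [e]splitr ltrD.
Qed.

Lemma nr_complete (u : nat -> celt A) : cauchy nr u -> exists x, tends nr u x.
Proof. exact: (complete_tends nrP). Qed.

Lemma tends_uniq (u : nat -> celt A) x y : tends nr u x -> tends nr u y -> x = y.
Proof. exact: (tends_unique nrP). Qed.

Lemma half_dbl a : (2^-1)%:C **: (a + a) = a.
Proof.
rewrite csZDr -csZDl -[RHS]cs1Z; congr (_ **: _).
by rewrite -rmorphD /= -[X in (X + X)%:C]mul1r -splitr.
Qed.

(** The bound on 1 - y and the commutation of y with whatever commutes with h are
    what makes y usable as the positive square root. *)
Lemma sqrt_unit h : st h = h -> nr h <= 1 ->
  exists y, [/\ st y = y, y * y = 1 - h, nr (1 - y) <= 1 &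
                forall x, x * h = h * x -> x * y = y * x].
Proof.
move=> sh h1; have [z hz] := nr_complete (sqit_cauchy h1).
have ez : z = (2^-1)%:C **: (h + z * z).
  apply: (tends_uniq (tends_shift hz)).
  exact: tendsZ (tendsD (tends_cst h) (tendsM hz hz)).
have e2 : z + z = h + z * z.
  by rewrite {1 2}ez -csZDr half_dbl.
exists (1 - z); split.
- rewrite stB st1; congr (_ - _).
  apply: (tends_uniq _ hz).
  have := tends_st hz; rewrite (_ : (fun n => _) = sqit h) //.
  by apply/funext => n; rewrite sqit_sa.
- have e3 : z * z = z + z - h by rewrite e2 addrC addKr.
  by rewrite mulrBl mul1r mulrBr mulr1 opprB e3 [_ - h - z]addrAC addrK subrKA.
- rewrite opprB addrCA subrr addr0; apply: (tends_norm_le nrP hz) => n.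
  by rewrite (le_trans (sqit_norm n h1)) //; have /andP[] := sqmaj_bnd n.
- move=> x xh; rewrite mulrBr mulrBl mulr1 mul1r; congr (_ - _).
  apply: (tends_uniq (tendsM (tends_cst x) hz)).
  have := tendsM hz (tends_cst x); congr (tends _ _ _).
  by apply/funext => n /=; rewrite sqit_comm.
Qed.

Lemma csNZ k a : (- k) **: a = - (k **: a). Proof. exact: scaleNr. Qed.

Definition sr t : celt A := t%:C **: 1.

Lemma srM t a : sr t * a = t%:C **: a. Proof. by rewrite csZl mul1r. Qed.
Lemma Msr t a : a * sr t = t%:C **: a. Proof. by rewrite csZr mulr1. Qed.
Lemma st_sr t : st (sr t) = sr t. Proof. by rewrite stZr st1. Qed.
Lemma sr_comm t a : a * sr t = sr t * a. Proof. by rewrite srM Msr. Qed.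
Lemma srD s t : sr (s + t) = sr s + sr t.
Proof. by rewrite /sr rmorphD csZDl. Qed.
Lemma sr0 : sr 0 = 0.
Proof. by apply: (addrI (sr 0)); rewrite -srD !addr0. Qed.
Lemma nr_sr_le t : 0 <= t -> nr (sr t) <= t.
Proof. by move=> t0; rewrite nrZ ger0_norm // ler_piMr // nr_le1. Qed.

(** ** Positive elements *)
(** For a self-adjoint h this says that the spectrum is nonnegative: it lies in
    [0, 2t] exactly when h is at distance at most t from t. *)
Definition Pos h := st h = h /\ exists2 t, 0 <= t & nr (sr t - h) <= t.

Lemma pos_sqrt h : Pos h -> exists y, [/\ Pos y, y * y = h &
  forall x, x * h = h * x -> x * y = y * x].
Proof.
move=> [sh [t t0 ht]]; have [t00|tn0] := eqVneq t 0.
  have h0 : h = 0.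
    move: ht; rewrite t00 sr0 sub0r nrN => ht.
    by apply: nr_eq0; apply/eqP; rewrite eq_le ht nr_ge0.
  exists 0; split; last by move=> x _; rewrite mulr0 mul0r.
    by split; [exact: st0|exists 0; rewrite ?sr0 ?subrr ?nr0].
  by rewrite mulr0 h0.
have tp : 0 < t by rewrite lt_def tn0.
pose g := t^-1%:C **: (sr t - h).
have sg : st g = g by rewrite /g stZr stB st_sr sh.
have g1 : nr g <= 1.
  by rewrite nrZ gtr0_norm ?invr_gt0 // mulrC ler_pdivrMr // mul1r.
have eg : t%:C **: (1 - g) = h.
  rewrite csZBr csZA -rmorphM /= mulfV // cs1Z opprB addrCA subrr addr0 //.
have [y [sy yy y1 hy]] := sqrt_unit sg g1.
pose r := Num.sqrt t; have rr : r * r = t by rewrite -expr2 sqr_sqrtr // ltW.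
exists (r%:C **: y); split.
- split; first by rewrite stZr sy.
  exists r; first exact: sqrtr_ge0.
  by rewrite -csZBr nrZ ger0_norm ?sqrtr_ge0 // ler_piMr ?sqrtr_ge0.
- by rewrite csZl csZr csZA -rmorphM /= rr yy.
- move=> x xh; rewrite csZl csZr; congr (_ **: _); apply: hy.
  by rewrite /g csZl csZr mulrBl mulrBr xh sr_comm.
Qed.

Lemma ImulI : ('i * 'i = -1 :> R[i])%C. Proof. by rewrite -expr2 sqr_i. Qed.
Lemma conjI : ('i%C : R[i])^*%R = - 'i%C. Proof. by simpc. Qed.

Lemma nrI a : nr ('i%C **: a) = nr a.
Proof.
rewrite [nr _](nrm_scale nrP) normc_def /= expr0n expr1n add0r sqrtr1.
by rewrite mul1r.
Qed.

(** c + i d is normal, and d is its imaginary part. *)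
Lemma comm_sqr_le c d t : st c = c -> st d = d -> c * d = d * c -> 0 <= t ->
  c * c + d * d = sr t -> nr (d * d) <= t.
Proof.
move=> sc sd cd t0 e; pose u := c + 'i%C **: d.
have su : st u = c - 'i%C **: d.
  by rewrite stD stZ sc sd conjI csNZ.
have uu : st u * u = sr t.
  rewrite su /u mulrBl !mulrDr !csZl !csZr cd csZA ImulI csNZ cs1Z.
  by rewrite opprD opprK addrA addrK -e.
have hu : u - st u = 'i%C **: (d + d).
  by rewrite su /u opprB addrC subrKA csZDr.
have : nr (d + d) <= nr u + nr u.
  by rewrite -nrI -hu (le_trans (nrD _ _)) // nrN nr_st.
have -> : d + d = 2%:C **: d by rewrite -{1 2}[d]cs1Z -csZDl -rmorphD.
rewrite nrZ ger0_norm // => hd.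
have {}hd : nr d <= nr u by lra.
rewrite sqr_sa // (le_trans (_ : _ <= nr u ^+ 2)) ?lerXn2r ?nnegrE ?nr_ge0 //.
by rewrite -nrC uu nr_sr_le.
Qed.

Lemma sqr_comm a x : x * a = a * x -> x * (a * a) = (a * a) * x.
Proof. by move=> e; rewrite mulrA e -mulrA e mulrA. Qed.

(** With w the square root of 1 - y^2, the element y + i w is unitary. *)
Lemma sqr_unit_pos y : st y = y -> nr y <= 1 -> nr (1 - y * y) <= 1.
Proof.
move=> sy y1.
have n1 : nr (y * y) <= 1 by rewrite sqr_sa // expr_le1 // nr_ge0.
have sa : st (y * y) = y * y by rewrite stM sy.
have [w [sw ww _ hw]] := sqrt_unit sa n1.
rewrite -ww; apply: (@comm_sqr_le y) => //; first exact: (hw _ (sqr_comm _)).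
by rewrite ww addrC subrK /sr cs1Z.
Qed.

Lemma sqr_pos y : st y = y -> Pos (y * y).
Proof.
move=> sy; split; first by rewrite stM sy.
have [y0|n0] := eqVneq (nr y) 0.
  by exists 0 => //; rewrite (nr_eq0 y0) mulr0 subr0 sr0 nr0.
have yp : 0 < nr y by rewrite lt_def n0 nr_ge0.
exists (nr y ^+ 2); first exact: sqr_ge0.
pose g := (nr y)^-1%:C **: y.
have := @sqr_unit_pos g; rewrite /g stZr sy => /(_ erefl).
rewrite nrZ gtr0_norm ?invr_gt0 // mulVf // lexx => /(_ isT) h.
rewrite (_ : sr _ - _ = (nr y ^+ 2)%:C **: (1 - g * g)).
  by rewrite nrZ ger0_norm ?sqr_ge0 // ler_piMr ?sqr_ge0.
rewrite csZBr /g csZl csZr !csZA -!rmorphM /= (_ : nr y ^+ 2 / nr y / nr y = 1) ?cs1Z //.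
by field.
Qed.

(** The constant t in the definition of Pos can be any bound of the norm: the
    square roots y of h and w of t - h commute and y^2 + w^2 = t. *)
Lemma pos_le_norm h t : Pos h -> nr h <= t -> nr (sr t - h) <= t.
Proof.
move=> ph ht; have sh := ph.1.
have t0 : 0 <= t := le_trans (nr_ge0 _) ht.
have [y [[sy _] yy hy]] := pos_sqrt ph.
have pw : Pos (sr t - h).
  split; first by rewrite stB st_sr sh.
  by exists t => //; rewrite opprB addrCA subrr addr0.
have [w [[sw _] ww hw]] := pos_sqrt pw.
rewrite -ww; apply: (@comm_sqr_le y) => //; last by rewrite yy ww addrC subrK.
by apply: hw; rewrite mulrBr mulrBl sr_comm -yy mulrA.
Qed.

Lemma posD a b : Pos a -> Pos b -> Pos (a + b).
Proof.
move=> [sa [s s0 hs]] [sb [t t0 ht]]; split; first by rewrite stD sa sb.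
exists (s + t); first exact: addr_ge0.
by rewrite srD opprD addrACA (le_trans (nrD _ _)) // lerD.
Qed.

Lemma posZ t a : 0 <= t -> Pos a -> Pos (t%:C **: a).
Proof.
move=> t0 [sa [s s0 hs]]; split; first by rewrite stZr sa.
exists (t * s); first exact: mulr_ge0.
by rewrite /sr rmorphM -csZA -csZBr nrZ ger0_norm // ler_wpM2l.
Qed.

Lemma pos_closed u h : (forall n, Pos (u n)) -> tends nr u h -> Pos h.
Proof.
move=> pu hu; split.
  apply: (tends_uniq (tends_st hu)); rewrite (_ : (fun n => _) = u) //.
  by apply/funext => n; have [] := pu n.
exists (nr h + 1); first by rewrite addr_ge0 ?nr_ge0.
apply/ler_addgt0Pr => e e0.
have [N1 h1] := hu 1 ltr01; have [N2 h2] := hu e e0.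
pose n := maxn N1 N2.
have {}h1 := ltW (h1 n (leq_maxl _ _)); have {}h2 := ltW (h2 n (leq_maxr _ _)).
rewrite -[sr _ - h](subrKA (u n)) (le_trans (nrD _ _)) // lerD //.
apply: pos_le_norm => //.
by rewrite -[u n](subrK h) (le_trans (nrD _ _)) // addrC lerD.
Qed.

(** The square roots of a and of |b| - a are commuting and their squares add up to
    |b|. *)
Lemma pos_mono a b : Pos a -> Pos (b - a) -> nr a <= nr b.
Proof.
move=> pa pba; pose s := nr b.
have sb : st b = b by rewrite -[b](subrK a) stD pba.1 pa.1.
have pb : Pos (sr s - b).
  split; first by rewrite stB st_sr sb.
  by exists s; rewrite ?nr_ge0 // opprB addrCA subrr addr0.
have ps : Pos (sr s - a) by rewrite -(subrKA b); apply: posD.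
have [y [[sy _] yy hy]] := pos_sqrt pa.
have [w [[sw _] ww hw]] := pos_sqrt ps.
rewrite -{1}yy; apply: (@comm_sqr_le w) => //; rewrite ?nr_ge0 //.
  by symmetry; apply: hw; rewrite mulrBr mulrBl sr_comm -yy mulrA.
by rewrite yy ww subrK.
Qed.

Lemma pos_comm a b : Pos a -> Pos b -> a * b = b * a -> Pos (a * b).
Proof.
move=> pa pb ab.
have [y [[sy _] yy hy]] := pos_sqrt pa.
have [w [[sw _] ww hw]] := pos_sqrt pb.
have yb : y * b = b * y by symmetry; apply: hy; rewrite ab.
have yw : y * w = w * y by apply: hw.
rewrite (_ : a * b = (y * w) * (y * w)).
  by apply: sqr_pos; rewrite stM sy sw yw.
by rewrite -yy -ww !mulrA -[y * w * y]mulrA -yw mulrA.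
Qed.

Lemma csZ2 a : 2%:C **: a = a + a.
Proof. by rewrite -{2 3}[a]cs1Z -csZDl -rmorphD. Qed.

(** yy* + y*y is twice the sum of the squares of the real and imaginary parts. *)
Lemma pos_sum_stM y : Pos (y * st y + st y * y).
Proof.
pose a := y + st y; pose b := 'i%C **: (y - st y).
have sa : st a = a by rewrite stD stK addrC.
have sb : st b = b by rewrite stZ stB stK conjI csNZ -csZN opprB.
have e : a * a + b * b = 2%:C **: (y * st y + st y * y).
  rewrite /a /b csZl csZr csZA ImulI csNZ cs1Z -mulNr opprB.
  rewrite !mulrDl !mulrDr !mulNr !mulrN csZ2.
  set p := y * y; set q := y * st y; set r := st y * y; set s := st y * st y.
  rewrite opprK [r - s + _]addrC addrACA [p + q]addrC [r - s]addrC.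
  by rewrite !addrA !addrK [q + q + r]addrAC.
have := posZ half_ge0 (posD (sqr_pos sa) (sqr_pos sb)).
by rewrite e csZA -rmorphM /= mulVf // cs1Z.
Qed.

(** If y*y is negative then yy* is positive, and both have norm |y|^2 = t; but
    y (t + y*y) y* = t q + q^2 for q = yy*, so that the norm of 2 q^2 is at most
    t^2. *)
Lemma neg_stM_eq0 y : Pos (- (st y * y)) -> y = 0.
Proof.
move=> pn; pose q := y * st y; pose t := nr y ^+ 2.
have pq : Pos q.
  have := posD (pos_sum_stM y) pn; rewrite addrK //.
have nq : nr q = t by rewrite /q -{1}[y]stK nrC nr_st.
have np : nr (sr t + st y * y) <= t.
  rewrite -[st y * y]opprK; apply: pos_le_norm => //.
  by rewrite nrN nrC.
have e : y * (sr t + st y * y) * st y = sr t * q + q * q.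
  by rewrite mulrDr mulrDl sr_comm !mulrA.
have n2 : nr (sr t * q + q * q) <= t * t.
  rewrite -e (le_trans (nrM _ _)) // nr_st.
  rewrite (le_trans (ler_wpM2r (nr_ge0 _) (nrM _ _))) //.
  by rewrite mulrAC -expr2 -/t ler_wpM2l ?sqr_ge0.
have pd : Pos (sr t * q + q * q - (q * q + q * q)).
  rewrite opprD addrA addrK -sr_comm -mulrBr; apply: pos_comm => //.
    split; first by rewrite stB st_sr pq.1.
    by exists t; rewrite ?sqr_ge0 // opprB addrCA subrr addr0 nq.
  by rewrite mulrBr mulrBl sr_comm.
have h := le_trans (pos_mono (posD (sqr_pos pq.1) (sqr_pos pq.1)) pd) n2.
rewrite -csZ2 nrZ ger0_norm // (sqr_sa pq.1) nq in h.
have t0 : t = 0.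
  apply/eqP; rewrite -sqrf_eq0 eq_le sqr_ge0 andbT.
  by move: h; rewrite -expr2; lra.
by apply: nr_eq0; apply/eqP; rewrite -sqrf_eq0 -/t t0.
Qed.

(** Kelley and Vaught: with a = x*x, b = |a| and c = b - a, twice the negative
    part of a, the element y = x c satisfies y*y = - b c^2. *)
Theorem stM_pos x : Pos (st x * x).
Proof.
pose a := st x * x; have sa : st a = a by rewrite stM stK.
have [b [pb bb hb]] := pos_sqrt (sqr_pos sa).
have sb := pb.1.
have ab : a * b = b * a by apply: hb; rewrite mulrA.
pose c := b - a; have scc : st c = c by rewrite stB sa sb.
have bc : b * c = c * b by rewrite mulrBr mulrBl ab.
have ca : c * a = - (b * c) by rewrite mulrBl mulrBr bb opprB.
have ac : a * c = - (b * c) by rewrite !mulrBr opprB ab bb.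
have c2 : c * c = b * c + b * c by rewrite {1}/c mulrBl ac opprK.
have [d [[sd _] dd hd]] := pos_sqrt pb.
have cd : c * d = d * c by apply: hd; rewrite bc.
have dc2 : (d * c) * (d * c) = b * (c * c).
  by rewrite mulrA -[d * c * d]mulrA cd mulrA dd -mulrA.
have e : st (x * c) * (x * c) = - ((d * c) * (d * c)).
  have e0 : c * (a * c) = - (b * (c * c)) by rewrite ac mulrN [c * (b * c)]mulrA -bc -mulrA.
  by rewrite stM scc dc2 -e0 /a !mulrA.
have y0 : x * c = 0.
  by apply: neg_stM_eq0; rewrite e opprK; apply: sqr_pos; rewrite stM sd scc cd.
have bcc : b * (c * c) = 0.
  by apply/eqP; rewrite -oppr_eq0 -dc2 -e y0 mulr0.
have cc0 : c * c = 0.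
  apply: sa_sqr_eq0; first by rewrite stM scc.
  by rewrite {1}c2 mulrDl mulrA -[b * c * c]mulrA bcc mul0r addr0.
have /eqP := sa_sqr_eq0 scc cc0.
by rewrite subr_eq0 -/a => /eqP <-.
Qed.

Lemma pos_conj a x : Pos a -> Pos (st x * a * x).
Proof.
move=> /pos_sqrt[y [[sy _] <- _]].
rewrite (_ : _ * x = st (y * x) * (y * x)); first exact: stM_pos.
by rewrite stM sy !mulrA.
Qed.

(** ** Inverses *)

Fixpoint geo h n : celt A := if n is m.+1 then 1 + h * geo h m else 0.

Lemma geo_step h n : geo h n.+1 - geo h n = h ^+ n.
Proof.
elim: n => [|n IH]; first by rewrite /= mulr0 addr0 subr0.
by rewrite exprS -IH mulrBr /= opprD addrACA subrr add0r.
Qed.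

Lemma geo_comm h x n : x * h = h * x -> x * geo h n = geo h n * x.
Proof.
move=> xh; elim: n => [|n IH] /=; first by rewrite mulr0 mul0r.
by rewrite mulrDr mulrDl mulr1 mul1r mulrA xh -mulrA IH mulrA.
Qed.

Lemma nrX h n : nr (h ^+ n) <= nr h ^+ n.
Proof.
elim: n => [|n IH]; first by rewrite !expr0 nr_le1.
by rewrite !exprS (le_trans (nrM _ _)) // ler_wpM2l // nr_ge0.
Qed.

Lemma neumann h : nr h < 1 -> exists z,
  [/\ z * (1 - h) = 1, (1 - h) * z = 1 &
      forall x, x * h = h * x -> x * z = z * x].
Proof.
move=> h1; pose r := nr h.
have r1 : 0 < 1 - r by rewrite subr_gt0.
have dist m n : nr (geo h (n + m) - geo h n) <= (r ^+ n - r ^+ (n + m)) / (1 - r).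
  elim: m => [|m IH]; first by rewrite addn0 !subrr mul0r nr0.
  rewrite addnS -(subrKA (geo h (n + m))) geo_step (le_trans (nrD _ _)) //.
  rewrite addrC (le_trans (lerD IH (nrX _ _))) // -/r exprS.
  set p := r ^+ (n + m); set q := r ^+ n.
  rewrite le_eqVlt; apply/orP; left; apply/eqP; field.
  by rewrite gt_eqF.
have cg : cauchy nr (geo h).
  move=> e e0; have e2 : 0 < e / 2 * (1 - r) by rewrite mulr_gt0 ?divr_gt0.
  have : (fun n => r ^+ n) @ \oo --> (0 : R) by apply: cvg_expr; rewrite ger0_norm ?nr_ge0.
  move=> /cvgrPdist_lt /(_ _ e2) [N _ hN]; exists N.
  have near n : (N <= n)%N -> nr (geo h n - geo h N) < e / 2.
    move=> nN; rewrite -(subnKC nN); apply: le_lt_trans (dist _ _) _.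
    rewrite ltr_pdivrMr //; have := hN N (leqnn N).
    rewrite /= sub0r normrN ger0_norm ?exprn_ge0 ?nr_ge0 //; apply: le_lt_trans.
    by rewrite gerBl exprn_ge0 // nr_ge0.
  move=> m n /near hm /near hn.
  apply: le_lt_trans (cn_tri nrP _ (geo h N) _) _.
  by rewrite [X in _ + X](cnC nrP) [e]splitr ltrD.
have [z hz] := nr_complete cg.
have comm x : x * h = h * x -> x * z = z * x.
  move=> xh; apply: (tends_uniq (tendsM (tends_cst x) hz)).
  have := tendsM hz (tends_cst x); congr (tends _ _ _).
  by apply/funext => n /=; rewrite geo_comm.
have ez : z = 1 + h * z.
  apply: (tends_uniq (tends_shift hz)).
  exact: tendsD (tends_cst 1) (tendsM (tends_cst h) hz).
have e : (1 - h) * z = 1 by rewrite mulrBl mul1r {1}ez addrK.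
exists z; split=> //; rewrite -[RHS]e mulrBr mulrBl mulr1 mul1r.
by rewrite (comm h).
Qed.

Lemma sa_inv a z : st a = a -> z * a = 1 -> a * z = 1 -> st z = z.
Proof.
move=> sa za az.
have : st z * a = 1 by rewrite -{1}sa -stM az st1.
by move=> h; rewrite -[st z]mulr1 -az mulrA h mul1r.
Qed.

Lemma pos_inv a : Pos a -> exists z,
  [/\ st z = z, z * (1 + a) = 1, (1 + a) * z = 1 &
      forall x, x * a = a * x -> x * z = z * x].
Proof.
move=> [sa [t t0 ht]].
have t1 : 0 < 1 + t by rewrite ltr_wpDr.
pose h := (1 + t)^-1%:C **: (sr t - a).
have h1 : nr h < 1.
  rewrite nrZ gtr0_norm ?invr_gt0 // mulrC ltr_pdivrMr // mul1r.
  by rewrite (le_lt_trans ht) // ltrDr.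
have e : (1 + t)%:C **: (1 - h) = 1 + a.
  rewrite csZBr csZA -rmorphM /= mulfV ?gt_eqF // cs1Z -/(sr _) srD /sr cs1Z.
  by rewrite opprB addrA addrAC addrK.
have [z [zh hz hc]] := neumann h1.
have za : (1 + t)^-1%:C **: z * (1 + a) = 1.
  by rewrite -e csZl csZr zh csZA -rmorphM /= mulVf ?gt_eqF // cs1Z.
have az : (1 + a) * ((1 + t)^-1%:C **: z) = 1.
  by rewrite -e csZl csZr hz csZA -rmorphM /= mulfV ?gt_eqF // cs1Z.
exists ((1 + t)^-1%:C **: z); split=> //.
  by apply: (sa_inv _ za az); rewrite stD st1 sa.
move=> x xa; rewrite csZl csZr hc // /h csZl csZr mulrBr mulrBl xa.
by rewrite sr_comm.
Qed.

(** ** Range projections *)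

(** Kaplansky's formula: p = e f k^-1 with f the adjoint of e and
    k = 1 + (e - f) (f - e), which satisfies e k = k e = e f e. *)
Lemma range_proj e : e * e = e -> exists p,
  [/\ st p = p, p * e = e & e * p = p].
Proof.
move=> ee; pose f := st e; have ff : f * f = f by rewrite -stM ee.
have [z [sz za az hz]] := pos_inv (stM_pos (f - e)).
pose k := 1 + (e - f) * (f - e).
rewrite stB stK -/f -/k in za az hz.
have ek : e * k = e * f * e.
  rewrite mulrDr mulr1 mulrA [e * (e - f)]mulrBr ee mulrBl !mulrBr ee.
  by rewrite -[e * f * f]mulrA ff opprB [e * f - e + _]addrC subrKA addrC subrK.
have ke : k * e = e * f * e.
  rewrite mulrDl mul1r -mulrA [(f - e) * e]mulrBl ee mulrBl !mulrBr ee.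
  by rewrite [f * (f * e)]mulrA ff subrr subr0 addrC subrK mulrA.
have skk : st k = k by rewrite stD st1 stM !stB /f stK.
have ez : e * z = z * e.
  by rewrite -[e * z]mul1r -za -mulrA [k * (e * z)]mulrA ke -ek -mulrA az mulr1.
have fz : f * z = z * f.
  by have := congr1 st ez; rewrite !stM sz.
exists (e * f * z); split.
- by rewrite !stM sz /f stK -/f mulrA -ez -mulrA -fz mulrA.
- by rewrite -mulrA -ez mulrA -ek -mulrA az mulr1.
- by rewrite !mulrA ee.
Qed.

Lemma range_proj_unique e p q : st p = p -> p * e = e -> e * p = p ->
  st q = q -> q * e = e -> e * q = q -> p = q.
Proof.
move=> sp pe ep sq qe eq.
have pq : p * q = q by rewrite -{1}eq mulrA pe eq.
have qp : q * p = p by rewrite -{1}ep mulrA qe ep.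
by rewrite -[p]sp -qp stM sp sq pq.
Qed.

End CstarTheory.
Notation "k **: a" := (sc k a) (at level 40, left associativity).

Section Perturbation.
Variables (R : realType) (A : cstar R).
Implicit Types g K y : celt A.

(** With K = (1 + g)^-1 one has K^2 = 1 - 2 g + g^2 (2 K + K^2), and the last term
    has norm at most 8 s^2. The second witness y turns the inequality
    K^2 <= 1 - 2 g + 8 s^2 into an identity. *)
Lemma inverse_square_le g (s : R) : st g = g -> nr g <= s -> s <= 2^-1 ->
  exists K y, [/\ st K = K, K * (1 + g) = 1, (1 + g) * K = 1 &
    y * y = 1 - g - g + sr A (8 * s ^+ 2) - K * K /\ st y = y].
Proof.
move=> sg gs s2; have s0 : 0 <= s := le_trans (nr_ge0 _) gs.
have h1 : nr (- g) < 1 by rewrite nrN; lra.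
have [K [K1 K2 Kc]] := neumann h1; rewrite opprK in K1 K2.
have sK : st K = K by apply: (sa_inv _ K1 K2); rewrite stD st1 sg.
have gK : g * K = K * g by apply: Kc; rewrite mulrN mulNr.
have e1 : 1 - K = g * K by rewrite -K2 mulrDl mul1r addrAC subrr add0r.
have nK : nr K <= 2.
  have eK : K = 1 - g * K by rewrite -e1 subKr.
  have : nr K <= 1 + s * nr K.
    rewrite {1}eK (le_trans (nrD _ _)) // nrN lerD ?nr_le1 //.
    by rewrite (le_trans (nrM _ _)) // ler_wpM2r ?nr_ge0.
  have := nr_ge0 K; nra.
pose E := g * g * (K + K + K * K).
have eE : 1 - g - g - K * K = - E.
  have e2 : 1 - K * K = g * K + g * K * K.
    by rewrite -e1 mulrBl mul1r subrKA.
  have e3 : g - g * K = g * g * K by rewrite -[RHS]mulrA -[in RHS]e1 mulrBr mulr1.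
  have e4 : g - g * K * K = g * g * K + g * g * K * K.
    by rewrite -[g * K * K]mulrA -{1}[g]mulr1 -mulrBr e2 mulrDr !mulrA.
  rewrite addrAC [1 - g - _]addrAC e2 /E !mulrDr [g * g * (K * K)]mulrA.
  by rewrite -[g * g * K + _ + _]addrA -e4 -e3 opprD !opprB addrACA addrA.
have nE : nr E <= 8 * s ^+ 2.
  have n1 : nr (g * g) <= s ^+ 2 by rewrite (le_trans (nrM _ _)) // expr2 ler_pM ?nr_ge0.
  have n2 : nr (K + K + K * K) <= 8.
    rewrite (le_trans (nrD _ _)) // (le_trans (lerD (nrD _ _) (nrM _ _))) //.
    have := nr_ge0 K; nra.
  rewrite (le_trans (nrM _ _)) // mulrC ler_pM ?nr_ge0 //.
have sE : st E = E.
  have c : K * (g * g) = g * g * K by apply: sqr_comm; rewrite gK.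
  have c2 : K * K * (g * g) = g * g * (K * K) by rewrite -mulrA c mulrA c !mulrA.
  by rewrite stM !stD !stM sg sK !mulrDl c c2 -!mulrDr.
have pE : Pos (sr A (8 * s ^+ 2) - E).
  split; first by rewrite stB st_sr sE.
  exists (8 * s ^+ 2); first by rewrite mulr_ge0 ?sqr_ge0.
  by rewrite opprB addrCA subrr addr0.
have [y [[sy _] yy _]] := pos_sqrt pE.
exists K, y; split=> //; split=> //.
by rewrite yy -eE [LHS]addrC addrAC.
Qed.

End Perturbation.

(** * Linear categories *)
Section LinearCategory.
Variables (R : realType) (D : lincat R).
Implicit Types X Y Z : D.

Lemma compDl X Y Z (g g' : hom Y Z) (f : hom X Y) : (g + g') ∘ f = g ∘ f + g' ∘ f.
Proof. by have := comp_linl 1 g g' f; rewrite !scale1r. Qed.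
Lemma compDr X Y Z (g : hom Y Z) (f f' : hom X Y) : g ∘ (f + f') = g ∘ f + g ∘ f'.
Proof. by have := comp_linr 1 g f f'; rewrite !scale1r. Qed.
Lemma comp0m X Y Z (f : hom X Y) : (0 : hom Y Z) ∘ f = 0.
Proof. by apply: (addrI (0 ∘ f)); rewrite -compDl !addr0. Qed.
Lemma compm0 X Y Z (g : hom Y Z) : g ∘ (0 : hom X Y) = 0.
Proof. by apply: (addrI (g ∘ 0)); rewrite -compDr !addr0. Qed.
Lemma compZl X Y Z k (g : hom Y Z) (f : hom X Y) : (k *: g) ∘ f = k *: (g ∘ f).
Proof. by have := comp_linl k g 0 f; rewrite comp0m !addr0. Qed.
Lemma compZr X Y Z k (g : hom Y Z) (f : hom X Y) : g ∘ (k *: f) = k *: (g ∘ f).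
Proof. by have := comp_linr k g f 0; rewrite compm0 !addr0. Qed.
Lemma compNl X Y Z (g : hom Y Z) (f : hom X Y) : (- g) ∘ f = - (g ∘ f).
Proof. by rewrite -[- g]scaleN1r compZl scaleN1r. Qed.
Lemma compNr X Y Z (g : hom Y Z) (f : hom X Y) : g ∘ (- f) = - (g ∘ f).
Proof. by rewrite -[- f]scaleN1r compZr scaleN1r. Qed.
Lemma compBl X Y Z (g g' : hom Y Z) (f : hom X Y) : (g - g') ∘ f = g ∘ f - g' ∘ f.
Proof. by rewrite compDl compNl. Qed.
Lemma compBr X Y Z (g : hom Y Z) (f f' : hom X Y) : g ∘ (f - f') = g ∘ f - g ∘ f'.
Proof. by rewrite compDr compNr. Qed.

(** Rewrites inside a composite that is bracketed to the left. *)
Lemma tl X Y Z W (f : hom Y Z) (g : hom X Y) (h : hom X Z) (k : hom Z W) :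
  f ∘ g = h -> k ∘ f ∘ g = k ∘ h.
Proof. by move=> <-; rewrite compA. Qed.

Variable dg : dagger D.
Hypothesis hdg : is_dagger dg.

Lemma dgD X Y (f g : hom X Y) : dg (f + g) = dg f + dg g.
Proof. by have := dag_antilin hdg 1 f g; rewrite conjC1 !scale1r. Qed.
Lemma dg0 X Y : dg (0 : hom X Y) = 0.
Proof. by apply: (addrI (dg 0)); rewrite -dgD !addr0. Qed.
Lemma dgZ X Y k (f : hom X Y) : dg (k *: f) = k^*%R *: dg f.
Proof. by have := dag_antilin hdg k f 0; rewrite dg0 !addr0. Qed.
Lemma dgN X Y (f : hom X Y) : dg (- f) = - dg f.
Proof. by rewrite -[- f]scaleN1r dgZ rmorphN1 scaleN1r. Qed.
Lemma dgB X Y (f g : hom X Y) : dg (f - g) = dg f - dg g.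
Proof. by rewrite dgD dgN. Qed.

Variable nm : forall X Y : D, hom X Y -> R.
Hypothesis hn : forall X Y, is_complete_norm (@nm X Y).
Hypothesis hsub : forall X Y Z (g : hom Y Z) (f : hom X Y),
  nm (g ∘ f) <= nm g * nm f.
Hypothesis hC : forall X Y (f : hom X Y), nm (dg f ∘ f) = nm f ^+ 2.

Definition end_cstar X : cstar R :=
  @CStar R (hom X X) (@comp _ _ X X X) (idm X) (@dg X X) (@nm X X)
    (@compA _ _ X X X X) (@compm1 _ _ X X) (@comp1m _ _ X X)
    (fun k => @comp_linl _ _ X X X k) (fun k => @comp_linr _ _ X X X k)
    (@dag_antilin _ _ _ hdg X X) (@dagK _ _ _ hdg X X) (@dag_comp _ _ _ hdg X X X)
    (@hn X X) (@hsub X X X) (@hC X X).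

End LinearCategory.

(** * Duality in a rigid C*-tensor category *)
Section Nested.
Import Strict.
Variables (R : realType) (C : rigid_Cstar_tensor_category R).
Implicit Types X Y Z U V W D E Q : C.
Local Notation one := (one_ob : C).

Let dagC := Cstar_dagger (rigid_Cstar C).

Lemma pcompr (a b : mor C) Q : src a = tgt b ->
  ptens (pcomp a b) (pid Q) = pcomp (ptens a (pid Q)) (ptens b (pid Q)).
Proof. by move=> e; rewrite -ptens_comp // pcomp1. Qed.

Lemma pcompl X (a b : mor C) : src a = tgt b ->
  ptens (pid X) (pcomp a b) = pcomp (ptens (pid X) a) (ptens (pid X) b).
Proof. by move=> e; rewrite -ptens_comp // pcomp1. Qed.

(** Morphisms are whiskered on the left by lw and on the right by rw. Cups take
    values in the nested product D ⊗ (W ⊗ Q), so that diagrams read from left to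
    right as nested terms that compose without coherence isomorphisms; asc occurs
    only where a tensor product is regrouped. *)
Definition lw X Q Q' (f : hom Q Q') : hom (X ⊗ Q) (X ⊗ Q') := idm X ⊠ f.
Definition rw X X' (f : hom X X') Q : hom (X ⊗ Q) (X' ⊗ Q) := f ⊠ idm Q.
Definition asc X Y Q : hom (X ⊗ (Y ⊗ Q)) ((X ⊗ Y) ⊗ Q) := eqm (tensA X Y Q).
Fact cup_key : unit. Proof. exact: tt. Qed.
Definition cup D W (r : hom one (D ⊗ W)) Q : hom Q (D ⊗ (W ⊗ Q)) :=
  locked_with cup_key
    (eqm (esym (tensA D W Q)) ∘ (r ⊠ idm Q) ∘ eqm (esym (tens1o Q))).
Definition cap D W (r : hom one (D ⊗ W)) Q : hom (D ⊗ (W ⊗ Q)) Q := (cup r Q)^†.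

Lemma cupE D W (r : hom one (D ⊗ W)) Q :
  cup r Q = eqm (esym (tensA D W Q)) ∘ (r ⊠ idm Q) ∘ eqm (esym (tens1o Q)).
Proof. by rewrite /cup locked_withE. Qed.

Lemma lwM X Q Q' Q'' (g : hom Q' Q'') (f : hom Q Q') : lw X (g ∘ f) = lw X g ∘ lw X f.
Proof. by rewrite /lw -tensm_comp comp1m. Qed.
Lemma rwM X X' X'' (g : hom X' X'') (f : hom X X') Q : rw (g ∘ f) Q = rw g Q ∘ rw f Q.
Proof. by rewrite /rw -tensm_comp comp1m. Qed.
Lemma lw1 X Q : lw X (idm Q) = idm (X ⊗ Q). Proof. exact: tensm1. Qed.
Lemma rw1 X Q : rw (idm X) Q = idm (X ⊗ Q). Proof. exact: tensm1. Qed.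
Lemma lw_rw X X' (f : hom X X') Q Q' (g : hom Q Q') :
  rw f Q' ∘ lw X g = lw X' g ∘ rw f Q.
Proof. by rewrite /rw /lw -!tensm_comp !comp1m !compm1. Qed.
Lemma tens_lw_rw X X' (f : hom X X') Q Q' (g : hom Q Q') :
  f ⊠ g = lw X' g ∘ rw f Q.
Proof. by rewrite /rw /lw -!tensm_comp !comp1m !compm1. Qed.
Lemma dag_lw X Q Q' (f : hom Q Q') : (lw X f)^† = lw X f^†.
Proof. by rewrite /lw dag_tens dag1. Qed.
Lemma dag_rw X X' (f : hom X X') Q : (rw f Q)^† = rw f^† Q.
Proof. by rewrite /rw dag_tens dag1. Qed.
Lemma dagM X Y Z (g : hom Y Z) (f : hom X Y) : (g ∘ f)^† = f^† ∘ g^†.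
Proof. exact: (dag_comp dagC). Qed.
Lemma daggerK X Y (f : hom X Y) : f^†^† = f.
Proof. exact: (dagK dagC). Qed.
Lemma dag_inj X Y (f g : hom X Y) : f^† = g^† -> f = g.
Proof. by move=> h; rewrite -[f]daggerK h daggerK. Qed.
Lemma dag_cap D W (r : hom one (D ⊗ W)) Q : (cap r Q)^† = cup r Q.
Proof. exact: daggerK. Qed.

Lemma lwD X Q Q' (f g : hom Q Q') : lw X (f + g) = lw X f + lw X g.
Proof. by have := tensm_linr 1 (idm X) f g; rewrite !scale1r. Qed.
Lemma lwZ X Q Q' k (f : hom Q Q') : lw X (k *: f) = k *: lw X f.
Proof.
have e : lw X (0 : hom Q Q') = 0 by apply: (addrI (lw X 0)); rewrite -lwD !addr0.
have := tensm_linr k (idm X) f 0; rewrite -/(lw _ _) -/(lw X f) -/(lw X 0) e !addr0 //.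
Qed.
Lemma rwD X X' (f g : hom X X') Q : rw (f + g) Q = rw f Q + rw g Q.
Proof. by have := tensm_linl 1 f g (idm Q); rewrite !scale1r. Qed.
Lemma rwZ X X' k (f : hom X X') Q : rw (k *: f) Q = k *: rw f Q.
Proof.
have e : rw (0 : hom X X') Q = 0 by apply: (addrI (rw 0 Q)); rewrite -rwD !addr0.
have := tensm_linl k f 0 (idm Q); rewrite -/(rw _ _) -/(rw f _) -/(rw 0 _) e !addr0 //.
Qed.
Lemma rwN X X' (f : hom X X') Q : rw (- f) Q = - rw f Q.
Proof. by rewrite -[- f]scaleN1r rwZ scaleN1r. Qed.
Lemma rwB X X' (f g : hom X X') Q : rw (f - g) Q = rw f Q - rw g Q.
Proof. by rewrite rwD rwN. Qed.
Lemma lwN X Q Q' (f : hom Q Q') : lw X (- f) = - lw X f.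
Proof. by rewrite -[- f]scaleN1r lwZ scaleN1r. Qed.
Lemma lwB X Q Q' (f g : hom Q Q') : lw X (f - g) = lw X f - lw X g.
Proof. by rewrite lwD lwN. Qed.

Lemma lw0 X Q Q' : lw X (0 : hom Q Q') = 0.
Proof. by rewrite -{1}(subrr (0 : hom Q Q')) lwB subrr. Qed.
Lemma rw0 X X' Q : rw (0 : hom X X') Q = 0.
Proof. by rewrite -{1}(subrr (0 : hom X X')) rwB subrr. Qed.

Lemma pack_lw X Q Q' (f : hom Q Q') : pack (lw X f) = ptens (pid X) (pack f).
Proof. by []. Qed.
Lemma pack_rw X X' (f : hom X X') Q : pack (rw f Q) = ptens (pack f) (pid Q).
Proof. by []. Qed.
Lemma pack_cup D W (r : hom one (D ⊗ W)) Q : pack (cup r Q) = ptens (pack r) (pid Q).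
Proof. by rewrite cupE pack_eqmr pack_eqml packT. Qed.
Lemma pack_cap D W (r : hom one (D ⊗ W)) Q : pack (cap r Q) = ptens (pack r^†) (pid Q).
Proof.
rewrite /cap cupE !dagM !dag_eqm dag_tens dag1 compA.
by rewrite pack_eqmr pack_eqml packT.
Qed.
Lemma pack_asc X Y Q : pack (asc X Y Q) = pid (X ⊗ (Y ⊗ Q)).
Proof. exact: pack_eqm. Qed.
Lemma pack_ascl X Y Q P (f : hom P (X ⊗ (Y ⊗ Q))) : pack (asc X Y Q ∘ f) = pack f.
Proof. exact: pack_eqml. Qed.

Lemma eqmV (X Y : C) (e : X = Y) : eqm (esym e) ∘ eqm e = idm X.
Proof. by case: Y / e; rewrite /= comp1m. Qed.
Lemma eqmVr (X Y : C) (e : X = Y) : eqm e ∘ eqm (esym e) = idm Y.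
Proof. by case: Y / e; rewrite /= comp1m. Qed.

Lemma ascV X Y Q : (asc X Y Q)^† ∘ asc X Y Q = idm _.
Proof. by rewrite /asc dag_eqm eqmV. Qed.
Lemma ascVr X Y Q : asc X Y Q ∘ (asc X Y Q)^† = idm _.
Proof. by rewrite /asc dag_eqm eqmVr. Qed.
Lemma asc_ll X Y Q Q' (f : hom Q Q') :
  asc X Y Q' ∘ lw X (lw Y f) = lw (X ⊗ Y) f ∘ asc X Y Q.
Proof. by rewrite /asc /lw tensmA tensm1. Qed.

Lemma cup_nat D W (r : hom one (D ⊗ W)) Q Q' (f : hom Q Q') :
  cup r Q' ∘ f = lw D (lw W f) ∘ cup r Q.
Proof.
apply: pack_inj; rewrite [LHS]packM [RHS]packM pack_cup !pack_lw pack_cup ptensA ptens_id.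
rewrite -[X in pcomp _ X = _]ptens1 -!ptens_comp; try ends.
by rewrite pcomp1 // p1comp // -/(pack f) p1comp // pcomp1.
Qed.
Lemma cap_nat D W (r : hom one (D ⊗ W)) Q Q' (f : hom Q Q') :
  cap r Q' ∘ lw D (lw W f) = f ∘ cap r Q.
Proof. by apply: dag_inj; rewrite !dagM !dag_lw !dag_cap cup_nat. Qed.

(** One half of the conjugate equations, whiskered by any Q. *)
Definition zig D W (r : hom one (D ⊗ W)) (rb : hom one (W ⊗ D)) :=
  forall Q, cap rb (W ⊗ Q) ∘ lw W (cup r Q) = idm (W ⊗ Q).

Lemma zigV D W (r : hom one (D ⊗ W)) (rb : hom one (W ⊗ D)) Q :
  zig r rb -> lw W (cap r Q) ∘ cup rb (W ⊗ Q) = idm (W ⊗ Q).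
Proof. by move=> h; apply: dag_inj; rewrite dagM dag_lw dag_cap -/(cap _ _) h dag1. Qed.

Lemma zigzag_zig D W (r : hom one (D ⊗ W)) (rb : hom one (W ⊗ D)) :
  zigzag (@dag _ C) rb r = idm W <-> zig r rb.
Proof.
have key Q : pack (cap rb (W ⊗ Q) ∘ lw W (cup r Q)) =
    ptens (pack (zigzag (@dag _ C) rb r)) (pid Q).
  rewrite packM pack_cap pack_lw pack_cup pack_zigzag -ptens_id !ptensA.
  by rewrite -ptens_comp ?p1comp; try ends.
split=> [h Q|h].
  by apply: pack_inj; rewrite key h ptens_id.
apply: pack_inj; rewrite -[LHS]ptensm1 -key h -[RHS]ptensm1.
by rewrite -[pack (idm W)]/(pid W) ptens_id.
Qed.

(** ** Endomorphisms of the unit *)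

Let nrmP X Y := Cstar_norm (rigid_Cstar C) X Y.
Let submul := Cstar_submul (rigid_Cstar C).
Let nrmC := Cstar_identity (rigid_Cstar C).

Lemma nrm_idone : nrm (idm one) = 1.
Proof.
have h := nrmC (idm one); rewrite dag1 comp1m in h.
have n0 : nrm (idm one) != 0.
  by apply/eqP => h0; apply: (@unit_neq0 R C); exact: (nrm_eq0 (nrmP _ _)).
by apply: (mulfI n0); rewrite -expr2 -h mulr1.
Qed.

Lemma dag_comp_eq0 X Y (f : hom X Y) : f^† ∘ f = 0 -> f = 0.
Proof.
move=> h; apply: (nrm_eq0 (nrmP _ _)); apply/eqP; rewrite -sqrf_eq0.
by rewrite -nrmC h (cn0 (nrmP _ _)).
Qed.

(** By positivity this is a square in the endomorphisms of the unit, which are the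
    scalars. *)
Lemma scalar_ge0 X (f : hom one X) :
  exists2 k : R, 0 <= k & f^† ∘ f = k%:C *: idm one.
Proof.
have [g ->] := Cstar_positive (rigid_Cstar C) f.
have [k ->] := unit_simple g.
exists (complex.Re `|k| ^+ 2); first exact: sqr_ge0.
rewrite (dgZ dagC) dag1 compZl compZr comp1m scalerA; congr (_ *: _).
by rewrite mulrC -sqr_normc normc_def /= rmorphXn.
Qed.

Lemma sum_squares_eq0 X Y (f : hom one X) (g : hom one Y) :
  f^† ∘ f + g^† ∘ g = 0 -> f = 0.
Proof.
have [k k0 ek] := scalar_ge0 f; have [l l0 el] := scalar_ge0 g.
rewrite ek el -scalerDl -rmorphD => h; apply: dag_comp_eq0.
have : nrm ((k + l)%:C *: idm one) = 0 by rewrite h (cn0 (nrmP _ _)).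
rewrite (cnZr (nrmP _ _)) nrm_idone mulr1 ger0_norm ?addr_ge0 // => e.
by rewrite ek (_ : k = 0) ?scale0r //; lra.
Qed.

(** ** Transposition and traces *)

(** T and y are transposes of each other for the dualities r and r'. Transposes
    are unique in either argument, which reduces the coherence identities between
    canonical isomorphisms of duals to the fact that both sides have the same
    transpose. *)
Definition transp D W D' W' (r : hom one (D ⊗ W)) (r' : hom one (D' ⊗ W'))
    (y : hom D' D) (T : hom W W') :=
  forall Q, lw D (rw T Q) ∘ cup r Q = rw y (W' ⊗ Q) ∘ cup r' Q.

Lemma transpP D W D' W' (r : hom one (D ⊗ W)) (r' : hom one (D' ⊗ W'))
    (y : hom D' D) (T : hom W W') :
  transp r r' y T <-> (idm D ⊠ T) ∘ r = (y ⊠ idm W') ∘ r'.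
Proof.
have k1 Q : pack (lw D (rw T Q) ∘ cup r Q) = ptens (pack ((idm D ⊠ T) ∘ r)) (pid Q).
  rewrite [LHS]packM pack_lw pack_rw pack_cup [in RHS]packM packT.
  by rewrite -{3}[pid Q](@pcomp1 _ _ Q) // ptens_comp ?ptensA //; ends.
have k2 Q : pack (rw y (W' ⊗ Q) ∘ cup r' Q) = ptens (pack ((y ⊠ idm W') ∘ r')) (pid Q).
  rewrite [LHS]packM pack_rw pack_cup [in RHS]packM packT.
  rewrite -{2}[pid Q](@pcomp1 _ _ Q) // ptens_comp ?ptensA; try ends.
  by rewrite -ptensA ptens_id.
split=> [h|h Q]; apply: pack_inj; last by rewrite k1 k2 h.
by rewrite -[LHS]ptensm1 -[RHS]ptensm1 -k1 -k2 h.
Qed.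

Lemma transp_id D W (r : hom one (D ⊗ W)) : transp r r (idm D) (idm W).
Proof. by apply/transpP. Qed.

Definition trl D W (r : hom one (D ⊗ W)) (T : hom W W) Q : hom Q Q :=
  cap r Q ∘ lw D (rw T Q) ∘ cup r Q.
Definition trr D W (rb : hom one (W ⊗ D)) (T : hom W W) Q : hom Q Q :=
  cap rb Q ∘ rw T (D ⊗ Q) ∘ cup rb Q.

(** The duals of W given by two solutions of the conjugate equations with this
    property are related by a unitary. *)
Definition tracial D W (r : hom one (D ⊗ W)) (rb : hom one (W ⊗ D)) :=
  forall T : hom W W, r^† ∘ (idm D ⊠ T) ∘ r = rb^† ∘ (T ⊠ idm D) ∘ rb.

Lemma tracialN D W (r : hom one (D ⊗ W)) (rb : hom one (W ⊗ D)) :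
  tracial r rb <-> forall T Q, trl r T Q = trr rb T Q.
Proof.
have k1 T Q : pack (trl r T Q) = ptens (pack (r^† ∘ (idm D ⊠ T) ∘ r)) (pid Q).
  rewrite /trl !packM pack_cap pack_lw pack_rw pack_cup packT ptensA.
  by rewrite -!ptens_comp ?pcomp1; try ends.
have k2 T Q : pack (trr rb T Q) = ptens (pack (rb^† ∘ (T ⊠ idm D) ∘ rb)) (pid Q).
  rewrite /trr !packM pack_cap pack_rw pack_cup packT -ptens_id ptensA.
  by rewrite -!ptens_comp ?pcomp1; try ends.
split=> h T; last first.
  by apply: pack_inj; rewrite -[LHS]ptensm1 -[RHS]ptensm1 -k1 -k2 h.
by move=> Q; apply: pack_inj; rewrite k1 k2 h.
Qed.

Section Transposition.
Variables (D W D' W' : C).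
Variables (r : hom one (D ⊗ W)) (rb : hom one (W ⊗ D)).
Variables (r' : hom one (D' ⊗ W')) (rb' : hom one (W' ⊗ D')).

Lemma transp_adj (y : hom D' D) (T : hom W W') : zig r rb -> zig rb' r' ->
  transp rb' rb T y -> transp r' r y^† T^†.
Proof.
move=> z1 z2 h Q; apply: dag_inj.
rewrite !dagM dag_lw !dag_rw !daggerK -/(cap r' Q) -/(cap r Q).
have e : rw T Q = lw W' (cap r Q ∘ rw y (W ⊗ Q)) ∘ cup rb' (W ⊗ Q).
  rewrite lwM -compA h compA -lw_rw -compA (zigV _ z1) compm1 //.
by rewrite e [lw D' (_ ∘ cup _ _)]lwM compA cap_nat -compA z2 compm1.
Qed.

Lemma rw_one_inj X Y (f g : hom X Y) : rw f one = rw g one -> f = g.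
Proof.
by move=> h; apply: pack_inj; rewrite -[LHS]ptensm1 -[RHS]ptensm1 -!pack_rw h.
Qed.

Lemma rw_from_cup (T : hom W W') Q : zig r rb ->
  rw T Q = cap rb (W' ⊗ Q) ∘ lw W (lw D (rw T Q) ∘ cup r Q).
Proof. by move=> z; rewrite lwM compA cap_nat -compA z compm1. Qed.

Lemma transp_fun (y : hom D' D) (T S : hom W W') : zig r rb ->
  transp r r' y T -> transp r r' y S -> T = S.
Proof.
move=> z h1 h2; apply: rw_one_inj.
by rewrite [LHS](rw_from_cup _ _ z) [RHS](rw_from_cup _ _ z) h1 h2.
Qed.

Lemma transp_finj (y z : hom D' D) (T : hom W W') : zig rb' r' ->
  transp r r' y T -> transp r r' z T -> y = z.
Proof.
move=> zz h1 h2; apply: rw_one_inj.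
have key (u : hom D' D) : rw u one = lw D (cap rb' one) ∘ (rw u _ ∘ cup r' (D' ⊗ one)).
  by rewrite compA -lw_rw -compA (zigV _ zz) compm1.
by rewrite [LHS]key [RHS]key -h1 -h2.
Qed.

Lemma transp_cap (y : hom D' D) (T : hom W W') Q : zig r rb -> zig rb' r' ->
  transp rb' rb T y -> cap r' Q ∘ lw D' (rw T Q) = cap r Q ∘ rw y (W ⊗ Q).
Proof.
move=> z1 z2 h; apply: dag_inj; have := transp_adj z1 z2 h Q.
by rewrite !dagM dag_lw !dag_rw !dag_cap.
Qed.

(** P bends y around with rb' on one side and the dagger of r on the other. *)
Lemma transp_exists (y : hom D' D) : zig rb r -> exists P, transp rb' rb P y.
Proof.
move=> z; pose P := eqm (tenso1 W') ∘ (lw W' (cap r one ∘ rw y (W ⊗ one))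
  ∘ cup rb' (W ⊗ one)) ∘ eqm (esym (tenso1 W)).
have key Q : rw P Q = lw W' (cap r Q ∘ rw y (W ⊗ Q)) ∘ cup rb' (W ⊗ Q).
  apply: pack_inj; rewrite pack_rw /P pack_eqmr pack_eqml !packM !pack_lw !packM.
  rewrite !pack_cap !pack_rw !pack_cup tenso1 ptensm1.
  rewrite -[in LHS](@pcomp1 _ _ Q (pid Q)) // ptens_comp; try ends.
  rewrite -ptensA; congr (pcomp (ptens _ _) _); last by rewrite -ptensA ptens_id.
  rewrite -[in LHS](@pcomp1 _ _ Q (pid Q)) // ptens_comp; try ends.
  by rewrite -!ptensA ptens_id.
exists P => Q; rewrite key -compA cup_nat compA -lwM -compA lw_rw compA z comp1m.
by [].
Qed.

End Transposition.

Section Sphericality.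
Variables (D W D' W' : C).
Variables (r : hom one (D ⊗ W)) (rb : hom one (W ⊗ D)).
Variables (r' : hom one (D' ⊗ W')) (rb' : hom one (W' ⊗ D')).
Hypotheses (z1 : zig r rb) (z2 : zig rb r) (z1' : zig r' rb') (z2' : zig rb' r').
Hypotheses (t : tracial r rb) (t' : tracial r' rb').

(** If P and T are the two transposes of y then tr (P S) = tr (S T), through the
    left traces, and tr (T S) = tr (S P), through the right traces. For S = a^†
    with a = T - P, this gives tr (a a^†) = - tr (a^† a). *)
Lemma transposes_agree (y : hom D' D) (T P : hom W W') :
  transp r r' y T -> transp rb' rb P y -> T = P.
Proof.
move=> hT hP.
have e1 (S : hom W' W) : trl r' (P ∘ S) one = trl r (S ∘ T) one.
  rewrite /trl rwM lwM compA (transp_cap one z1 z2' hP) -[_ ∘ _ ∘ lw D' _]compA.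
  by rewrite lw_rw -!compA -hT [in RHS]rwM [in RHS]lwM !compA.
have hT' := transp_cap one z2' z1 hT.
have e2 (S : hom W' W) : trr rb' (T ∘ S) one = trr rb (S ∘ P) one.
  rewrite /trr rwM compA -hT' -[_ ∘ _ ∘ rw S _]compA -lw_rw -!compA.
  by rewrite [lw W' _ ∘ _]hP [in RHS]rwM !compA.
have e (S : hom W' W) : trl r' ((T - P) ∘ S) one + trl r (S ∘ (T - P)) one = 0.
  have lD (x x' : hom W' W') : trl r' (x - x') one = trl r' x one - trl r' x' one.
    by rewrite /trl rwB lwB compBr compBl.
  have lD' (x x' : hom W W) : trl r (x - x') one = trl r x one - trl r x' one.
    by rewrite /trl rwB lwB compBr compBl.
  rewrite compBl compBr lD lD' e1.
  have /tracialN h := t; have /tracialN h' := t'.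
  by rewrite h' e2 -h addrC subrKA subrr.
have := e (T - P)^†; rewrite /trl rwM lwM [in X in _ + X]rwM [in X in _ + X]lwM.
rewrite -dag_cap -(dag_cap r) !compA.
rewrite (_ : _ ∘ _ ∘ _ ∘ _ = (lw D' (rw (T - P)^† one) ∘ cup r' one)^†
    ∘ (lw D' (rw (T - P)^† one) ∘ cup r' one)); last first.
  by rewrite dagM dag_lw dag_rw daggerK !compA dag_cap.
rewrite (_ : cap r one ∘ _ ∘ _ ∘ _ = (lw D (rw (T - P) one) ∘ cup r one)^†
    ∘ (lw D (rw (T - P) one) ∘ cup r one)); last first.
  by rewrite dagM dag_lw dag_rw !compA dag_cap.
rewrite addrC => /sum_squares_eq0 h0.
apply/eqP; rewrite -subr_eq0; apply/eqP; apply: rw_one_inj.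
by rewrite (rw_from_cup (T - P) _ z1) h0 lw0 compm0 rw0.
Qed.

(** The right transpose of y exists, and agrees with the left one. *)
Lemma sphericality_l (y : hom D' D) (T : hom W W') :
  transp r r' y T -> transp rb' rb T y.
Proof.
move=> hT; have [P hP] := transp_exists rb' y z2.
by rewrite (transposes_agree hT hP).
Qed.

End Sphericality.

Record solution D W (r : hom one (D ⊗ W)) (rb : hom one (W ⊗ D)) : Prop :=
  Solution { sol_l : zig r rb; sol_r : zig rb r; sol_tr : tracial r rb }.

Lemma sphericality D W D' W' (r : hom one (D ⊗ W)) (rb : hom one (W ⊗ D))
    (r' : hom one (D' ⊗ W')) (rb' : hom one (W' ⊗ D')) y T :
  solution r rb -> solution r' rb' -> transp r r' y T <-> transp rb' rb T y.
Proof.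
case=> z1 z2 t [z1' z2' t']; split; first by move=> h; apply: (sphericality_l z1 z2 z2' t t' h).
move=> h; have [y' hy'] := transp_exists r T z1'.
have := sphericality_l z1 z2 z2' t t' hy'.
by move/(transp_fun z2' h) => ->.
Qed.

Lemma solution_flip D W (r : hom one (D ⊗ W)) (rb : hom one (W ⊗ D)) :
  solution r rb -> solution rb r.
Proof.
move=> s; have [z1 z2 t] := s; split=> // y.
have [T hT] := transp_exists rb y z2.
have /transpP hT' := (sphericality y T s s).2 hT; move/transpP in hT.
by rewrite -!compA hT -hT' !compA t.
Qed.

Lemma transp_comp D W D' W' D'' W'' (r : hom one (D ⊗ W)) (r' : hom one (D' ⊗ W'))
    (r'' : hom one (D'' ⊗ W'')) y T y' T' :
  transp r r' y T -> transp r' r'' y' T' -> transp r r'' (y ∘ y') (T' ∘ T).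
Proof.
move=> h h' Q; rewrite rwM lwM -compA h compA -lw_rw -compA h' compA.
by rewrite -rwM.
Qed.

Lemma rw_zigzag D W E (r : hom one (D ⊗ W)) (sb : hom one (W ⊗ E)) Q :
  rw (zigzag (@dag _ C) r sb) Q = cap r (E ⊗ Q) ∘ lw D (cup sb Q).
Proof.
apply: pack_inj; rewrite packM pack_rw pack_cap pack_lw pack_cup pack_zigzag.
by rewrite pcompr; try ends; rewrite -ptens_id !ptensA.
Qed.

(** Two solutions for W are related by the zigzag between their duals, which is
    unitary when both of them are tracial. *)
Section UniqueSolution.
Variables (W D E : C).
Variables (r : hom one (D ⊗ W)) (rb : hom one (W ⊗ D)).
Variables (s : hom one (E ⊗ W)) (sb : hom one (W ⊗ E)).
Let t := zigzag (@dag _ C) r sb.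

Lemma transp_zigzag : zig r rb -> transp rb sb (idm W) t.
Proof.
move=> z Q; rewrite rw_zigzag lwM rw1 comp1m -compA -cup_nat compA (zigV _ z).
by rewrite comp1m.
Qed.

Lemma transp_zigzag_adj : zig r rb -> zig rb r -> zig s sb ->
  transp r s t^† (idm W).
Proof.
move=> z1 z2 z3; rewrite -[idm W]dag1.
exact: transp_adj z3 z2 (transp_zigzag z1).
Qed.

Hypotheses (hr : solution r rb) (hs : solution s sb).

Lemma transp_zigzag_l : transp s r t (idm W).
Proof. exact: (sphericality _ _ hs hr).2 (transp_zigzag (sol_l hr)). Qed.

Lemma zigzag_isometry : t^† ∘ t = idm D.
Proof.
have h := transp_comp (transp_zigzag_adj (sol_l hr) (sol_r hr) (sol_l hs))
  transp_zigzag_l.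
by rewrite comp1m in h; exact: (transp_finj (sol_r hr) h (transp_id r)).
Qed.

End UniqueSolution.

(** ** Tensor products of solutions *)

(** T acting on the two leftmost factors of a nested product. *)
Definition til U V U' V' (T : hom (U ⊗ V) (U' ⊗ V')) Q :
    hom (U ⊗ (V ⊗ Q)) (U' ⊗ (V' ⊗ Q)) :=
  locked_with cup_key ((asc U' V' Q)^† ∘ rw T Q ∘ asc U V Q).

Lemma tilE U V U' V' (T : hom (U ⊗ V) (U' ⊗ V')) Q :
  til T Q = (asc U' V' Q)^† ∘ rw T Q ∘ asc U V Q.
Proof. by rewrite /til locked_withE. Qed.

Lemma til_nat U V U' V' (T : hom (U ⊗ V) (U' ⊗ V')) Q Q' (f : hom Q Q') :
  til T Q' ∘ lw U (lw V f) = lw U' (lw V' f) ∘ til T Q.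
Proof.
rewrite !tilE -compA asc_ll compA -[_ ∘ _ ∘ lw _ f]compA lw_rw !compA.
by congr (_ ∘ _ ∘ _); apply: dag_inj; rewrite !dagM !dag_lw !daggerK asc_ll.
Qed.

Lemma pack_til U V U' V' (T : hom (U ⊗ V) (U' ⊗ V')) Q :
  pack (til T Q) = ptens (pack T) (pid Q).
Proof. by rewrite tilE /asc dag_eqm pack_eqmr pack_eqml. Qed.

Lemma cup_nest U V D E (r : hom one (D ⊗ U)) (s : hom one (E ⊗ V)) Q :
  cup (nest r s) Q = asc E D _ ∘ lw E (lw D (asc U V Q) ∘ cup r (V ⊗ Q)) ∘ cup s Q.
Proof.
apply: pack_inj; rewrite pack_cup pack_nest -[RHS]/(pack (_ ∘ _)) -compA.
rewrite pack_ascl lwM -compA [RHS]packM.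
rewrite (_ : pack (lw E (lw D (asc U V Q))) = pid (E ⊗ (D ⊗ (U ⊗ (V ⊗ Q)))));
  last first.
  by rewrite !pack_lw pack_asc !ptens_id.
rewrite p1comp; last by rewrite [pack (lw E _ ∘ _)]packM tgt_pcomp.
rewrite packM pack_lw !pack_cup pcompr; try ends.
by rewrite -!ptensA ptens_id.
Qed.

Lemma cap_nest U V D E (r : hom one (D ⊗ U)) (s : hom one (E ⊗ V)) Q :
  cap (nest r s) Q
  = cap s Q ∘ lw E (cap r (V ⊗ Q) ∘ lw D (asc U V Q)^†) ∘ (asc E D _)^†.
Proof. by rewrite /cap cup_nest !dagM !dag_lw !dagM !dag_lw !compA. Qed.

Lemma ascV_ll X Y Q1 Q2 (f : hom Q1 Q2) :
  (asc X Y Q2)^† ∘ lw (X ⊗ Y) f = lw X (lw Y f) ∘ (asc X Y Q1)^†.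
Proof. by apply: dag_inj; rewrite !dagM !dag_lw !daggerK asc_ll. Qed.

Lemma zig_nest U V D E (r : hom one (D ⊗ U)) (rb : hom one (U ⊗ D))
    (s : hom one (E ⊗ V)) (sb : hom one (V ⊗ E)) :
  zig r rb -> zig s sb -> zig (nest r s) (nest sb rb).
Proof.
move=> z1 z2 Q; rewrite cap_nest cup_nest.
rewrite -[_ ∘ lw (U ⊗ V) _]compA ascV_ll compA -[cap rb _ ∘ _ ∘ _]compA -lwM.
rewrite -[cap sb _ ∘ _ ∘ _]compA -lwM.
rewrite -[asc _ _ _ ∘ _ ∘ _]compA [_^† ∘ (asc _ _ _ ∘ _)]compA ascV comp1m.
rewrite [lw V (_ ∘ _)]lwM [cap sb _ ∘ (_ ∘ _)]compA cap_nat.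
rewrite -[_ ∘ cap sb _ ∘ _]compA z2 compm1 [lw U _]lwM.
by rewrite [cap rb _ ∘ (_ ∘ _)]compA cap_nat -[_ ∘ cap rb _ ∘ _]compA z1 compm1 ascVr.
Qed.

Lemma til_nat_tl U V U' V' (T : hom (U ⊗ V) (U' ⊗ V')) Q Q' (f : hom Q Q') Z
    (k : hom (U' ⊗ (V' ⊗ Q')) Z) :
  k ∘ (asc U' V' Q')^† ∘ rw T Q' ∘ asc U V Q' ∘ lw U (lw V f)
  = k ∘ lw U' (lw V' f) ∘ til T Q.
Proof.
transitivity (k ∘ (til T Q' ∘ lw U (lw V f))); first by rewrite tilE !compA.
by rewrite til_nat compA.
Qed.

Lemma trl_nest U V D E (r : hom one (D ⊗ U)) (s : hom one (E ⊗ V)) T Q :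
  trl (nest r s) T Q = cap s Q ∘ lw E (cap r (V ⊗ Q) ∘ lw D (til T Q)
    ∘ cup r (V ⊗ Q)) ∘ cup s Q.
Proof.
rewrite /trl cap_nest cup_nest tilE (tl _ (ascV_ll _ _ _)) !compA.
by rewrite (tl _ (ascV _ _ _)) compm1 !lwM !compA.
Qed.

Lemma trr_nest U V D E (rb : hom one (U ⊗ D)) (sb : hom one (V ⊗ E)) T Q :
  trr (nest sb rb) T Q = cap rb Q ∘ (lw U (cap sb (D ⊗ Q)) ∘ til T (E ⊗ (D ⊗ Q))
    ∘ lw U (cup sb (D ⊗ Q))) ∘ cup rb Q.
Proof.
rewrite /trr cap_nest cup_nest !lwM !compA til_nat_tl.
have e : lw U (lw V (asc E D Q)^†) ∘ lw U (lw V (asc E D Q)) = idm _.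
  by rewrite -!lwM ascV !lw1.
by rewrite (tl _ e) compm1.
Qed.

(** The left trace of T on U ⊗ V is the left trace on V of the partial left trace K
    of T, and its right trace is the right trace on U of the partial right trace L.
    The right trace of K is the left trace of L, by moving the two loops past each
    other. *)
Lemma tracial_nest U V D E (r : hom one (D ⊗ U)) (rb : hom one (U ⊗ D))
    (s : hom one (E ⊗ V)) (sb : hom one (V ⊗ E)) :
  tracial r rb -> tracial s sb -> tracial (nest r s) (nest sb rb).
Proof.
move=> /tracialN tr /tracialN ts; apply/tracialN => T Q.
rewrite trl_nest trr_nest.
pose K : hom V V := cap r V ∘ lw D T ∘ cup r V.
have hK P' : rw K P' = cap r (V ⊗ P') ∘ lw D (til T P') ∘ cup r (V ⊗ P').
  apply: pack_inj; rewrite pack_rw /K !packM !pack_cap !pack_lw !pack_cup pack_til.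
  rewrite !pcompr; try ends.
  by rewrite -!ptensA !ptens_id.
pose L : hom U U := eqm (tenso1 U) ∘ (lw U (cap sb one) ∘ til T (E ⊗ one)
    ∘ lw U (cup sb one)) ∘ eqm (esym (tenso1 U)).
have hL P' : rw L P' = lw U (cap sb P') ∘ til T (E ⊗ P') ∘ lw U (cup sb P').
  apply: pack_inj; rewrite pack_rw /L pack_eqmr pack_eqml !packM !pack_lw !pack_cap.
  rewrite !pack_cup !pack_til !ptensm1 !pcompr; try ends.
  by rewrite -!ptensA !ptens_id ?tenso1.
rewrite -hK -[LHS]/(trl s K Q) ts /trr hK -hL -[RHS]/(trr rb L Q) -tr /trl hL.
by rewrite !compA (tl _ (cup_nat r (cup sb Q))) -(cap_nat r (cap sb Q)) !lwM !compA.
Qed.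

Lemma solution_nest U V D E (r : hom one (D ⊗ U)) (rb : hom one (U ⊗ D))
    (s : hom one (E ⊗ V)) (sb : hom one (V ⊗ E)) :
  solution r rb -> solution s sb -> solution (nest r s) (nest sb rb).
Proof.
case=> r1 r2 r3 [s1 s2 s3]; split; last exact: tracial_nest.
  exact: zig_nest.
exact: zig_nest.
Qed.

(** ** Standard solutions are tracial *)

Lemma scalar_sa (f : hom one one) : f^† = f -> exists t : R, f = t%:C *: idm one.
Proof.
have [k ->] := unit_simple f; rewrite (dgZ dagC) dag1 => e.
have {e} : k^*%R = k.
  have : (k^*%R - k) *: idm one = 0 by rewrite scalerBl e subrr.
  move=> /(congr1 (@nrm _ C _ _)).
  rewrite (nrm_scale (nrmP _ _)) nrm_idone mulr1 (cn0 (nrmP _ _)) => h.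
  by apply/eqP; rewrite -subr_eq0 -normr_eq0; move: h; rewrite normc_def /= => ->.
by move=> /CrealP/complex_realP[t ->]; exists t.
Qed.

Lemma scalar_inj (s t : R) : s%:C *: idm one = t%:C *: idm one -> s = t.
Proof.
move=> e; have : (s - t)%:C *: idm one = 0 by rewrite rmorphB scalerBl e subrr.
move=> /(congr1 (@nrm _ C _ _)).
rewrite (cnZr (nrmP _ _)) nrm_idone mulr1 (cn0 (nrmP _ _)) => /eqP.
by rewrite normr_eq0 subr_eq0 => /eqP.
Qed.

Definition ltr D W (r : hom one (D ⊗ W)) (T : hom W W) := r^† ∘ lw D T ∘ r.
Definition rtr D W (rb : hom one (W ⊗ D)) (T : hom W W) := rb^† ∘ rw T D ∘ rb.

Lemma ltr_lin D W (r : hom one (D ⊗ W)) k (T S : hom W W) :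
  ltr r (k *: T + S) = k *: ltr r T + ltr r S.
Proof. by rewrite /ltr lwD lwZ compDr compDl compZr compZl. Qed.
Lemma rtr_lin D W (rb : hom one (W ⊗ D)) k (T S : hom W W) :
  rtr rb (k *: T + S) = k *: rtr rb T + rtr rb S.
Proof. by rewrite /rtr rwD rwZ compDr compDl compZr compZl. Qed.
Lemma ltr_dag D W (r : hom one (D ⊗ W)) (T : hom W W) : (ltr r T)^† = ltr r T^†.
Proof. by rewrite /ltr !dagM daggerK dag_lw compA. Qed.
Lemma rtr_dag D W (rb : hom one (W ⊗ D)) (T : hom W W) : (rtr rb T)^† = rtr rb T^†.
Proof. by rewrite /rtr !dagM daggerK dag_rw compA. Qed.
Lemma ltr_sqr D W (r : hom one (D ⊗ W)) (T : hom W W) :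
  ltr r (T^† ∘ T) = (lw D T ∘ r)^† ∘ (lw D T ∘ r).
Proof. by rewrite /ltr !dagM dag_lw lwM !compA. Qed.
Lemma rtr_sqr D W (rb : hom one (W ⊗ D)) (T : hom W W) :
  rtr rb (T^† ∘ T) = (rw T D ∘ rb)^† ∘ (rw T D ∘ rb).
Proof. by rewrite /rtr !dagM dag_rw rwM !compA. Qed.

Let EC U := end_cstar dagC nrmP submul nrmC U.

(** The value e = - c t with t small contradicts a nonzero c. *)
Lemma nonneg_linear_eq0 (c M : R) :
  (forall e : R, `|e| <= 2^-1 -> 0 <= e * c + e ^+ 2 * M) -> c = 0.
Proof.
move=> h; apply/eqP; apply: contraT => c0.
pose N := `|c| + `|M| + 1.
have N0 : 0 < N by rewrite ltr_wpDl ?addr_ge0.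
pose t := (2 * N)^-1; have t0 : 0 < t by rewrite invr_gt0 mulr_gt0.
have tN : t * (2 * N) = 1 by rewrite mulVf // gt_eqF // mulr_gt0.
have cN : `|c| <= N by rewrite /N; have := normr_ge0 M; lra.
have MN : M <= N - 1 by rewrite /N; have := normr_ge0 c; have := ler_norm M; lra.
have := h (- (c * t)); rewrite normrN normrM (gtr0_norm t0).
have -> : `|c| * t <= 2^-1 by nra.
move=> /(_ isT) {}h.
have c2 : 0 < c ^+ 2 by rewrite lt_def sqr_ge0 sqrf_eq0 c0.
have h0 : 0 <= c ^+ 2 * t * (t * M - 1).
  by rewrite (_ : _ * _ = - (c * t) * c + (- (c * t)) ^+ 2 * M) //; ring.
rewrite (pmulr_rge0 _ (mulr_gt0 c2 t0)) in h0.
nra.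
Qed.

Lemma ev_zig U : zig (ev U : hom one _) (evb U).
Proof. exact/zigzag_zig/(ev_conj U).1. Qed.
Lemma evb_zig U : zig (evb U : hom one _) (ev U).
Proof. exact/zigzag_zig/(ev_conj U).2. Qed.

Lemma nrm_sqr_scalar X (f : hom one X) (k : R) : f^† ∘ f = k%:C *: idm one ->
  nrm f ^+ 2 = `|k|.
Proof. by move=> e; rewrite -nrmC e (cnZr (nrmP _ _)) nrm_idone mulr1. Qed.

Lemma cup_lw D W W' (r : hom one (D ⊗ W)) (T : hom W W') Q :
  cup (lw D T ∘ r) Q = lw D (rw T Q) ∘ cup r Q.
Proof.
apply: pack_inj; rewrite pack_cup !packM !pack_lw pack_rw pack_cup pcompr; try ends.
by rewrite ptensA.
Qed.
Lemma cup_rw D D' W (r : hom one (D ⊗ W)) (T : hom D D') Q :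
  cup (rw T W ∘ r) Q = rw T (W ⊗ Q) ∘ cup r Q.
Proof.
apply: pack_inj; rewrite pack_cup !packM !pack_rw pack_cup pcompr; try ends.
by rewrite -ptensA ptens_id.
Qed.

(** Rescaling the two sides by 1 + e h and its inverse does not decrease the
    product of the norms, for small e of either sign; the first order term in e
    has to vanish. *)
Lemma ev_trace_sa U (h : hom U U) : h^† = h -> nrm h <= 1 ->
  ltr (ev U) h = rtr (evb U) h.
Proof.
move=> sh h1.
have sa1 (T : hom U U) : T^† = T -> exists t : R, ltr (ev U) T = t%:C *: idm one.
  by move=> sT; apply: scalar_sa; rewrite ltr_dag sT.
have sa2 (T : hom U U) : T^† = T -> exists t : R, rtr (evb U) T = t%:C *: idm one.
  by move=> sT; apply: scalar_sa; rewrite rtr_dag sT.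
have [a ea] := sa1 h sh; have [a' ea'] := sa2 h sh.
have [b eb] := sa1 (h ∘ h) (etrans (dagM _ _) (f_equal2 _ sh sh)).
have [d d0 ed] := scalar_ge0 (ev U); have [d' d0' ed'] := scalar_ge0 (evb U).
have dd : d' = d.
  have := nrm_sqr_scalar ed; have := nrm_sqr_scalar ed'.
  by rewrite ev_balanced !ger0_norm // => <- <-.
have p1 : ltr (ev U) (idm U) = d%:C *: idm one by rewrite /ltr lw1 compm1.
have q1 : rtr (evb U) (idm U) = d%:C *: idm one.
  by rewrite /rtr rw1 compm1 ed' dd.
(* d, a, b and a' are the scalars given by the traces of 1, h, h^2 on the left
   and of h on the right. *)
have key (e : R) : `|e| <= 2^-1 ->
    d ^+ 2 <= (d + 2 * e * a + e ^+ 2 * b) * (d - 2 * e * a' + 8 * e ^+ 2 * d).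
  move=> e2; pose g : celt (EC U) := e%:C *: h.
  have sg : st g = g by rewrite [st g](dgZ dagC) conj_Creal ?complex_real // sh.
  have ng : nr g <= `|e|.
    by rewrite [nr g](cnZr (nrmP _ _)) ler_piMr.
  have [K [y [sK K1 K2 [yy sy]]]] := inverse_square_le sg ng e2.
  pose T : hom U U := idm U + e%:C *: h.
  change (K ∘ T = idm U) in K1; change (T ∘ K = idm U) in K2.
  change (K^† = K) in sK; change (y^† = y) in sy.
  change (y ∘ y = idm U - e%:C *: h - e%:C *: h + (8 * `|e| ^+ 2)%:C *: idm U - K ∘ K) in yy.
  have sT : T^† = T.
    by rewrite /T (dgD dagC) dag1 (dgZ dagC) conj_Creal ?complex_real // sh.
  have zT : conjugate_eqs (@dag _ C) (lw (dual U) T ∘ ev U) (rw K (dual U) ∘ evb U).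
    split; apply/zigzag_zig => Q.
      rewrite cup_lw /cap cup_rw dagM dag_rw sK -/(cap _ _) -compA lw_rw compA.
      rewrite lwM [cap _ _ ∘ (_ ∘ _)]compA cap_nat -[_ ∘ _ ∘ lw U _]compA ev_zig.
      by rewrite compm1 -rwM K2 rw1.
    rewrite cup_rw /cap cup_lw dagM dag_lw dag_rw sT -/(cap _ _) lwM compA.
    by rewrite -[cap _ _ ∘ _ ∘ _]compA -lwM -rwM K2 rw1 lw1 compm1 evb_zig.
  have TT : ltr (ev U) (T^† ∘ T) = (d + 2 * e * a + e ^+ 2 * b)%:C *: idm one.
    rewrite sT (_ : T ∘ T = e%:C *: h + (e%:C *: h + ((e * e)%:C *: (h ∘ h) + idm U))).
      rewrite !ltr_lin ea eb p1 !scalerA -!rmorphM -!scalerDl -!rmorphD.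
      by congr (_ *: _); congr (_%:C); ring.
    rewrite /T compDl !compDr !comp1m compm1 compZl compZr scalerA -rmorphM.
    rewrite -!addrA addrCA; congr (_ + _); rewrite addrCA; congr (_ + _).
    exact: addrC.
  have [k k0 ek] := scalar_ge0 (rw K (dual U) ∘ evb U).
  have [l l0 el] := scalar_ge0 (rw y (dual U) ∘ evb U).
  have [n n0 en] := scalar_ge0 (lw (dual U) T ∘ ev U).
  have KK : k <= d - 2 * e * a' + 8 * e ^+ 2 * d.
    rewrite -[X in _ <= X](_ : k + l = _) ?lerDl //; apply: scalar_inj.
    rewrite rmorphD scalerDl -ek -el -!rtr_sqr sK sy yy.
    rewrite -[rtr (evb U) (K ∘ K)]scale1r -rtr_lin scale1r addrC subrK.
    rewrite (_ : _ + _ = (- e)%:C *: h + ((- e)%:C *: h +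
        ((8 * e ^+ 2)%:C *: idm U + idm U))); last first.
      rewrite rmorphN scaleNr real_normK ?num_real // -!addrA addrC -!addrA.
      congr (_ + _); rewrite -!addrA; congr (_ + _).
    rewrite !rtr_lin ea' q1 !scalerA -!rmorphM -!scalerDl -!rmorphD.
    by congr (_ *: _); congr (_%:C); ring.
  have nl : n = d + 2 * e * a + e ^+ 2 * b.
    by apply: scalar_inj; rewrite -en -ltr_sqr TT.
  have m := ev_minimal zT.
  have s1 := nrm_sqr_scalar ed; rewrite ger0_norm // in s1.
  have s2 := nrm_sqr_scalar ek; rewrite ger0_norm // in s2.
  have s3 := nrm_sqr_scalar en; rewrite ger0_norm // in s3.
  rewrite -nl; apply: le_trans (_ : n * k <= _); last by rewrite ler_wpM2l.
  rewrite -s2 -s3 -exprMn -s1 -exprM (_ : (2 * 2)%N = (2 + 2)%N) // exprD -exprMn.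
  by rewrite {2}ev_balanced lerXn2r ?nnegrE ?mulr_ge0 ?(cn_ge0 (nrmP _ _)).
have [dz|dn0] := eqVneq d 0.
  have z X (f : hom one X) : f^† ∘ f = 0%:C *: idm one -> f = 0.
    by move=> hf; apply: dag_comp_eq0; rewrite hf scale0r.
  rewrite /ltr /rtr (z _ (ev U)) ?ed ?dz // (z _ (evb U)) ?ed' ?dd ?dz //.
  by rewrite !compm0.
suff e : a = a' by rewrite ea ea' e.
pose K1 := b * d - 4 * a * a' + 8 * d ^+ 2.
pose K2 := 16 * a * d - 2 * a' * b; pose K3 := 8 * b * d.
have : 2 * d * (a - a') = 0.
  apply: (@nonneg_linear_eq0 _ (`|K1| + `|K2| + `|K3|)) => e he.
  have le1 (x y : R) : `|x| <= 1 -> x * y <= `|y|.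
    move=> x1; rewrite (le_trans (ler_norm _)) // normrM.
    by rewrite ler_piMl.
  have e1 : `|e| <= 1 by lra.
  have hM : K1 + e * K2 + e ^+ 2 * K3 <= `|K1| + `|K2| + `|K3|.
    rewrite !lerD ?ler_norm ?le1 // normrX expr_le1 //.
  have := ler_wpM2l (sqr_ge0 e) hM; have := key e he.
  by rewrite /K1 /K2 /K3; nra.
by move/eqP; rewrite !mulf_eq0 (negPf dn0) subr_eq0 pnatr_eq0 /= => /eqP.
Qed.

Lemma ltrZ D W (r : hom one (D ⊗ W)) k (T : hom W W) : ltr r (k *: T) = k *: ltr r T.
Proof. by rewrite /ltr lwZ compZr compZl. Qed.
Lemma rtrZ D W (rb : hom one (W ⊗ D)) k (T : hom W W) : rtr rb (k *: T) = k *: rtr rb T.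
Proof. by rewrite /rtr rwZ compZr compZl. Qed.

(** The case of self-adjoint contractions extends by linearity. *)
Theorem ev_solution U : solution (ev U : hom one _) (evb U).
Proof.
split; [exact: ev_zig|exact: evb_zig|] => T.
have sa (h : hom U U) : h^† = h -> ltr (ev U) h = rtr (evb U) h.
  move=> sh; pose c := nrm h + 1.
  have c0 : 0 < c by rewrite ltr_wpDl ?(cn_ge0 (nrmP _ _)).
  have -> : h = c%:C *: (c^-1%:C *: h).
    by rewrite scalerA -rmorphM mulfV ?gt_eqF // scale1r.
  rewrite ltrZ rtrZ ev_trace_sa //.
    by rewrite (dgZ dagC) conj_Creal ?complex_real // sh.
  rewrite (cnZr (nrmP _ _)) gtr0_norm ?invr_gt0 // mulrC ler_pdivrMr // mul1r.
  by rewrite /c lerDl.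
change (ltr (ev U) T = rtr (evb U) T).
pose a := T + T^†; pose b := 'i%C *: (T - T^†).
have sa1 : a^† = a by rewrite (dgD dagC) daggerK addrC.
have sb : b^† = b.
  by rewrite (dgZ dagC) (dgB dagC) daggerK conjI scaleNr -scalerN opprB.
have -> : T = 2^-1%:C *: ((- 'i%C) *: b + a).
  rewrite /b scalerA mulNr ImulI opprK scale1r /a [T + T^†]addrC subrKA.
  by rewrite scalerDr -scalerDl -rmorphD (_ : 2^-1 + 2^-1 = 1) ?scale1r //; lra.
by rewrite ltrZ rtrZ ltr_lin rtr_lin !sa.
Qed.
End Nested.

Section TranspNest.
Import Strict.
Variables (R : realType) (C : rigid_Cstar_tensor_category R).
Implicit Types X Y Z U V W D E Q : C.
Local Notation one := (one_ob : C).

Lemma rw_asc D W P Y Y' (g : hom D Y) (h : hom W Y') :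
  rw (g ⊠ h) P ∘ asc D W P = asc Y Y' P ∘ (g ⊠ (h ⊠ idm P)).
Proof. by rewrite /rw /asc tensmA. Qed.

Lemma transp_nest U V D E U' V' D' E' (r : hom one (D ⊗ U)) (s : hom one (E ⊗ V))
    (r' : hom one (D' ⊗ U')) (s' : hom one (E' ⊗ V')) y T z S :
  transp r r' y T -> transp s s' z S ->
  transp (nest r s) (nest r' s') (z ⊠ y) (T ⊠ S).
Proof.
move=> h1 h2 Q; rewrite !cup_nest.
have e (A B A' B' P : C) (f : hom A A') (g : hom B B') :
    rw (f ⊠ g) P ∘ asc A B P = asc A' B' P ∘ (lw A' (rw g P) ∘ rw f (B ⊗ P)).
  by rewrite -tens_lw_rw; rewrite rw_asc.
rewrite !compA e -!compA.
transitivity (asc E D _ ∘ (lw E (lw D (asc U' V' Q) ∘ lw D (lw U' (rw S Q))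
    ∘ rw y (U' ⊗ (V ⊗ Q)) ∘ cup r' (V ⊗ Q)) ∘ cup s Q)).
  rewrite compA -asc_ll -compA; congr (_ ∘ _); rewrite compA -lwM; congr (lw E _ ∘ _).
  by rewrite compA -lwM e !lwM -!compA h1.
congr (_ ∘ _); rewrite [rw z _ ∘ _]compA lw_rw -[_ ∘ rw z _ ∘ _]compA -h2 [RHS]compA.
rewrite -[lw E _ ∘ lw E _ in RHS]lwM [RHS]compA -[lw E _ ∘ lw E _ in RHS]lwM.
congr (lw E _ ∘ _); rewrite -!compA cup_nat [rw y _ ∘ (lw _ _ ∘ _)]compA lw_rw.
by rewrite -!compA [rw y _ ∘ (_ ∘ _)]compA lw_rw !compA.
Qed.

(** The unit object is its own dual. *)
Definition unit_sol : hom one (one ⊗ one) := eqm (esym (tens1o one)).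

Lemma pack_unit_sol : pack unit_sol = pid one.
Proof. exact: pack_eqm. Qed.

Lemma unit_solution : solution unit_sol unit_sol.
Proof.
have z : zig unit_sol unit_sol.
  move=> Q; apply: pack_inj; rewrite packM pack_cap pack_lw pack_cup pack_unit_sol.
  rewrite dag_eqm pack_eqm.
  by rewrite !ptens_id pcomp1 //; ends.
split=> // T; apply: pack_inj; rewrite !packM !packT pack_unit_sol /unit_sol dag_eqm.
by rewrite pack_eqm ptens1 ptensm1.
Qed.

Lemma pack_rw_asc D W (r : hom one (D ⊗ W)) Q P (X : hom Q (D ⊗ (W ⊗ P))) :
  pack (rw r^† P ∘ (asc D W P ∘ X)) = pack (cap r P ∘ X).
Proof. by rewrite packM pack_ascl pack_rw [RHS]packM pack_cap. Qed.

(** The unit and D ⊗ W are their own duals, and r transposes to its dagger. *)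
Lemma transp_unit D W (r : hom one (D ⊗ W)) (rb : hom one (W ⊗ D)) :
  zig rb r -> transp unit_sol (nest rb r) r^† r.
Proof.
move=> z Q; apply: pack_inj; rewrite packM pack_lw pack_rw pack_cup pack_unit_sol.
rewrite -ptens_comp ?p1comp ?pcomp1; try ends.
rewrite ptens1 cup_nest -compA pack_rw_asc lwM !compA cap_nat -2!compA.
by rewrite [_ ∘ (lw _ _ ∘ _)]compA z comp1m pack_ascl pack_cup.
Qed.

End TranspNest.
Arguments unit_sol {R C}.
Arguments unit_solution {R C}.

(** * The involution of a star-algebra object *)
Section StarAlgebra.
Import Strict.
Variables (R : realType) (C : rigid_Cstar_tensor_category R).
Variable A : star_algebra_object C.
Implicit Types X Y Z U V W D E Q : C.
Local Notation one := (one_ob : C).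
Let dagC := Cstar_dagger (rigid_Cstar C).

(** The involution read through an arbitrary dual D of W. Its
    compatibility with morphisms and with products ([star_by_amap], [star_by_mul])
    involves no canonical isomorphism; for the dual Y ⊗ dual X of X ⊗ dual Y it is the involution of the module
    category. *)
Definition star_by D W (r : hom one (D ⊗ W)) (a : A W) : A D :=
  amap (zigzag (@dag _ C) r (evb W)) a^♮.

Lemma star_by_antilin D W (r : hom one (D ⊗ W)) k (a b : A W) :
  star_by r (k *: a + b) = k^*%R *: star_by r a + star_by r b.
Proof. by rewrite /star_by natural_antilin amap_linr. Qed.

Lemma star_by_ev U (a : A U) : star_by (ev U : hom one _) a = a^♮.
Proof. by rewrite /star_by (ev_conj U).2 amap1. Qed.

Lemma star_by_evb U (a : A U) : star_by (evb U : hom one _) a^♮ = a.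
Proof. exact: naturalK. Qed.

Lemma star_by_amap U V (T : hom U V) D E (r : hom one (D ⊗ U)) (rb : hom one (U ⊗ D))
    (s : hom one (E ⊗ V)) (sb : hom one (V ⊗ E)) (Tv : hom D E) (a : A V) :
  zig r rb -> zig rb r -> zig s sb -> transp rb sb T^† Tv ->
  star_by r (amap T a) = amap Tv (star_by s a).
Proof.
move=> z1 z2 z3 hT.
pose t := zigzag (@dag _ C) r (evb U); pose t' := zigzag (@dag _ C) (ev U) rb.
pose u := zigzag (@dag _ C) s (evb V).
have ht : transp rb (evb U) (idm U) t by exact: transp_zigzag.
have ht' : transp (evb U) rb (idm U) t'.
  by apply: transp_zigzag; exact: ev_zig.
have hu : transp sb (evb V) (idm V) u by exact: transp_zigzag.
have t't : t' ∘ t = idm D.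
  have := transp_comp ht ht'; rewrite comp1m => h.
  exact: (transp_fun z2 h (transp_id rb)).
have := transp_comp ht' (transp_comp hT hu); rewrite compm1 comp1m => /transpP e.
rewrite /star_by -/t -/u (@natural_amap _ _ A _ _ _ _ a e) -!amap_comp.
by rewrite -[u ∘ Tv ∘ t' ∘ t]compA t't compm1.
Qed.

Lemma star_byK D W (r : hom one (D ⊗ W)) (rb : hom one (W ⊗ D)) (a : A W) :
  zig r rb -> zig rb r -> star_by rb (star_by r a) = a.
Proof.
move=> z1 z2.
rewrite {2}/star_by (star_by_amap (Tv := idm W) (s := evb W) (sb := ev W) _ z2 z1) //.
- by rewrite amap1 star_by_evb.
- exact: evb_zig.
- by apply: transp_zigzag_adj z1 z2 _; exact: ev_zig.
Qed.

Lemma amul_natl U V V' (S : hom V' V) (a : A U) (b : A V) :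
  a ⋅ amap S b = amap (S ⊠ idm U) (a ⋅ b).
Proof. by rewrite -{1}[a]amap1 amul_nat. Qed.

Lemma amul_natr U U' V (T : hom U' U) (a : A U) (b : A V) :
  amap T a ⋅ b = amap (idm V ⊠ T) (a ⋅ b).
Proof. by rewrite -{1}[b]amap1 amul_nat. Qed.

Lemma star_by_mul U V D E (r : hom one (D ⊗ U)) (rb : hom one (U ⊗ D))
    (s : hom one (E ⊗ V)) (sb : hom one (V ⊗ E)) (a : A U) (b : A V) :
  zig r rb -> zig rb r -> zig s sb -> zig sb s ->
  star_by (nest r s) (b ⋅ a) = star_by r a ⋅ star_by s b.
Proof.
move=> z1 z2 z3 z4; rewrite /star_by amul_nat natural_mul -amap_comp; congr amap.
have h1 := transp_nest (transp_zigzag (evb V) z3) (transp_zigzag (evb U) z1).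
have h2 : transp (nest (evb V) (evb U)) (evb (U ⊗ V)) (idm _) (dual_tens U V).
  by apply: transp_zigzag; apply: zig_nest; exact: ev_zig.
have := transp_comp h1 h2; rewrite tensm1 comp1m => h.
apply: (transp_fun (zig_nest z4 z2) _ h).
by apply: transp_zigzag; exact: zig_nest.
Qed.

(** The form does not depend on the choice of the dual: the isomorphism t between
    two duals has the identity as a transpose on both sides, by sphericality. *)
Lemma inner0E D W (r : hom one (D ⊗ W)) (rb : hom one (W ⊗ D)) (a b : A W) :
  solution r rb -> inner0 a b = amap r (a ⋅ star_by r b).
Proof.
move=> hr; rewrite /star_by amul_natl -amap_comp /inner0; congr amap.
have /transpP := transp_zigzag_l hr (ev_solution W).
by rewrite tensm1 comp1m => <-.
Qed.

Lemma star0E (a : A one) : star0 a = star_by unit_sol a.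
Proof.
rewrite /star0 /star_by; congr amap; apply: pack_inj.
rewrite /dual_one pack_eqml pack_zigzag /unit_sol dag_eqm pack_eqm.
by rewrite ptens_id !ptens1 p1comp //; ends.
Qed.

Lemma inner0_unit (a b : A one) : inner0 a b = mul0 a (star0 b).
Proof. by rewrite (inner0E _ _ unit_solution) star0E. Qed.

Lemma star0_mul (a b : A one) : star0 (mul0 a b) = mul0 (star0 b) (star0 a).
Proof.
have [z _ _] := @unit_solution R C.
rewrite /mul0 !star0E -/unit_sol -(star_by_mul _ _ z z z z).
exact: (star_by_amap _ z z (zig_nest z z) (transp_unit z)).
Qed.

Lemma star0K (a : A one) : star0 (star0 a) = a.
Proof. by have [z _ _] := @unit_solution R C; rewrite !star0E star_byK. Qed.

Lemma mul0A (a b c : A one) : mul0 a (mul0 b c) = mul0 (mul0 a b) c.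
Proof.
rewrite /mul0 amul_natl amul_natr -!amap_comp -amulA -amap_comp; congr amap.
apply: pack_inj; rewrite !packM !packT !pack_eqm ?pack_eqmr.
by rewrite !ptens_id !pcomp1 ?p1comp ?tens1o //; ends.
Qed.

Lemma mul01 (a : A one) : mul0 a aone = a. Proof. exact: amul1. Qed.

Lemma mul1_0 (a : A one) : mul0 aone a = a.
Proof.
rewrite -[RHS]a1mul /mul0; congr amap; apply: pack_inj; by rewrite !pack_eqm.
Qed.

Lemma inner0_herm U (a b : A U) : star0 (inner0 a b) = inner0 b a.
Proof.
have [z _ _] := @unit_solution R C; have [z1 z2 _] := ev_solution U.
rewrite star0E /inner0.
rewrite (star_by_amap (Tv := ev U) _ z z (zig_nest z2 z1)).
  by rewrite (star_by_mul _ _ z2 z1 z1 z2) star_by_evb star_by_ev.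
exact: transp_unit.
Qed.

(** The transpose of the adjoint of T through evb, which appears in the involution,
    is by sphericality also the one that moves T across ev. *)
Lemma inner0_adj U V (T : hom U V) (a : A V) (b : A U) :
  inner0 (amap T a) b = inner0 a (amap T^† b).
Proof.
have [Tv hT] := transp_exists (ev U) T (ev_zig V).
have h := (sphericality _ _ (ev_solution U) (ev_solution V)).1 hT.
have /transpP e := h; have e' := etrans (esym e) (erefl _).
rewrite /inner0 (@natural_amap _ _ A _ _ T^† Tv b) ?daggerK //.
rewrite amul_natl amul_natr -!amap_comp; congr amap.
by have /transpP := hT.
Qed.

Definition act U (c : A one) (a : A U) : A U := amap (eqm (esym (tenso1 U))) (c ⋅ a).

Lemma inner0_act U (c : A one) (a b : A U) : inner0 (act c a) b = mul0 c (inner0 a b).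
Proof.
rewrite /inner0 /act /mul0 amul_natr amul_natl -!amap_comp -amulA -amap_comp.
congr amap; apply: pack_inj.
rewrite pack_eqml pack_eqmr [LHS]packM !packT pack_eqm ptensm1.
by rewrite [pack (idm (dual U))]/(pid _) ptens_id p1comp.
Qed.

(** The form inner0 (a ⋅ b) (a' ⋅ b') depends on b and b' only through
    c = inner0 b b'. *)
Definition sandwich U (a a' : A U) (c : A one) : A one :=
  amap ((eqm (esym (tenso1 (dual U))) ⊠ idm U) ∘ ev U) (a ⋅ (c ⋅ a'^♮)).

Lemma sandwich_lin U (a a' : A U) k (c c' : A one) :
  sandwich a a' (k *: c + c') = k *: sandwich a a' c + sandwich a a' c'.
Proof. by rewrite /sandwich amul_linl amul_linr amap_linr. Qed.

Lemma sandwich1 U (a a' : A U) : sandwich a a' aone = inner0 a a'.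
Proof.
rewrite /sandwich /inner0 -[in RHS](a1mul a'^♮) amul_natl -amap_comp.
by [].
Qed.

Lemma inner0_mul U V (a a' : A U) (b b' : A V) :
  inner0 (a ⋅ b) (a' ⋅ b') = sandwich a a' (inner0 b b').
Proof.
have hs := solution_nest (ev_solution V) (ev_solution U).
have [z1 z2 _] := ev_solution U; have [z3 z4 _] := ev_solution V.
rewrite (inner0E _ _ hs) (star_by_mul _ _ z3 z4 z1 z2) !star_by_ev.
rewrite /sandwich /inner0 amul_natr amul_natl -amap_comp.
rewrite -amulA -!amap_comp -[b ⋅ b'^♮ ⋅ a'^♮]amulA amul_natl -amap_comp.
congr amap; apply: pack_inj; rewrite pack_eqml pack_nest.
rewrite !packM !packT !pack_eqm -/(pid U) -/(pid (dual U)) !ptens_id -ptensA.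
by rewrite [pcomp (pid (dual U ⊗ U)) _]p1comp // p1comp //; ends.
Qed.

Definition coev U : A (U ⊗ dual U) := amap (evb U)^† aone.

(** A conjugate equation straightens the cap of coev against w ⋅ a; this turns the
    bound on products into a bound on the involution. *)
Lemma inner0_coev U (a : A U) (w : A (dual U)) :
  inner0 (coev U) (w ⋅ a) = inner0 a^♮ w.
Proof.
have hs := solution_nest (ev_solution U) (ev_solution (dual U)).
have [z1 z2 _] := ev_solution U; have [z3 z4 _] := ev_solution (dual U).
rewrite (inner0E _ _ hs) (star_by_mul _ _ z1 z2 z3 z4) !star_by_ev.
rewrite /coev amul_natr -amap_comp /inner0.
rewrite -[in RHS](a1mul (a^♮ ⋅ w^♮)) -amap_comp; congr amap; apply: pack_inj.
rewrite pack_eqml [LHS]packM packT pack_nest.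
rewrite -[pack (idm (_ ⊗ _))]/(pid _) -ptens_id pcompA; try ends.
rewrite -ptensA -pcompl; try ends.
by rewrite conj_rV ptens_id p1comp.
Qed.

End StarAlgebra.

(** * The Hilbert module structure *)
Section BaseAlgebra.
Variables (R : realType) (C : rigid_Cstar_tensor_category R).
Variable A : star_algebra_object C.
Local Notation one := (one_ob : C).

Lemma mul0_linl k (a b c : A one) :
  mul0 (k *: a + b) c = k *: mul0 a c + mul0 b c.
Proof. by rewrite /mul0 amul_linl amap_linr. Qed.
Lemma mul0_linr k (a b c : A one) :
  mul0 a (k *: b + c) = k *: mul0 a b + mul0 a c.
Proof. by rewrite /mul0 amul_linr amap_linr. Qed.
Lemma star0_antilin k (a b : A one) :
  star0 (k *: a + b) = k^*%R *: star0 a + star0 b.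
Proof. by rewrite !star0E star_by_antilin. Qed.

Definition base_of (n : A one -> R) (h : is_Cstar_norm0 n) : cstar R :=
  @CStar R (A one) (@mul0 R C A) aone (@star0 R C A) n
  (@mul0A R C A) (@mul01 R C A) (@mul1_0 R C A)
  mul0_linl mul0_linr star0_antilin (@star0K R C A) (@star0_mul R C A)
  (nrm0_complete h) (nrm0_submul h) (nrm0_Cstar h).

End BaseAlgebra.

Section PreHilbert.
Variables (R : realType) (C : rigid_Cstar_tensor_category R).
Variable A : pre_Cstar_algebra_object C.
Implicit Types X Y Z U V W D E Q : C.
Local Notation one := (one_ob : C).
Let dagC := Cstar_dagger (rigid_Cstar C).

Lemma amap0l U V (a : A V) : amap (0 : hom U V) a = 0.
Proof.
have := amap_linl 1 (0 : hom U V) 0 a; rewrite !scale1r addr0 => h.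
by apply: (addrI (amap 0 a)); rewrite -h addr0.
Qed.
Lemma sandwich0 U (a b : A U) : sandwich a b 0 = 0.
Proof.
have := sandwich_lin a b 1 0 0; rewrite !scale1r addr0 => h.
by apply: (addrI (sandwich a b 0)); rewrite -h addr0.
Qed.

Definition base : cstar R := base_of (norm0P A).

Lemma inner0_linl U k (a b c : A U) :
  inner0 (k *: a + b) c = k *: inner0 a c + inner0 b c.
Proof. by rewrite /inner0 amul_linl amap_linr. Qed.
Lemma inner0_linr U k (a b c : A U) :
  inner0 a (k *: b + c) = k^*%R *: inner0 a b + inner0 a c.
Proof. by rewrite /inner0 natural_antilin amul_linr amap_linr. Qed.
Lemma inner0Dl U (a b c : A U) : inner0 (a + b) c = inner0 a c + inner0 b c.
Proof. by have := inner0_linl 1 a b c; rewrite !scale1r. Qed.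
Lemma inner0Dr U (a b c : A U) : inner0 a (b + c) = inner0 a b + inner0 a c.
Proof. by have := inner0_linr 1 a b c; rewrite conjC1 !scale1r. Qed.
Lemma inner00l U (c : A U) : inner0 0 c = 0.
Proof. by apply: (addrI (inner0 0 c)); rewrite -inner0Dl !addr0. Qed.
Lemma inner00r U (c : A U) : inner0 c 0 = 0.
Proof. by apply: (addrI (inner0 c 0)); rewrite -inner0Dr !addr0. Qed.
Lemma inner0Zl U k (a c : A U) : inner0 (k *: a) c = k *: inner0 a c.
Proof. by have := inner0_linl k a 0 c; rewrite inner00l !addr0. Qed.
Lemma inner0Zr U k (a c : A U) : inner0 c (k *: a) = k^*%R *: inner0 c a.
Proof. by have := inner0_linr k c a 0; rewrite inner00r !addr0. Qed.
Lemma inner0Nl U (a c : A U) : inner0 (- a) c = - inner0 a c.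
Proof. by rewrite -[- a]scaleN1r inner0Zl scaleN1r. Qed.
Lemma inner0Nr U (a c : A U) : inner0 c (- a) = - inner0 c a.
Proof. by rewrite -[- a]scaleN1r inner0Zr rmorphN1 scaleN1r. Qed.

(** The form inner0, valued in the C*-algebra A_0. *)
Definition ip U (a b : A U) : celt base := inner0 a b.

Lemma ip_pos U (a : A U) : Pos (ip a a).
Proof. by have [x hx] := inner0_ge0 a; rewrite /ip hx; exact: (@stM_pos _ base). Qed.
Lemma ip_st U (a b : A U) : st (ip a b) = ip b a.
Proof. exact: inner0_herm. Qed.
Lemma ip_act U c (a b : A U) : ip (act c a) b = (c : celt base) * ip a b.
Proof. exact: inner0_act. Qed.
Lemma ip_actr U c (a b : A U) : ip a (act c b) = ip a b * st (c : celt base).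
Proof. by rewrite -ip_st ip_act stM ip_st. Qed.
Lemma ipDl U (a b c : A U) : ip (a + b) c = ip a c + ip b c.
Proof. exact: inner0Dl. Qed.
Lemma ipDr U (a b c : A U) : ip c (a + b) = ip c a + ip c b.
Proof. exact: inner0Dr. Qed.
Lemma ipNl U (a c : A U) : ip (- a) c = - ip a c. Proof. exact: inner0Nl. Qed.
Lemma ipNr U (a c : A U) : ip c (- a) = - ip c a. Proof. exact: inner0Nr. Qed.
Lemma ipZl U k (a c : A U) : ip (k *: a) c = sc k (ip a c).
Proof. exact: inner0Zl. Qed.
Lemma ipZr U k (a c : A U) : ip c (k *: a) = sc k^*%R (ip c a).
Proof. exact: inner0Zr. Qed.

Local Notation fn := (@fiber_norm R C A _).

Lemma fn_ge0 U (a : A U) : 0 <= fn a. Proof. exact: sqrtr_ge0. Qed.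
Lemma fn_sqr U (a : A U) : fn a ^+ 2 = nr (ip a a).
Proof. by rewrite sqr_sqrtr // (nr_ge0 (ip a a)). Qed.

(** The inequality behind it: a - t <a, b> b has a positive square for
    t = 1 / |<b, b>|, up to a small correction of t. *)
Lemma cauchy_schwarz U (a b : A U) : nr (ip a b) <= fn a * fn b.
Proof.
rewrite -(ler_pXn2r (_ : 0 < 2)%N) ?nnegrE ?mulr_ge0 ?fn_ge0 ?nr_ge0 //.
rewrite exprMn !fn_sqr; set z := ip a b; set c := ip b b; set p := ip a a.
have main beta : nr c < beta -> nr z ^+ 2 <= beta * nr p.
  move=> cb; have b0 : 0 < beta := le_lt_trans (nr_ge0 _) cb.
  pose t := beta^-1; have t0 : 0 < t by rewrite invr_gt0.
  have tb : t * beta = 1 by rewrite mulVf // gt_eqF.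
  pose h := a - t%:C *: act z b.
  have e : ip h h = p - sc t%:C (z * st z) - sc t%:C (z * st z)
      + sc (t * t)%:C (z * c * st z).
    rewrite /h !ipDl !ipDr !ipNl !ipNr !ipZl !ipZr !ip_act !ip_actr.
    rewrite conj_Creal ?complex_real // -/z -/c -/p -(ip_st a b) -/z.
    by rewrite opprK csZA -rmorphM mulrA addrA.
  have p1 := ip_pos h; rewrite e in p1.
  have p2 : Pos (sr base beta - c).
    have [sc' _] := ip_pos b; split; first by rewrite stB st_sr sc'.
    by exists beta; [exact: ltW|rewrite opprB addrCA subrr addr0 ltW].
  have p3 := posZ (ltW (mulr_gt0 t0 t0)) (pos_conj (st z) p2).
  have p4 : Pos (p - sc t%:C (z * st z)).
    have tt : t * t * beta = t by rewrite -mulrA tb mulr1.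
    have := posD p1 p3; rewrite stK mulrBr mulrBl csZBr Msr csZl csZA -rmorphM tt.
    by rewrite -addrA [sc _ _ + (_ - _)]addrCA subrr addr0 subrK.
  have p5 : Pos (sc t%:C (z * st z)).
    by apply: posZ; [exact: ltW|rewrite -{1}[z]stK; exact: stM_pos].
  have := pos_mono p5 p4; rewrite nrZ gtr0_norm // -{1}[z]stK nrC nr_st.
  by rewrite -(ler_pM2l b0) mulrA [beta * t]mulrC tb mul1r.
apply/ler_addgt0Pr => e e0.
have np0 : 0 < nr p + 1 by rewrite ltr_wpDl // nr_ge0.
apply: le_trans (main (nr c + e / (nr p + 1)) _) _.
  by rewrite ltrDl divr_gt0.
rewrite mulrDl mulrC lerD2l -mulrA ler_piMr ?(ltW e0) //.
by rewrite mulrC ler_pdivrMr // mul1r lerDl.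
Qed.

Lemma fnD U (a b : A U) : fn (a + b) <= fn a + fn b.
Proof.
rewrite -(ler_pXn2r (_ : 0 < 2)%N) ?nnegrE ?addr_ge0 ?fn_ge0 //.
rewrite fn_sqr ipDl !ipDr sqrrD !fn_sqr mulr2n.
have h1 := cauchy_schwarz a b; have h2 := cauchy_schwarz b a.
apply: le_trans (nrD _ _) _; apply: le_trans (lerD (nrD _ _) (nrD _ _)) _.
by rewrite mulrC in h2; lra.
Qed.

Lemma fnZ U k (a : A U) : fn (k *: a) = complex.Re `|k| * fn a.
Proof.
apply/eqP; rewrite -(eqrXn2 (_ : 0 < 2)%N) ?mulr_ge0 ?fn_ge0 ?Re_norm_ge0 //.
rewrite exprMn !fn_sqr ipZl ipZr.
have nZ l (x : celt base) : nr (sc l x) = complex.Re `|l| * nr x.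
  exact: (nrm_scale (cs_normP base)).
by rewrite !nZ Re_norm_conj mulrA -expr2.
Qed.

Lemma fn_ip_le U V (a : A U) (b : A V) (s : R) : 0 <= s ->
  Pos (sc s%:C (ip b b) - ip a a) -> fn a ^+ 2 <= s * fn b ^+ 2.
Proof.
move=> s0 h; rewrite !fn_sqr -[s]ger0_norm // -nrZ.
exact: pos_mono (ip_pos a) h.
Qed.

(** ** Bounds for the structure maps *)

Let nrmP X Y := Cstar_norm (rigid_Cstar C) X Y.
Let EC U := end_cstar dagC nrmP (Cstar_submul (rigid_Cstar C))
  (Cstar_identity (rigid_Cstar C)) U.

(** If |T|^2 - T T^† = y^2 with y self-adjoint, then
    |T|^2 <a, a> - <A(T) a, A(T) a> = <A(y) a, A(y) a> is positive. *)
Lemma amap_bound U V (T : hom U V) : exists2 M, 0 <= M &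
  forall a : A V, fn (amap T a) <= M * fn a.
Proof.
pose h : celt (EC V) := T ∘ T^†; pose s := nr h.
have sh : st h = h by rewrite [st h]dagM daggerK.
have s0 : 0 <= s := nr_ge0 _.
have ph : Pos (sr (EC V) s - h).
  split; first by rewrite stB st_sr sh.
  by exists s; rewrite // opprB addrCA subrr addr0.
have [y [[sy _] yy _]] := pos_sqrt ph.
exists (Num.sqrt s); first exact: sqrtr_ge0.
move=> a; rewrite -(ler_pXn2r (_ : 0 < 2)%N) ?nnegrE ?mulr_ge0 ?fn_ge0 ?sqrtr_ge0 //.
rewrite exprMn [Num.sqrt s ^+ 2]sqr_sqrtr //; apply: fn_ip_le => //.
have e : ip (amap (y : hom V V) a) (amap (y : hom V V) a)
    = sc s%:C (ip a a) - ip (amap T a) (amap T a).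
  rewrite /ip !inner0_adj -!amap_comp.
  change (y ∘ y = s%:C *: idm V - T ∘ T^†) in yy.
  change (y^† = y) in sy.
  have e0 (S : hom V V) : amap (- S) a = - amap S a.
    by rewrite -[- S]addr0 -scaleN1r amap_linl amap0l addr0 scaleN1r.
  rewrite sy yy amap_linl amap1 e0 inner0_linr inner0Nr.
  by rewrite conj_Creal ?complex_real.
by rewrite -e; exact: ip_pos.
Qed.

(** If |<b, b>| - <b, b> = y^2 in A_0, then
    |<b, b>| <a, a> - <a b, a b> = <a y, a y> is positive. *)
Lemma amul_bound U V (a : A U) (b : A V) : fn (a ⋅ b) <= fn a * fn b.
Proof.
pose s := nr (ip b b); have s0 : 0 <= s := nr_ge0 _.
have ph : Pos (sr base s - ip b b).
  split; first by rewrite stB st_sr ip_st.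
  by exists s; rewrite // opprB addrCA subrr addr0.
have [y [[sy _] yy _]] := pos_sqrt ph.
rewrite -(ler_pXn2r (_ : 0 < 2)%N) ?nnegrE ?mulr_ge0 ?fn_ge0 //.
rewrite exprMn mulrC [fn b ^+ 2]fn_sqr -/s; apply: fn_ip_le => //.
have e : ip (a ⋅ (y : A one)) (a ⋅ (y : A one)) = sc s%:C (ip a a) - ip (a ⋅ b) (a ⋅ b).
  rewrite /ip !inner0_mul inner0_unit.
  change (mul0 (y : A one) y = s%:C *: aone - inner0 b b) in yy.
  change (star0 (y : A one) = y) in sy.
  rewrite sy yy sandwich_lin sandwich1.
  by rewrite -[- inner0 b b]addr0 -scaleN1r sandwich_lin sandwich0 addr0 scaleN1r.
by rewrite -e; exact: ip_pos.
Qed.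

(** The square of the norm of the adjoint w of a is |<coev, w a>|. *)
Lemma natural_bound U (a : A U) : fn a^♮ <= fn (coev A U) * fn a.
Proof.
have [->|n0] := eqVneq (fn a^♮) 0; first by rewrite mulr_ge0 ?fn_ge0.
have p0 : 0 < fn a^♮ by rewrite lt_def n0 fn_ge0.
rewrite -(ler_pM2r p0) -expr2 fn_sqr {1}/ip -inner0_coev.
apply: le_trans (cauchy_schwarz _ _) _.
by rewrite -mulrA ler_wpM2l ?fn_ge0 // mulrC amul_bound.
Qed.

End PreHilbert.

(** * Extension by continuity *)
Section Extension.
Variable R : realType.

(** W, with the norm nm, is a completion of V for the seminorm p. *)
Record dense_in (V W : lmodType R[i]) (p : V -> R) (nm : W -> R) (i : V -> W) : Prop :=
  DenseIn {
  dn_norm : is_complete_norm nm;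
  dn_lin : forall k a b, i (k *: a + b) = k *: i a + i b;
  dn_iso : forall a, nm (i a) = p a;
  dn_dense : forall w e, 0 < e -> exists a, nm (w - i a) < e
}.

Definition lip (W W' : lmodType R[i]) (nm : W -> R) (nm' : W' -> R) (F : W -> W') :=
  exists2 M, 0 <= M & forall w w', nm' (F w - F w') <= M * nm (w - w').

Lemma lip_id (W : lmodType R[i]) (nm : W -> R) : lip nm nm id.
Proof. by exists 1 => // w w'; rewrite mul1r. Qed.

Lemma lip_comp (W W' W'' : lmodType R[i]) (nm : W -> R) (nm' : W' -> R)
    (nm'' : W'' -> R) (F : W -> W') (G : W' -> W'') :
  lip nm' nm'' G -> lip nm nm' F -> lip nm nm'' (fun w => G (F w)).
Proof.
move=> [M M0 hG] [N N0 hF]; exists (M * N) => [|w w']; first exact: mulr_ge0.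
by rewrite (le_trans (hG _ _)) // -mulrA ler_wpM2l.
Qed.

Section Lip.
Variables (W W' : lmodType R[i]) (nm : W -> R) (nm' : W' -> R).
Hypotheses (hn : is_complete_norm nm) (hn' : is_complete_norm nm').

Lemma lip_cst (c : W') : lip nm nm' (fun=> c).
Proof. by exists 0 => // w w'; rewrite subrr (cn0 hn') mul0r. Qed.

Lemma lipD (F G : W -> W') : lip nm nm' F -> lip nm nm' G ->
  lip nm nm' (fun w => F w + G w).
Proof.
move=> [M M0 hF] [N N0 hG]; exists (M + N) => [|w w']; first exact: addr_ge0.
by rewrite opprD addrACA (le_trans (nrm_triangle hn' _ _)) // mulrDl lerD.
Qed.

Lemma lipZ k (F : W -> W') : lip nm nm' F -> lip nm nm' (fun w => k *: F w).
Proof.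
move=> [M M0 hF]; exists (complex.Re `|k| * M) => [|w w'].
  by rewrite mulr_ge0 ?Re_norm_ge0.
by rewrite -scalerBr (nrm_scale hn') -mulrA ler_wpM2l ?Re_norm_ge0.
Qed.

Lemma lip_semilin (s : R[i] -> R[i]) (F : W -> W') M : 0 <= M -> s 1 = 1 ->
  s (-1) = -1 ->
  (forall k a b, F (k *: a + b) = s k *: F a + F b) ->
  (forall a, nm' (F a) <= M * nm a) -> lip nm nm' F.
Proof.
move=> M0 s1 sN1 lF bF; exists M => // w w'.
have -> : F w - F w' = F (w - w').
  by rewrite addrC -scaleN1r -sN1 -lF scaleN1r addrC.
exact: bF.
Qed.

Variables (V : lmodType R[i]) (p : V -> R) (i : V -> W).
Hypothesis hd : dense_in p nm i.

Lemma dn_linB a b : i (a - b) = i a - i b.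
Proof. by rewrite addrC -scaleN1r (dn_lin hd) scaleN1r addrC. Qed.

Lemma density (F G : W -> W') : lip nm nm' F -> lip nm nm' G ->
  (forall a, F (i a) = G (i a)) -> forall w, F w = G w.
Proof.
move=> [M M0 hF] [N N0 hG] e w; apply/eqP; rewrite -subr_eq0; apply/eqP.
apply: (cn_small_eq0 hn') => d d0.
have MN : 0 < M + N + 1 by rewrite ltr_wpDl // addr_ge0.
have [a ha] := dn_dense hd w (divr_gt0 d0 MN).
rewrite (le_trans (cn_tri hn' _ (F (i a)) _)) // {2}e.
rewrite (le_trans (lerD (hF _ _) (hG _ _))) // [X in _ + _ * X](cnC hn) -mulrDl.
move: ha; rewrite ltr_pdivlMr // => /ltW; apply: le_trans.
by rewrite mulrC ler_wpM2l ?(cn_ge0 hn) // lerDl.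
Qed.

(** The value at w is the limit of f along any sequence of V that approaches w. *)
Lemma lip_extend (f : V -> W') M : 0 <= M ->
  (forall a b, nm' (f a - f b) <= M * p (a - b)) ->
  exists2 F, forall a, F (i a) = f a & lip nm nm' F.
Proof.
move=> M0 hf.
have M1 : 0 < M + 1 by rewrite ltr_wpDl.
have near w : exists x, forall e, 0 < e -> exists2 d, 0 < d &
    forall a, nm (w - i a) < d -> nm' (x - f a) <= e.
  have /choice[u hu] (n : nat) : exists a, nm (w - i a) < n.+1%:R^-1.
    by apply: (dn_dense hd); rewrite invr_gt0.
  have small e : 0 < e -> exists N, forall n, (N <= n)%N ->
      forall a, nm (w - i a) < e -> nm' (f (u n) - f a) <= M * (e + e).
    move=> e0; exists (Num.bound e^-1) => n nN a ha.
    rewrite (le_trans (hf _ _)) // ler_wpM2l // -(dn_iso hd) dn_linB.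
    rewrite (le_trans (cn_tri hn _ w _)) // lerD //; last exact: ltW.
    rewrite (cnC hn) (le_trans (ltW (hu n))) // invf_ple ?posrE //.
    rewrite ltW // (lt_le_trans (archi_boundP _)) ?invr_ge0 ?(ltW e0) //.
    by rewrite ler_nat (leq_trans nN).
  have cu : cauchy nm' (fun n => f (u n)).
    move=> e e0; have e1 : 0 < e / 2 / (M + 1) by rewrite !divr_gt0.
    have [N hN] := small _ e1; exists (maxn N (Num.bound (e / 2 / (M + 1))^-1)).
    move=> m n; rewrite !geq_max => /andP[m1 m2] /andP[n1 n2].
    apply: le_lt_trans (hN m m1 (u n) _) _.
      rewrite (lt_le_trans (hu n)) // invf_ple ?posrE //.
      rewrite ltW // (lt_le_trans (archi_boundP _)) ?invr_ge0 ?(ltW e1) //.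
      by rewrite ler_nat (leq_trans n2).
    have : (M + 1) * (e / 2 / (M + 1)) = e / 2 by rewrite mulrC divfK // gt_eqF.
    by move: e1; set q := e / 2 / _ => q0; rewrite mulrDl mul1r mulrDr; lra.
  have [x hx] := complete_tends hn' cu; exists x => e e0.
  have e1 : 0 < e / 4 / (M + 1) by rewrite !divr_gt0.
  exists (e / 4 / (M + 1)) => // a ha.
  have [N1 h1] := small _ e1; have [N2 h2] := hx (e / 2) (divr_gt0 e0 (ltr0Sn R 1)).
  pose n := maxn N1 N2.
  rewrite (le_trans (cn_tri hn' _ (f (u n)) _)) // [e]splitr lerD //.
    by rewrite (cnC hn') ltW // h2 // leq_maxr.
  rewrite (le_trans (h1 n (leq_maxl _ _) _ ha)) //.
  have : M * (e / 4 / (M + 1)) <= e / 4.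
    by rewrite mulrCA ler_piMr ?divr_ge0 ?ltW // ltr_pdivrMr // mul1r ltrDl.
  lra.
have [F hF] := choice near; exists F => [a|].
  apply/eqP; rewrite -subr_eq0; apply/eqP; apply: (cn_small_eq0 hn') => e e0.
  by have [d d0 hd'] := hF (i a) e e0; apply: hd'; rewrite subrr (cn0 hn).
exists M => // w w'; apply/ler_addgt0Pr => e e0.
pose e' := e / 2 / (M + 1).
have e3 : 0 < e / 4 by rewrite divr_gt0.
have e4 : 0 < e / 4 / (M + 1) by rewrite divr_gt0.
have [d1 d10 h1] := hF w _ e3; have [d2 d20 h2] := hF w' _ e3.
have m1 : 0 < Num.min d1 (e / 4 / (M + 1)) by rewrite lt_min d10.
have m2 : 0 < Num.min d2 (e / 4 / (M + 1)) by rewrite lt_min d20.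
have [a ha] := dn_dense hd w m1; have [b hb] := dn_dense hd w' m2.
move: ha hb; rewrite !lt_min => /andP[a1 a2] /andP[b1 b2].
have k1 := h1 a a1; have k2 := h2 b b1.
have k3 : nm' (f a - f b) <= M * nm (w - w') + e / 2.
  rewrite (le_trans (hf _ _)) // -(dn_iso hd) dn_linB.
  have : nm (i a - i b) <= nm (w - w') + 2 * (e / 4 / (M + 1)).
    rewrite (le_trans (cn_tri hn _ w _)) // (cnC hn).
    have := cn_tri hn w w' (i b); lra.
  move=> /(ler_wpM2l M0) /le_trans; apply; rewrite mulrDr lerD2l.
  have : M * (e / 4 / (M + 1)) <= e / 4.
    by rewrite mulrCA ler_piMr ?divr_ge0 ?ltW // ltr_pdivrMr // mul1r ltrDl.
  lra.
have := cn_tri hn' (F w) (f a) (F w'); have := cn_tri hn' (f a) (f b) (F w').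
rewrite (cnC hn') in k2; lra.
Qed.

End Lip.

Section ExtSemilin.
Variables (V W W' : lmodType R[i]) (p : V -> R) (nm : W -> R) (nm' : W' -> R).
Variable i : V -> W.
Hypotheses (hn' : is_complete_norm nm') (hd : dense_in p nm i).
Let hn := dn_norm hd.

(** Both linear and antilinear maps are extended: s is the identity or the
    conjugation. *)
Lemma ext_semilin (s : R[i] -> R[i]) (f : V -> W') M : 0 <= M -> s 1 = 1 ->
  s (-1) = -1 ->
  (forall k a b, f (k *: a + b) = s k *: f a + f b) ->
  (forall a, nm' (f a) <= M * p a) ->
  exists F, [/\ forall a, F (i a) = f a,
    forall k a b, F (k *: a + b) = s k *: F a + F b &
    forall w, nm' (F w) <= M * nm w].
Proof.
move=> M0 s1 sN1 lf bf.
have hf a b : nm' (f a - f b) <= M * p (a - b).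
  have -> : f a - f b = f (a - b) by rewrite addrC -scaleN1r -sN1 -lf scaleN1r addrC.
  exact: bf.
have [F Fi lF] := lip_extend hn hn' hd M0 hf.
have [N N0 hF] := lF.
exists F; split=> // [k a b|w].
  move: a; apply: (density hn hn' hd) => [||a].
  - exact: (lip_comp lF (lipD hn (lipZ hn k (lip_id _)) (lip_cst _ hn _))).
  - exact: (lipD hn' (lipZ hn' _ lF) (lip_cst _ hn' _)).
  move: b; apply: (density hn hn' hd) => [||b].
  - exact: (lip_comp lF (lipD hn (lip_cst _ hn _) (lip_id _))).
  - exact: (lipD hn' (lip_cst _ hn' _) lF).
  by rewrite -(dn_lin hd) !Fi lf.
apply/ler_addgt0Pr => e e0.
have d0 : 0 < M + N + 1 by rewrite ltr_wpDl // addr_ge0.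
have [a ha] := dn_dense hd w (divr_gt0 e0 d0).
have h1 : nm' (F w) <= M * nm (i a) + N * nm (w - i a).
  have h0 : nm' (F (i a)) <= M * nm (i a) by rewrite Fi (dn_iso hd).
  rewrite -[F w](subrK (F (i a))) (le_trans (nrm_triangle hn' _ _)) //.
  by rewrite [leLHS]addrC; exact: lerD h0 (hF _ _).
have h2 : nm (i a) <= nm w + nm (w - i a).
  by rewrite -[X in nm X <= _](subKr w) (cnB hn).
apply: le_trans h1 _; apply: le_trans (lerD (ler_wpM2l M0 h2) (lexx _)) _.
rewrite mulrDr -addrA lerD2l -mulrDl.
move: ha; rewrite ltr_pdivlMr // => /ltW; apply: le_trans.
by rewrite mulrC ler_wpM2l ?(cn_ge0 hn) // lerDl.
Qed.

End ExtSemilin.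

(** Extension in the second variable, then in the first one. *)
Lemma ext_bilin (V1 V2 W1 W2 W' : lmodType R[i]) (p1 : V1 -> R) (p2 : V2 -> R)
    (n1 : W1 -> R) (n2 : W2 -> R) (nm' : W' -> R) (i1 : V1 -> W1) (i2 : V2 -> W2)
    (f : V1 -> V2 -> W') M : is_complete_norm nm' ->
  dense_in p1 n1 i1 -> dense_in p2 n2 i2 -> 0 <= M ->
  (forall k a a' b, f (k *: a + a') b = k *: f a b + f a' b) ->
  (forall k a b b', f a (k *: b + b') = k *: f a b + f a b') ->
  (forall a b, nm' (f a b) <= M * p1 a * p2 b) ->
  exists F, [/\ forall a b, F (i1 a) (i2 b) = f a b,
    forall k a a' b, F (k *: a + a') b = k *: F a b + F a' b,
    forall k a b b', F a (k *: b + b') = k *: F a b + F a b' &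
    forall a b, nm' (F a b) <= M * n1 a * n2 b].
Proof.
move=> hn' h1 h2 M0 fl fr fb.
have p10 a : 0 <= p1 a by rewrite -(dn_iso h1) (cn_ge0 (dn_norm h1)).
have n20 b : 0 <= n2 b by rewrite (cn_ge0 (dn_norm h2)).
have /choice[G hG] a := ext_semilin hn' h2 (mulr_ge0 M0 (p10 a)) (erefl 1) (erefl _)
  (fun k => fr k a) (fb a).
have lG a : lip n2 nm' (G a).
  have [_ g2 g3] := hG a.
  by apply: (lip_semilin (s := id) (mulr_ge0 M0 (p10 a))).
have Gl b k a a' : G (k *: a + a') b = k *: G a b + G a' b.
  move: b; apply: (density (dn_norm h2) hn' h2) => [||b].
  - exact: lG.
  - exact: (lipD hn' (lipZ hn' _ (lG a)) (lG a')).
  by have [-> _ _] := hG (k *: a + a'); have [-> _ _] := hG a; have [-> _ _] := hG a'.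
have Gb b a : nm' (G a b) <= M * n2 b * p1 a.
  by have [_ _ /(_ b)] := hG a; rewrite mulrAC.
have /choice[F hF] b := ext_semilin hn' h1 (mulr_ge0 M0 (n20 b)) (erefl 1) (erefl _)
  (Gl b) (Gb b).
have lF b : lip n1 nm' (F b).
  have [_ g2 g3] := hF b.
  by apply: (lip_semilin (s := id) (mulr_ge0 M0 (n20 b))).
exists (fun a b => F b a); split=> [a b|k a a' b|k a b b'|a b].
- by have [-> _ _] := hF (i2 b); have [-> _ _] := hG a.
- by have [_ -> _] := hF b.
- move: a; apply: (density (dn_norm h1) hn' h1) => [||a].
  + exact: lF.
  + exact: (lipD hn' (lipZ hn' _ (lF b)) (lF b')).
  have [-> _ _] := hF (k *: b + b'); have [-> _ _] := hF b; have [-> _ _] := hF b'.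
  by have [_ -> _] := hG a.
- by have [_ _ /(_ a)] := hF b; rewrite mulrAC.
Qed.

End Extension.

Section OpNorm.
Variables (R : realType) (V W : Type) (p : V -> R) (n : W -> R).
Hypotheses (p0 : forall v, 0 <= p v) (n0 : forall w, 0 <= n w).

Definition opnorm (T : V -> W) : R :=
  inf [set M | 0 <= M /\ forall v, n (T v) <= M * p v].

Lemma opnorm_le (T : V -> W) M : 0 <= M -> (forall v, n (T v) <= M * p v) ->
  opnorm T <= M.
Proof.
move=> M0 hM; apply: ge_inf => //; exists 0 => x [] //.
Qed.

Lemma opnorm_ge0 (T : V -> W) : 0 <= opnorm T.
Proof.
have [[M hM]|h] := pselect ([set M | 0 <= M /\ forall v, n (T v) <= M * p v] !=set0).
  by apply: lb_le_inf; [exists M|move=> x []].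
rewrite /opnorm (_ : [set M | _] = set0) ?inf0 //.
by apply/eqP/negPn/negP => /set0P.
Qed.

Lemma opnorm_bound (T : V -> W) M v : 0 <= M -> (forall v, n (T v) <= M * p v) ->
  n (T v) <= opnorm T * p v.
Proof.
move=> M0 hM; have [pv0|pn0] := eqVneq (p v) 0.
  by have := hM v; rewrite pv0 !mulr0.
have pv : 0 < p v by rewrite lt_def pn0 p0.
rewrite -ler_pdivrMr //; apply: lb_le_inf; first by exists M.
by move=> x [x0 hx]; rewrite ler_pdivrMr.
Qed.

End OpNorm.

(** * The fiberwise completion *)
Section FiberCompletion.
Variables (R : realType) (C : rigid_Cstar_tensor_category R).
Variables (A : pre_Cstar_algebra_object C) (U : C).
Local Notation one := (one_ob : C).
Local Notation fn := (@fiber_norm R C A _).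
Local Notation n0 := (@norm0 R C A).

(** The completion of A(U) is realized among the maps from A(U) to A_0: an element b
    is sent to the inner product with b, and limits are uniform on bounded sets. *)
Definition cpred : {pred A U -> A one} :=
  [pred phi | `[< forall e : R, 0 < e ->
    exists b, forall c, n0 (phi c - inner0 b c) <= e * fn c >]].

Record cfib := CFib { cval :> A U -> A one; cvalP : cval \in cpred }.

HB.instance Definition _ := [isSub of cfib for cval].
HB.instance Definition _ := [Choice of cfib by <:].

Let hn0 := nrm0_complete (norm0P A).
Let CS (a b : A U) : n0 (inner0 a b) <= fn a * fn b := cauchy_schwarz a b.

Lemma cpred_submod : submod_closed cpred.
Proof.
split=> [|k f g]; rewrite !inE.
  move=> e e0; exists 0 => c.
  by rewrite inner00l subr0 (cn0 hn0) mulr_ge0 ?(ltW e0) ?fn_ge0.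
move=> hf hg e e0.
pose r := complex.Re `|k|; have r0 : 0 <= r := Re_norm_ge0 k.
have r1 : 0 < r + 1 by rewrite ltr_wpDl.
have [a ha] := hf (e / 2 / (r + 1)) (divr_gt0 (divr_gt0 e0 (ltr0Sn R 1)) r1).
have [b hb] := hg (e / 2) (divr_gt0 e0 (ltr0Sn R 1)).
exists (k *: a + b) => c.
have -> : (k *: f + g) c - inner0 (k *: a + b) c
    = k *: (f c - inner0 a c) + (g c - inner0 b c).
  by rewrite inner0_linl scalerBr opprD addrACA.
rewrite (le_trans (nrm_triangle hn0 _ _)) // (nrm_scale hn0) -/r.
have h1 := ler_wpM2l r0 (ha c); have h2 := hb c.
have : r * (e / 2 / (r + 1) * fn c) <= e / 2 * fn c.
  rewrite mulrA ler_wpM2r ?fn_ge0 // mulrCA ler_piMr ?divr_ge0 ?(ltW e0) //.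
  by rewrite ler_pdivrMr // mul1r lerDl.
have -> : e * fn c = e / 2 * fn c + e / 2 * fn c by rewrite -mulrDl -splitr.
lra.
Qed.

HB.instance Definition _ := GRing.isSubmodClosed.Build R[i] (A U -> A one) cpred
  cpred_submod.
HB.instance Definition _ := [SubChoice_isSubLmodule of cfib by <:].

Definition cnrm (phi : cfib) : R := opnorm fn n0 phi.

Lemma cval_bounded (phi : cfib) : exists2 M, 0 <= M & forall c, n0 (phi c) <= M * fn c.
Proof.
have := cvalP phi; rewrite inE => /(_ 1 ltr01)[b hb].
exists (1 + fn b) => [|c]; first by rewrite addr_ge0 ?fn_ge0.
rewrite -[phi c](subrK (inner0 b c)) (le_trans (nrm_triangle hn0 _ _)) //.
by rewrite mulrDl lerD.
Qed.

Lemma cnrm_bound (phi : cfib) c : n0 (phi c) <= cnrm phi * fn c.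
Proof.
have [M M0 hM] := cval_bounded phi.
exact: (opnorm_bound (@fn_ge0 _ _ _ _) c M0 hM).
Qed.

Lemma cnrm_ge0 (phi : cfib) : 0 <= cnrm phi. Proof. exact: opnorm_ge0. Qed.

Lemma cnrmZ_le k (phi : cfib) : cnrm (k *: phi) <= complex.Re `|k| * cnrm phi.
Proof.
apply: opnorm_le => [|c]; first by rewrite mulr_ge0 ?Re_norm_ge0 ?cnrm_ge0.
rewrite [n0 _](nrm_scale hn0) -mulrA ler_wpM2l ?Re_norm_ge0 //.
exact: cnrm_bound.
Qed.

Lemma cnrm_complete : is_complete_norm cnrm.
Proof.
apply: complete_norm_intro.
- move=> f g; apply: opnorm_le => [|c]; first by rewrite addr_ge0 ?cnrm_ge0.
  rewrite mulrDl (le_trans (nrm_triangle hn0 _ _)) // lerD ?cnrm_bound //.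
- move=> k f; apply/eqP; rewrite eq_le cnrmZ_le andTb.
  have [->|k0] := eqVneq k 0; first by rewrite normr0 mul0r cnrm_ge0.
  rewrite -{1}[f](scalerK k0).
  apply: le_trans (ler_wpM2l (Re_norm_ge0 k) (cnrmZ_le _ _)) _.
  by rewrite mulrA -Re_normM mulfV // normr1 mul1r.
- move=> f f0; apply: val_inj; apply/funext => c /=; apply: (nrm_eq0 hn0).
  by apply/eqP; rewrite eq_le (cn_ge0 hn0) andbT (le_trans (cnrm_bound f c)) // f0 mul0r.
move=> u cu.
have /choice[phi hphi] c : exists x, tends n0 (fun n => u n c) x.
  apply: (complete_tends hn0) => e e0.
  have d0 : 0 < fn c + 1 by rewrite ltr_wpDl ?fn_ge0.
  have [N hN] := cu _ (divr_gt0 e0 d0); exists N => m n mN nN.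
  have := hN m n mN nN; rewrite ltr_pdivlMr // => h.
  apply: le_lt_trans (cnrm_bound (u m - u n) c) _; apply: le_lt_trans h.
  by rewrite ler_wpM2l ?cnrm_ge0 // lerDl.
have unif e : 0 < e -> exists N, forall n c, (N <= n)%N ->
    n0 (u n c - phi c) <= e * fn c.
  move=> e0; have [N hN] := cu e e0; exists N => n c nN.
  apply/ler_addgt0Pr => d d0; have [N' hN'] := hphi c d d0.
  pose m := maxn N N'.
  rewrite (le_trans (cn_tri hn0 _ (u m c) _)) // lerD //.
    apply: le_trans (cnrm_bound (u n - u m) c) _.
    by rewrite ler_wpM2r ?fn_ge0 // ltW // hN ?leq_maxl.
  by rewrite ltW // hN' ?leq_maxr.
have pphi : phi \in cpred.
  rewrite inE => e e0; have e2 : 0 < e / 2 by rewrite divr_gt0.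
  have [N hN] := unif _ e2; have := cvalP (u N); rewrite inE => /(_ _ e2)[b hb].
  exists b => c; rewrite (le_trans (cn_tri hn0 _ (u N c) _)) // [e]splitr mulrDl.
  by rewrite lerD // (cnC hn0) hN.
exists (CFib pphi) => e e0; have e2 : 0 < e / 2 by rewrite divr_gt0.
have [N hN] := unif _ e2; exists N => n nN.
apply: le_lt_trans (_ : e / 2 < e); last by rewrite ltr_pdivrMr // ltr_pMr // ltr1n.
by apply: opnorm_le => [|c]; [exact: ltW|exact: hN].
Qed.

Lemma ciota_subproof (b : A U) : (fun c => inner0 b c) \in cpred.
Proof.
rewrite inE => e e0; exists b => c.
by rewrite subrr (cn0 hn0) mulr_ge0 ?fn_ge0 ?(ltW e0).
Qed.

Definition ciota (b : A U) : cfib := CFib (ciota_subproof b).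

(** The embedding is isometric by the Cauchy-Schwarz inequality. *)
Lemma cfib_dense : dense_in fn cnrm ciota.
Proof.
split.
- exact: cnrm_complete.
- by move=> k a b; apply: val_inj; apply/funext => c /=; rewrite inner0_linl.
- move=> a; apply/eqP; rewrite eq_le; apply/andP; split.
    by apply: opnorm_le => [|c]; [exact: fn_ge0|exact: CS].
  have [->|f0] := eqVneq (fn a) 0; first exact: cnrm_ge0.
  have fp : 0 < fn a by rewrite lt_def f0 fn_ge0.
  rewrite -(ler_pM2r fp) -expr2 fn_sqr; exact: (cnrm_bound (ciota a) a).
move=> phi e e0; have e2 : 0 < e / 2 by rewrite divr_gt0.
have := cvalP phi; rewrite inE => /(_ _ e2)[b hb]; exists b.
apply: le_lt_trans (_ : e / 2 < e); last by rewrite ltr_pdivrMr // ltr_pMr // ltr1n.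
by apply: opnorm_le => [|c]; [exact: ltW|exact: hb].
Qed.

End FiberCompletion.

Section CompletedAlgebra.
Variables (R : realType) (C : rigid_Cstar_tensor_category R).
Variable A : pre_Cstar_algebra_object C.
Local Notation one := (one_ob : C).
Variables (B : C -> lmodType R[i]) (nm : forall U, B U -> R).
Variable i : forall U, A U -> B U.
Arguments i {U}.
Arguments nm {U}.
Hypothesis hd : forall U, dense_in (@fiber_norm R C A U) (@nm U) (@i U).
Implicit Types U V W : C.

Let hn U : is_complete_norm (@nm U) := dn_norm (hd U).
Let nm_ge0 U (b : B U) : 0 <= nm b := cn_ge0 (hn U) b.

Lemma i_lin U k (a b : A U) : i (k *: a + b) = k *: i a + i b.
Proof. exact: dn_lin (hd U) k a b. Qed.

(** The structure maps of the completion extend those of A by continuity, and the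
    axioms hold by density. *)
Lemma camap_ex U V (T : hom U V) : exists F : B V -> B U,
  [/\ forall a, F (i a) = i (amap T a),
      forall k a b, F (k *: a + b) = k *: F a + F b &
      exists2 M, 0 <= M & forall w, nm (F w) <= M * nm w].
Proof.
have [M M0 hM] := amap_bound A T.
have [||||F [F1 F2 F3]] := ext_semilin (hn U) (hd V) (s := id)
  (f := fun a => i (amap T a)) M0.
- by [].
- by [].
- by move=> k a b; rewrite amap_linr i_lin.
- by move=> a; rewrite (dn_iso (hd U)).
by exists F; split=> //; exists M.
Qed.

Lemma camul_ex U V : exists F : B U -> B V -> B (V ⊗ U),
  [/\ forall a b, F (i a) (i b) = i (a ⋅ b),
      forall k a a' b, F (k *: a + a') b = k *: F a b + F a' b,
      forall k a b b', F a (k *: b + b') = k *: F a b + F a b' &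
      forall a b, nm (F a b) <= 1 * nm a * nm b].
Proof.
apply: (ext_bilin (hn _) (hd U) (hd V) ler01 (f := fun a b => i (a ⋅ b))).
- by move=> k a a' b; rewrite amul_linl i_lin.
- by move=> k a b b'; rewrite amul_linr i_lin.
- by move=> a b; rewrite (dn_iso (hd _)) mul1r amul_bound.
Qed.

Lemma cnat_ex U : exists F : B U -> B (dual U),
  [/\ forall a, F (i a) = i a^♮,
      forall k a b, F (k *: a + b) = k^*%R *: F a + F b &
      exists2 M, 0 <= M & forall w, nm (F w) <= M * nm w].
Proof.
have [||||F [F1 F2 F3]] := ext_semilin (hn (dual U)) (hd U)
  (s := fun k => k^*%R) (f := fun a : A U => i a^♮) (fn_ge0 (coev A U)).
- exact: conjC1.
- exact: rmorphN1.
- by move=> k a b; rewrite natural_antilin i_lin.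
- by move=> a; rewrite (dn_iso (hd _)) natural_bound.
by exists F; split=> //; exists (fiber_norm (coev A U)); [exact: fn_ge0|].
Qed.

Definition camap U V (T : hom U V) : B V -> B U := projT1 (cid (camap_ex T)).
Definition camul U V : B U -> B V -> B (V ⊗ U) := projT1 (cid (camul_ex U V)).
Definition cnat U : B U -> B (dual U) := projT1 (cid (cnat_ex U)).

Lemma camap_i U V (T : hom U V) a : camap T (i a) = i (amap T a).
Proof. by rewrite /camap; case: cid => F [/= ->]. Qed.
Lemma camap_linr U V k (T : hom U V) a b :
  camap T (k *: a + b) = k *: camap T a + camap T b.
Proof. by rewrite /camap; case: cid => F [/= _ ->]. Qed.
Lemma camap_bound U V (T : hom U V) : exists2 M, 0 <= M &
  forall w, nm (camap T w) <= M * nm w.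
Proof. by rewrite /camap; case: cid => F [/= _ _ h]. Qed.
Lemma camul_i U V (a : A U) (b : A V) : camul (i a) (i b) = i (a ⋅ b).
Proof. by rewrite /camul; case: cid => F [/= ->]. Qed.
Lemma camul_linl U V k (a a' : B U) (b : B V) :
  camul (k *: a + a') b = k *: camul a b + camul a' b.
Proof. by rewrite /camul; case: cid => F [/= _ ->]. Qed.
Lemma camul_linr U V k (a : B U) (b b' : B V) :
  camul a (k *: b + b') = k *: camul a b + camul a b'.
Proof. by rewrite /camul; case: cid => F [/= _ _ ->]. Qed.
Lemma camul_bound U V (a : B U) (b : B V) : nm (camul a b) <= nm a * nm b.
Proof. by rewrite /camul; case: cid => F [/= _ _ _ /(_ a b)]; rewrite mul1r. Qed.
Lemma cnat_i U (a : A U) : cnat (i a) = i a^♮.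
Proof. by rewrite /cnat; case: cid => F [/= ->]. Qed.
Lemma cnat_antilin U k (a b : B U) :
  cnat (k *: a + b) = k^*%R *: cnat a + cnat b.
Proof. by rewrite /cnat; case: cid => F [/= _ ->]. Qed.
Lemma cnat_bound U : exists2 M, 0 <= M & forall w : B U, nm (cnat w) <= M * nm w.
Proof. by rewrite /cnat; case: cid => F [/= _ _ h]. Qed.

Lemma lip_camap U V (T : hom U V) : lip nm nm (camap T).
Proof.
have [M M0 hM] := camap_bound T.
by apply: (lip_semilin (s := id) M0) => // k a b; rewrite camap_linr.
Qed.
Lemma lip_camull U V (b : B V) : lip nm nm (fun a : B U => camul a b).
Proof.
apply: (lip_semilin (s := id) (nm_ge0 b)) => // [k a a'|a].
  by rewrite camul_linl.
by rewrite mulrC camul_bound.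
Qed.
Lemma lip_camulr U V (a : B U) : lip nm nm (fun b : B V => camul a b).
Proof.
apply: (lip_semilin (s := id) (nm_ge0 a)) => // [k b b'|b].
  by rewrite camul_linr.
by rewrite camul_bound.
Qed.
Lemma lip_cnat U : lip nm nm (@cnat U).
Proof.
have [M M0 hM] := cnat_bound U.
apply: (lip_semilin (s := fun k => k^*%R) M0) => //.
- exact: conjC1.
- exact: rmorphN1.
- exact: cnat_antilin.
Qed.

Let dens U V := density (hn U) (hn V) (hd U).

Lemma camap_linl U V k (S T : hom U V) a :
  camap (k *: S + T) a = k *: camap S a + camap T a.
Proof.
move: a; apply: dens => [||a]; first exact: lip_camap.
  exact: (lipD (hn _) (lipZ (hn _) _ (lip_camap S)) (lip_camap T)).
by rewrite !camap_i amap_linl i_lin.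
Qed.

Lemma camap1 U (a : B U) : camap (idm U) a = a.
Proof.
move: a; apply: dens => [||a]; [exact: lip_camap|exact: lip_id|].
by rewrite camap_i amap1.
Qed.

Lemma camap_comp U V W (S : hom V W) (T : hom U V) a :
  camap (S ∘ T) a = camap T (camap S a).
Proof.
move: a; apply: dens => [||a]; first exact: lip_camap.
  exact: (lip_comp (lip_camap T) (lip_camap S)).
by rewrite !camap_i amap_comp.
Qed.

Lemma camul_nat U U' V V' (T : hom U' U) (S : hom V' V) a b :
  camul (camap T a) (camap S b) = camap (S ⊠ T) (camul a b).
Proof.
move: a; apply: dens => [||a].
- exact: (lip_comp (lip_camull _ _) (lip_camap T)).
- exact: (lip_comp (lip_camap _) (lip_camull _ _)).
move: b; apply: dens => [||b].
- exact: (lip_comp (lip_camulr _ _) (lip_camap S)).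
- exact: (lip_comp (lip_camap _) (lip_camulr _ _)).
by rewrite !camap_i !camul_i camap_i amul_nat.
Qed.

Lemma camulA U V W (a : B U) (b : B V) (c : B W) :
  camap (eqm (tensA W V U)) (camul a (camul b c)) = camul (camul a b) c.
Proof.
move: a; apply: dens => [||a].
- exact: (lip_comp (lip_camap _) (lip_camull _ _)).
- exact: (lip_comp (lip_camull _ _) (lip_camull _ _)).
move: b; apply: dens => [||b].
- exact: (lip_comp (lip_camap _) (lip_comp (lip_camulr _ _) (lip_camull _ _))).
- exact: (lip_comp (lip_camull _ _) (lip_camulr _ _)).
move: c; apply: dens => [||c].
- exact: (lip_comp (lip_camap _) (lip_comp (lip_camulr _ _) (lip_camulr _ _))).
- exact: lip_camulr.
by rewrite !camul_i camap_i amulA.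
Qed.

Lemma camul1 U (a : B U) : camap (eqm (esym (tens1o U))) (camul a (i aone)) = a.
Proof.
move: a; apply: dens => [||a]; [|exact: lip_id|].
  exact: (lip_comp (lip_camap _) (lip_camull _ _)).
by rewrite camul_i camap_i amul1.
Qed.

Lemma ca1mul U (a : B U) : camap (eqm (esym (tenso1 U))) (camul (i aone) a) = a.
Proof.
move: a; apply: dens => [||a]; [|exact: lip_id|].
  exact: (lip_comp (lip_camap _) (lip_camulr _ _)).
by rewrite camul_i camap_i a1mul.
Qed.

Definition completed_algebra : algebra_object C :=
  AlgebraObject camap_linl camap_linr camap1 camap_comp camul_linl camul_linr
    camul_nat camulA camul1 ca1mul.

Lemma cnat_amap U V (T : hom U V) (Tv : hom (dual U) (dual V)) (a : B V) :
  (idm U ⊠ Tv) ∘ evb U = (T^† ⊠ idm (dual V)) ∘ evb V ->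
  cnat (camap T a) = camap Tv (cnat a).
Proof.
move=> h; move: a; apply: dens => [||a].
- exact: (lip_comp (@lip_cnat _) (lip_camap _)).
- exact: (lip_comp (lip_camap _) (@lip_cnat _)).
by rewrite camap_i !cnat_i camap_i (natural_amap _ h).
Qed.

Lemma cnatK U (a : B U) : camap (dual_dual U) (cnat (cnat a)) = a.
Proof.
move: a; apply: dens => [||a]; [|exact: lip_id|].
  exact: (lip_comp (lip_camap _) (lip_comp (@lip_cnat _) (@lip_cnat _))).
by rewrite !cnat_i camap_i naturalK.
Qed.

Lemma cnat1 : camap (dual_one C) (cnat (i aone)) = i aone.
Proof. by rewrite cnat_i camap_i natural1. Qed.

Lemma cnat_mul U V (a : B U) (b : B V) :
  camul (cnat a) (cnat b) = camap (dual_tens U V) (cnat (camul b a)).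
Proof.
move: a; apply: dens => [||a].
- exact: (lip_comp (lip_camull _ _) (@lip_cnat _)).
- exact: (lip_comp (lip_camap _) (lip_comp (@lip_cnat _) (lip_camulr _ _))).
move: b; apply: dens => [||b].
- exact: (lip_comp (lip_camulr _ _) (@lip_cnat _)).
- exact: (lip_comp (lip_camap _) (lip_comp (@lip_cnat _) (lip_camull _ _))).
by rewrite !cnat_i !camul_i cnat_i camap_i natural_mul.
Qed.

Definition completed_star : star_algebra_object C :=
  @StarAlgebraObject R C completed_algebra cnat cnat_antilin cnat_amap cnatK cnat1
    cnat_mul.

Lemma completed_is_completion :
  @is_fiberwise_completion R C A completed_star (@i) (@nm).
Proof.
split.
- split.
  + by move=> U k a b; rewrite i_lin.
  + by move=> U V T a; rewrite [RHS]camap_i.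
  + by move=> U V a b; rewrite [RHS]camul_i.
  + by [].
  + by move=> U a; rewrite [RHS]cnat_i.
- exact: hn.
- by move=> U a; rewrite (dn_iso (hd U)).
- by move=> U b e e0; exact: (dn_dense (hd U)).
- by move=> U V T; have [M _ hM] := camap_bound T; exists M.
- by move=> U V; exists 1 => a b; rewrite mul1r; exact: camul_bound.
- by move=> U; have [M _ hM] := cnat_bound U; exists M.
Qed.

End CompletedAlgebra.

Theorem completion_exists (R : realType) (C : rigid_Cstar_tensor_category R)
    (A : pre_Cstar_algebra_object C) :
  exists (B : star_algebra_object C) (iota : forall U : C, A U -> B U)
     (nm : forall U : C, B U -> R), is_fiberwise_completion iota nm.
Proof.
have hd (U : C) := cfib_dense A U.
by eexists _, _, _; exact: (completed_is_completion hd).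
Qed.

(** * A completion is again a pre-C*-algebra object *)
Section Limits.
Variable R : realType.

Lemma lim_le (f g : nat -> R) (l l' : R) : f n @[n --> \oo] --> l ->
  g n @[n --> \oo] --> l' -> (forall n, f n <= g n) -> l <= l'.
Proof. by move=> hf hg h; apply: (ler_cvg_to hf hg); exact: nearW. Qed.

Lemma lim_eq (f g : nat -> R) (l l' : R) : f n @[n --> \oo] --> l ->
  g n @[n --> \oo] --> l' -> (forall n, f n = g n) -> l = l'.
Proof.
move=> hf hg h; apply/eqP; rewrite eq_le (lim_le hf hg) ?(lim_le hg hf) // => n.
  by rewrite h.
by rewrite h.
Qed.

Lemma tends_cvg (W : lmodType R[i]) (nm : W -> R) (u : nat -> W) v :
  is_complete_norm nm -> tends nm u v -> nm (u n) @[n --> \oo] --> nm v.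
Proof.
move=> hn h; apply/cvgrPdist_lt => e e0; have [N hN] := h e e0.
exists N => //= n /= nN; rewrite distrC (le_lt_trans (cn_dist hn _ _)) // hN //.
Qed.

Lemma tends_lip (W W' : lmodType R[i]) (nm : W -> R) (nm' : W' -> R) F
    (u : nat -> W) v : is_complete_norm nm -> lip nm nm' F ->
  tends nm u v -> tends nm' (fun n => F (u n)) (F v).
Proof.
move=> hn [M M0 hF] h e e0; have M1 : 0 < M + 1 by rewrite ltr_wpDl.
have [N hN] := h _ (divr_gt0 e0 M1); exists N => n nN.
apply: le_lt_trans (hF _ _) _; have := hN n nN; rewrite ltr_pdivlMr // mulrDr mulr1.
by rewrite mulrC; apply: le_lt_trans; rewrite lerDl (cn_ge0 hn).
Qed.

Lemma tends_bilin (W1 W2 W' : lmodType R[i]) (n1 : W1 -> R) (n2 : W2 -> R)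
    (nm' : W' -> R) (F : W1 -> W2 -> W') M (u : nat -> W1) (v : nat -> W2) x y :
  is_complete_norm n1 -> is_complete_norm n2 -> is_complete_norm nm' ->
  (forall k a a' b, F (k *: a + a') b = k *: F a b + F a' b) ->
  (forall k a b b', F a (k *: b + b') = k *: F a b + F a b') ->
  (forall a b, nm' (F a b) <= M * n1 a * n2 b) ->
  tends n1 u x -> tends n2 v y -> tends nm' (fun n => F (u n) (v n)) (F x y).
Proof.
move=> h1 h2 h' fl fr fb hu hv e e0.
have Fl a a' b : F (a - a') b = F a b - F a' b.
  by rewrite addrC -scaleN1r fl scaleN1r addrC.
have Fr a b b' : F a (b - b') = F a b - F a b'.
  by rewrite addrC -scaleN1r fr scaleN1r addrC.
pose K := `|M| * (n2 y + 1) + 1; pose L := `|M| * n1 x + 1.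
have K0 : 0 < K by rewrite ltr_wpDl // mulr_ge0 // addr_ge0 // (cn_ge0 h2).
have L0 : 0 < L by rewrite ltr_wpDl // mulr_ge0 // (cn_ge0 h1).
have e2 : 0 < e / 2 by rewrite divr_gt0.
have [N1 H1] := hu _ (divr_gt0 e2 K0); have [N2 H2] := hv _ (divr_gt0 e2 L0).
have [N3 H3] := hv 1 ltr01.
exists (maxn N1 (maxn N2 N3)) => n; rewrite !geq_max => /and3P[n1' n2' n3'].
have vb : n2 (v n) <= n2 y + 1.
  rewrite -[v n](subrK y) (le_trans (nrm_triangle h2 _ _)) // addrC lerD //.
  by apply: ltW; apply: H3.
have -> : F (u n) (v n) - F x y = F (u n - x) (v n) + F x (v n - y).
  by rewrite Fl Fr addrA subrK.
apply: le_lt_trans (nrm_triangle h' _ _) _; rewrite [e]splitr ltrD //.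
  apply: le_lt_trans (fb _ _) _.
  apply: le_lt_trans (_ : n1 (u n - x) * (`|M| * (n2 y + 1)) < _).
    rewrite mulrAC mulrC ler_wpM2l ?(cn_ge0 h1) //.
    by rewrite (le_trans (ler_wpM2r (cn_ge0 h2 _) (ler_norm M))) // ler_wpM2l.
  have := H1 n n1'; rewrite ltr_pdivlMr // /K mulrDr mulr1; apply: le_lt_trans.
  by rewrite lerDl (cn_ge0 h1).
apply: le_lt_trans (fb _ _) _.
apply: le_lt_trans (_ : n2 (v n - y) * (`|M| * n1 x) < _).
  rewrite mulrC ler_wpM2l ?(cn_ge0 h2) // ler_wpM2r ?(cn_ge0 h1) //.
  exact: ler_norm.
have := H2 n n2'; rewrite ltr_pdivlMr // /L mulrDr mulr1; apply: le_lt_trans.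
by rewrite lerDl (cn_ge0 h2).
Qed.

End Limits.

Section CompletionPositive.
Variables (R : realType) (C : rigid_Cstar_tensor_category R).
Variables (A : pre_Cstar_algebra_object C) (B : star_algebra_object C).
Variables (iota : forall U, A U -> B U) (nm : forall U, B U -> R).
Hypothesis hB : is_fiberwise_completion iota nm.
Arguments iota {U}.
Arguments nm {U}.
Local Notation one := (one_ob : C).
Let hm := completion_morph hB.
Let hn U : is_complete_norm (@nm U) := @completion_norm _ _ _ _ _ _ hB U.

Lemma iota_star0 (a : A one) : iota (star0 a) = star0 (iota a).
Proof. by rewrite /star0 (morph_amap hm) (morph_natural hm). Qed.
Lemma iota_mul0 (a b : A one) : iota (mul0 a b) = mul0 (iota a) (iota b).
Proof. by rewrite /mul0 (morph_amap hm) (morph_mul hm). Qed.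
Lemma iota_inner0 U (a b : A U) : iota (inner0 a b) = inner0 (iota a) (iota b).
Proof. by rewrite /inner0 (morph_amap hm) (morph_mul hm) (morph_natural hm). Qed.

Lemma fiber_norm_one (a : A one) : fiber_norm a = norm0 a.
Proof.
apply/eqP; rewrite -(eqrXn2 (_ : 0 < 2)%N) ?fn_ge0 //; last exact: (nr_ge0 (a : celt (base A))).
rewrite fn_sqr /ip inner0_unit -{1}[a]star0K.
by rewrite [nr _](@nrC _ (base A) (star0 a)) (@nr_st _ (base A)).
Qed.

Lemma nm_iota (a : A one) : nm (iota a) = norm0 a.
Proof. by rewrite (completion_isometry hB) fiber_norm_one. Qed.

(** Every axiom on the norm of B is a limit of the corresponding one for A. *)
Lemma approx U (b : B U) : exists u : nat -> A U, tends nm (fun n => iota (u n)) b.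
Proof.
have /choice[u hu] (n : nat) : exists a, nm (b - iota a) < n.+1%:R^-1.
  by apply: (completion_dense hB); rewrite invr_gt0.
exists u => e e0; exists (Num.bound e^-1) => n nN.
rewrite (cnC (@hn U)) (lt_le_trans (hu n)) // invf_ple ?posrE //.
rewrite ltW // (lt_le_trans (archi_boundP _)) ?invr_ge0 ?(ltW e0) //.
by rewrite ler_nat (leq_trans nN).
Qed.

Lemma lip_bamap U V (T : hom U V) : lip nm nm (fun b : B V => amap T b).
Proof.
have [M hM] := completion_amap hB T.
apply: (lip_semilin (s := id) (normr_ge0 M)) => // [k a b|a].
  by rewrite amap_linr.
by rewrite (le_trans (hM a)) // ler_wpM2r ?(cn_ge0 (@hn _)) // ler_norm.
Qed.

Lemma lip_bnat U : lip nm nm (fun b : B U => b^♮).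
Proof.
have [M hM] := completion_natural hB U.
apply: (lip_semilin (s := fun k => k^*%R) (normr_ge0 M)).
- exact: conjC1.
- exact: rmorphN1.
- by move=> k a b; rewrite natural_antilin.
by move=> a; rewrite (le_trans (hM a)) // ler_wpM2r ?(cn_ge0 (@hn _)) // ler_norm.
Qed.

Lemma tends_mul U V (u : nat -> B U) (v : nat -> B V) x y :
  tends nm u x -> tends nm v y -> tends nm (fun n => u n ⋅ v n) (x ⋅ y).
Proof.
have [M hM] := completion_mul hB U V.
apply: (tends_bilin (@hn _) (@hn _) (@hn _) _ _ hM) => [k a a' b|k a b b'].
  exact: amul_linl.
exact: amul_linr.
Qed.

Lemma tends_inner0 U (u v : nat -> B U) x y :
  tends nm u x -> tends nm v y -> tends nm (fun n => inner0 (u n) (v n)) (inner0 x y).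
Proof.
move=> hu hv; apply: (tends_lip (@hn _) (lip_bamap _)).
exact: (tends_mul hu (tends_lip (@hn _) (@lip_bnat _) hv)).
Qed.

Lemma tends_mul0 (u v : nat -> B one) x y :
  tends nm u x -> tends nm v y -> tends nm (fun n => mul0 (u n) (v n)) (mul0 x y).
Proof. by move=> hu hv; exact: (tends_lip (@hn _) (lip_bamap _) (tends_mul hu hv)). Qed.

Lemma tends_star0 (u : nat -> B one) x :
  tends nm u x -> tends nm (fun n => star0 (u n)) (star0 x).
Proof.
move=> hu; apply: (tends_lip (@hn _) (lip_bamap _)).
exact: (tends_lip (@hn _) (@lip_bnat _) hu).
Qed.

Lemma completion_norm0 : is_Cstar_norm0 (@nm one : B one -> R).
Proof.
split; first exact: hn.
- move=> a b; have [u hu] := approx a; have [v hv] := approx b.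
  apply: (lim_le (tends_cvg (@hn _) (tends_mul0 hu hv))
    (cvgM (tends_cvg (@hn _) hu) (tends_cvg (@hn _) hv))) => n /=.
  by rewrite -iota_mul0 !nm_iota; exact: (nrm0_submul (norm0P A)).
- move=> a; have [u hu] := approx a.
  rewrite expr2.
  apply: (lim_eq (tends_cvg (@hn _) (tends_mul0 (tends_star0 hu) hu))
    (cvgM (tends_cvg (@hn _) hu) (tends_cvg (@hn _) hu))) => n /=.
  by rewrite -iota_star0 -iota_mul0 !nm_iota (nrm0_Cstar (norm0P A)) expr2.
Qed.

(** Positive elements form a closed set, and they have square roots. *)
Lemma completion_ge0 U (b : B U) : exists x, inner0 b b = mul0 (star0 x) x.
Proof.
have [u hu] := approx b.
pose B0 := base_of completion_norm0.
pose v n : celt B0 := inner0 (iota (u n)) (iota (u n)).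
have t : tends (@nr _ B0) v (inner0 b b : celt B0) := tends_inner0 hu hu.
have p : Pos (inner0 b b : celt B0).
  apply: (pos_closed _ t) => n; rewrite /v.
  rewrite -iota_inner0; have [x ->] := inner0_ge0 (u n).
  rewrite iota_mul0 iota_star0; exact: (@stM_pos _ (base_of completion_norm0)).
have [y [[sy _] yy _]] := pos_sqrt p.
exists y; change (star0 (y : B one) = y) in sy.
by rewrite sy; symmetry; exact: yy.
Qed.

Definition completion_pre : pre_Cstar_algebra_object C :=
  PreCstarAlgebraObject completion_norm0 completion_ge0.

Lemma completion_fiber_norm U (b : completion_pre U) : fiber_norm b = nm b.
Proof.
have [u hu] := approx b.
rewrite /fiber_norm (_ : norm0 (inner0 b b) = nm b * nm b).
  by rewrite -expr2 sqrtr_sqr ger0_norm // (cn_ge0 (@hn _)).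
apply: (lim_eq (tends_cvg (@hn _) (tends_inner0 hu hu))
  (cvgM (tends_cvg (@hn _) hu) (tends_cvg (@hn _) hu))) => n /=.
rewrite -iota_inner0 nm_iota (completion_isometry hB) -expr2 fn_sqr.
by [].
Qed.

End CompletionPositive.

(** * The involution and the action on the module category *)
Section Whisker.
Import Strict.
Variables (R : realType) (C : strict_moncat R).
Implicit Types (A B : C) (x : mor C).

Lemma whisk_l A A' x : ptens (pid A) (ptens (pid A') x) = ptens (pid (A ⊗ A')) x.
Proof. by rewrite ptensA ptens_id. Qed.
Lemma whisk_r B B' x : ptens (ptens x (pid B)) (pid B') = ptens x (pid (B ⊗ B')).
Proof. by rewrite -ptensA ptens_id. Qed.
Lemma whisk_m A B x : ptens (ptens (pid A) x) (pid B) = ptens (pid A) (ptens x (pid B)).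
Proof. by rewrite ptensA. Qed.
Lemma pack_nestV (C' : rigid_Cstar_tensor_category R) (U V D E : C')
    (r : hom one_ob (D ⊗ U)) (s : hom one_ob (E ⊗ V)) :
  pack (nest r s)^† = pcomp (pack s^†) (ptens (pid E) (ptens (pack r^†) (pid V))).
Proof. by rewrite /nest dagM packM pack_insertV. Qed.
Lemma pack_unit_solV (C' : rigid_Cstar_tensor_category R) :
  pack (unit_sol : hom (one_ob : C') _)^† = pid one_ob.
Proof. by rewrite /unit_sol dag_eqm pack_eqm tens1o. Qed.
Lemma pack_idm A : pack (idm A) = pid A. Proof. by []. Qed.

End Whisker.

(** The tactic wnf distributes whiskerings over composites and merges nested ones;
    it leaves a composite of whiskered generators, in the order of the diagram. *)
Ltac packs := rewrite ?(pack_nest, pack_insert, pack_insertV, pack_cup, pack_cap,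
  pack_lw, pack_rw, Strict.pack_eqml, Strict.pack_eqmr, Strict.packM, Strict.packT,
  pack_unit_sol,
  pack_nestV, pack_unit_solV, pack_asc, Strict.pack_eqm, pack_idm).
Ltac wends := repeat first
  [ rewrite Strict.src_ptens | rewrite Strict.tgt_ptens | rewrite Strict.tgt_pcomp
  | rewrite Strict.src_pcomp; [|solve [wends]] ];
  rewrite /Strict.src /Strict.tgt /=; by do ?rewrite (tens1o, tenso1, tensA).
Ltac whisk := repeat first
  [ rewrite pcompr; [|solve [wends]]
  | rewrite pcompl; [|solve [wends]]
  | rewrite whisk_l | rewrite whisk_r | rewrite whisk_m
  | rewrite Strict.ptens_id | rewrite Strict.ptens1 | rewrite Strict.ptensm1
  | rewrite Strict.pcomp1; [|solve [wends]]
  | rewrite Strict.p1comp; [|solve [wends]] ].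
Ltac wnf := packs; whisk; rewrite ?tensA ?tens1o ?tenso1.
(** Closes an identity that holds by whiskering and associativity alone. *)
Ltac wdone := wnf; repeat (rewrite Strict.pcompA; [|solve [wends]|solve [wends]]); by [].

Section ModuleStar.
Import Strict.
Variables (R : realType) (C : rigid_Cstar_tensor_category R).
Variable A : star_algebra_object C.
Implicit Types X Y Z U V W : C.
Local Notation one := (one_ob : C).

(** Y ⊗ dual X is a dual of X ⊗ dual Y; through this solution star_by is mstar. *)
Definition homr X Y : hom one ((Y ⊗ dual X) ⊗ (X ⊗ dual Y)) := nest (ev X) (evb Y).

Lemma homr_solution X Y : solution (homr X Y) (homr Y X).
Proof. exact: solution_nest (ev_solution X) (solution_flip (ev_solution Y)). Qed.

Lemma mstarE X Y (f : mhom A X Y) : mstar f = star_by (homr X Y) f.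
Proof. by []. Qed.

Lemma mstar_antilin X Y k (f g : mhom A X Y) :
  mstar (k *: f + g) = k^*%R *: mstar f + mstar g.
Proof. exact: star_by_antilin. Qed.

Lemma mstarK X Y (f : mhom A X Y) : mstar (mstar f) = f.
Proof. by have [z1 z2 _] := homr_solution X Y; exact: star_byK. Qed.

(** In mcomp g f a pair ev Y is inserted in the middle; its adjoint is moved to the
    other side of the duality between the objects Z ⊗ dual X and X ⊗ dual Z by
    cancelling the two cups of Y with a conjugate equation. *)
Lemma transp_insert X Y Z :
  transp (homr Z X) (nest (homr Z Y) (homr Y X))
    (insert X (dual Z) (ev Y))^† (insert Z (dual X) (ev Y)).
Proof.
move=> Q; apply: pack_inj.
transitivity (pack (lw X (cup (ev Z) _ ∘ cup (ev Y) (dual X ⊗ Q)) ∘ cup (evb X) Q)).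
  by rewrite cup_nat; wdone.
transitivity (pack (lw X (cap (ev Y) _ ∘ lw (dual Y) (lw Y (cup (ev Z) _) ∘ cup (evb Y) _)
    ∘ cup (ev Y) (dual X ⊗ Q)) ∘ cup (evb X) Q)).
  have -> : cap (ev Y) _ ∘ lw (dual Y) (lw Y (cup (ev Z) _) ∘ cup (evb Y) _)
     = cup (ev Z) (dual Y ⊗ (Y ⊗ (dual X ⊗ Q))).
    by rewrite lwM compA cap_nat -compA evb_zig compm1.
  by [].
by rewrite /homr; wdone.
Qed.

Lemma mstar_comp X Y Z (g : mhom A Y Z) (f : mhom A X Y) :
  mstar (mcomp g f) = mcomp (mstar f) (mstar g).
Proof.
have [z1 z2 _] := homr_solution X Y; have [z3 z4 _] := homr_solution Y Z.
have [z5 z6 _] := homr_solution X Z.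
rewrite !mstarE /mcomp -(star_by_mul _ _ z1 z2 z3 z4).
exact: (star_by_amap _ z5 z6 (zig_nest z1 z3) (@transp_insert X Y Z)).
Qed.

(** This is why right composition has an adjoint. *)
Lemma inner0_mcomp Y Z (g h : mhom A Y Z) :
  inner0 g h = amap (evb Z) (mcomp g (mstar h)).
Proof. by rewrite (inner0E _ _ (homr_solution Y Z)) /mcomp -amap_comp. Qed.

Lemma mcomp_pre X X' Y Z (g : mhom A Y Z) (S : hom X X') (f : mhom A X' Y) :
  mcomp g (amap (S ⊠ idm (dual Y)) f) = amap (S ⊠ idm (dual Z)) (mcomp g f).
Proof.
rewrite /mcomp amul_natl -!amap_comp; congr amap; apply: pack_inj.
wnf; rewrite -[LHS]ptens_comp -1?[RHS]ptens_comp; try wends.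
by rewrite !(pcomp1, p1comp) ?pcomp1 ?p1comp //; wends.
Qed.

Lemma mcomp_post X Y Z Z' (t : hom (dual Z') (dual Z)) (g : mhom A Y Z)
    (f : mhom A X Y) (g' : mhom A Y Z') :
  g' = amap (idm Y ⊠ t) g -> mcomp g' f = amap (idm X ⊠ t) (mcomp g f).
Proof.
move=> ->; rewrite /mcomp amul_natr -!amap_comp; congr amap; apply: pack_inj.
wnf; rewrite -[X ⊗ dual Y ⊗ Y]tensA -ptens_id -ptensA -!pcompl; try wends.
rewrite -ptens_comp; try wends.
rewrite -[X in _ = ptens _ (pcomp _ X)]ptens1 -ptens_comp; try wends.
by rewrite ?pcomp1 ?p1comp //; wends.
Qed.

Lemma membedE X Y (S : hom X Y) : membed A S = amap (S ⊠ idm (dual Y)) (mid A Y).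
Proof. by rewrite /membed amap_comp. Qed.

Lemma mcomp_membed X Y Z (f : mhom A Y Z) (S : hom X Y) :
  mcomp f (membed A S) = amap (S ⊠ idm (dual Z)) f.
Proof. by rewrite membedE mcomp_pre mcompm1. Qed.

(** The adjoint form of the transposition, for evb. *)
Lemma transp_evb Y Z (T : hom Y Z) Tt : transp (ev Y) (ev Z) Tt T ->
  (evb Z)^† ∘ (T ⊠ idm (dual Z)) = (evb Y)^† ∘ (idm Y ⊠ Tt).
Proof.
move=> h; apply: dag_inj.
have /transpP := transp_adj (evb_zig Z) (ev_zig Y) h.
by rewrite !dagM !daggerK !dag_tens !dag1.
Qed.

Lemma membed_transp Y Z (T : hom Y Z) Tt : transp (ev Y) (ev Z) Tt T ->
  membed A T = amap (idm Y ⊠ Tt) (mid A Y).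
Proof.
by move=> h; rewrite /membed /mid -amap_comp (transp_evb h).
Qed.

Lemma membed_mcomp X Y Z (T : hom Y Z) Tt (f : mhom A X Y) :
  transp (ev Y) (ev Z) Tt T -> mcomp (membed A T) f = amap (idm X ⊠ Tt) f.
Proof. by move=> /membed_transp e; rewrite (mcomp_post f e) mcomp1m. Qed.

Lemma membed_comp X Y Z (T : hom Y Z) (S : hom X Y) :
  membed A (T ∘ S) = mcomp (membed A T) (membed A S).
Proof.
rewrite mcomp_membed membedE /membed -!amap_comp; congr amap.
by rewrite -[in RHS]compA -tensm_comp comp1m.
Qed.

Lemma membed1 X : membed A (idm X) = mid A X.
Proof. by rewrite membedE tensm1 amap1. Qed.

Lemma mcomp_eqm X Y Z (e : Y = Z) (f : mhom A X Y) :
  mcomp (membed A (eqm e)) f = amap (idm X ⊠ eqm (congr1 dual (esym e))) f.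
Proof.
case: Z / e; rewrite /= membed1 mcomp1m tensm1 amap1 //.
Qed.

Lemma star_one : star_by unit_sol (aone : A one) = aone.
Proof. by rewrite -star0E /star0 natural1. Qed.

Lemma mstar_membed X Y (T : hom X Y) : mstar (membed A T) = membed A T^†.
Proof.
have [z _ _] := @unit_solution R C; have [z1 z2 _] := homr_solution X Y.
rewrite mstarE (star_by_amap (Tv := (evb X)^† ∘ (T^† ⊠ idm (dual X))) _ z1 z2 z).
  by rewrite star_one.
have [s hs] := transp_exists (ev Y) T^† (ev_zig X).
have hs' := (sphericality _ _ (ev_solution Y) (ev_solution X)).1 hs.
move=> Q; apply: pack_inj.
transitivity (pack (lw X (lw (dual Y) (cap (evb X) Q) ∘ (lw (dual Y) (rw T^† (dual X ⊗ Q))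
   ∘ cup (ev Y) (dual X ⊗ Q))) ∘ cup (evb X) Q)).
  by rewrite /homr; wdone.
rewrite hs [lw (dual Y) _ ∘ _]compA -lw_rw -[rw s _ ∘ _ ∘ _]compA zigV ?compm1; last exact: evb_zig.
rewrite hs' dagM daggerK dag_tens dag1.
by wdone.
Qed.

Lemma transp_insertV X Y V :
  transp (nest (nest (ev Y) (ev V)) (nest (evb V) (evb X))) (homr Y X)
    (insert X (dual Y) (evb V)) (insert Y (dual X) (evb V))^†.
Proof.
move=> Q; apply: pack_inj.
transitivity (pack (lw X (lw V (lw (dual V) (lw (dual Y) (lw Y (cap (evb V) (dual X ⊗ Q)))
    ∘ cup (ev Y) _) ∘ cup (ev V) _) ∘ cup (evb V) _) ∘ cup (evb X) Q)).
  by wdone.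
have -> : lw (dual Y) (lw Y (cap (evb V) (dual X ⊗ Q))) ∘ cup (ev Y) _
   = cup (ev Y) _ ∘ cap (evb V) (dual X ⊗ Q) by rewrite cup_nat.
rewrite [lw (dual V) (_ ∘ cap _ _)]lwM -[lw _ _ ∘ lw _ (cap _ _) ∘ _]compA.
rewrite zigV ?compm1; last exact: evb_zig.
by rewrite -cup_nat; rewrite /homr; wdone.
Qed.

(** The involution of the right action is computed in two steps, through the
    duality of X ⊗ V with dual V ⊗ dual X. *)
Lemma mstar_mact X Y (f : mhom A X Y) V : mstar (mact f V) = mact (mstar f) V.
Proof.
have [z1 z2 _] := homr_solution (X ⊗ V) (Y ⊗ V); have [z3 z4 _] := homr_solution X Y.
rewrite !mstarE /mact; apply: (star_by_amap _ z1 z2 z3).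
rewrite dagM daggerK dag_tens dag1 daggerK.
have hX := solution_nest (ev_solution X) (ev_solution V).
have hY := solution_nest (ev_solution Y) (ev_solution V).
apply: transp_comp (transp_insertV X Y V); apply: transp_nest.
  exact: transp_zigzag_l hY (ev_solution _).
have := transp_adj (sol_r hX) (ev_zig _) (transp_zigzag_l hX (ev_solution (X ⊗ V))).
by rewrite dag1.
Qed.

(** The isomorphism between two duals, being unitary, intertwines the caps. *)
Lemma zigzag_coev D W E (r : hom one (D ⊗ W)) (rb : hom one (W ⊗ D))
    (s : hom one (E ⊗ W)) (sb : hom one (W ⊗ E)) :
  solution r rb -> solution s sb ->
  sb^† ∘ (idm W ⊠ zigzag (@dag _ C) r sb) = rb^†.
Proof.
move=> hr hs; have := transp_zigzag sb (sol_l hr); have := zigzag_isometry hr hs.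
move: (zigzag _ _ _) => t tt /transpP; rewrite tensm1 comp1m => <-.
by rewrite dagM dag_tens dag1 -compA -tensm_comp tt comp1m tensm1 compm1.
Qed.

Lemma transp_eqm Y Z (e : Y = Z) :
  transp (ev Y) (ev Z) (eqm (congr1 dual (esym e))) (eqm e).
Proof. by case: Z / e; exact: transp_id. Qed.

Lemma transp_dual_tens Y U :
  transp (nest (ev Y) (ev U)) (ev (Y ⊗ U)) (dual_tens Y U)^† (idm (Y ⊗ U)).
Proof.
have h := solution_nest (ev_solution Y) (ev_solution U).
exact: transp_zigzag_adj (sol_l h) (sol_r h) (ev_zig _).
Qed.

(** Both sides apply a morphism of C to f. The identity between these morphisms
    follows from the naturality e of the identification of the dual of a tensor
    product, checked on transposes. *)
Lemma mact_nat X Y (f : mhom A X Y) U V (T : hom U V) :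
  mcomp (membed A (idm Y ⊠ T)) (mact f U) = mcomp (mact f V) (membed A (idm X ⊠ T)).
Proof.
have [Tt hTt] := transp_exists (ev (Y ⊗ U)) (idm Y ⊠ T) (ev_zig (Y ⊗ V)).
have [t ht] := transp_exists (ev U) T (ev_zig V).
rewrite (membed_mcomp _ hTt) mcomp_membed /mact -!amap_comp; congr amap.
have e : (dual_tens Y U)^† ∘ Tt = (t ⊠ idm (dual Y)) ∘ (dual_tens Y V)^†.
  apply: (transp_finj (evb_zig (Y ⊗ V))).
    exact: transp_comp (transp_dual_tens Y U) hTt.
  have := transp_comp (transp_nest (transp_id (ev Y)) ht) (transp_dual_tens Y V).
  by rewrite comp1m compm1.
have e2 : (insert X (dual Y) (evb U))^† ∘ (idm (X ⊗ U) ⊠ (t ⊠ idm (dual Y)))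
    = (insert X (dual Y) (evb V))^† ∘ ((idm X ⊠ T) ⊠ idm (dual V ⊗ dual Y)).
  apply: pack_inj.
  transitivity (ptens (pid X) (ptens (pack ((evb U)^† ∘ (idm U ⊠ t))) (pid (dual Y)))).
    by wdone.
  by rewrite -(transp_evb ht); wdone.
rewrite -[LHS]compA -tensm_comp e -[RHS]compA -tensm_comp !comp1m compm1.
rewrite -{1}[idm (X ⊗ U)]comp1m tensm_comp compA e2 -compA -tensm_comp.
by rewrite ?comp1m ?compm1.
Qed.

Lemma insert_coev X Z D W E (r : hom one (D ⊗ W)) (rb : hom one (W ⊗ D))
    (s : hom one (E ⊗ W)) (sb : hom one (W ⊗ E)) :
  solution r rb -> solution s sb ->
  (insert X Z sb)^† ∘ (idm (X ⊗ W) ⊠ (zigzag (@dag _ C) r sb ⊠ idm Z))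
  = (insert X Z rb)^†.
Proof.
move=> hr hs; apply: pack_inj; rewrite [RHS]pack_insertV -(zigzag_coev hr hs).
by wdone.
Qed.

Lemma transp_asc U V W D E F (r : hom one (D ⊗ U)) (s : hom one (E ⊗ V))
    (q : hom one (F ⊗ W)) :
  transp (nest r (nest s q)) (nest (nest r s) q) (asc F E D) (eqm (tensA U V W)).
Proof. by apply/transpP; apply: pack_inj; wdone. Qed.

Lemma transp_nest_unit Y D (r : hom one (D ⊗ Y)) :
  transp (nest r unit_sol) r (eqm (esym (tens1o D))) (eqm (tenso1 Y)).
Proof. by apply/transpP; apply: pack_inj; wdone. Qed.

(** The identity e, checked on transposes, is the coherence of the identifications
    of the dual of Y ⊗ U ⊗ V for the two bracketings. *)
Lemma mact_tens X Y (f : mhom A X Y) U V :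
  mcomp (membed A (eqm (tensA Y U V))) (mact f (U ⊗ V))
  = mcomp (mact (mact f U) V) (membed A (eqm (tensA X U V))).
Proof.
rewrite mcomp_eqm mcomp_membed /mact -!amap_comp; congr amap.
have e : (dual_tens Y (U ⊗ V))^† ∘ eqm (congr1 dual (esym (tensA Y U V)))
  = (dual_tens U V ⊠ idm (dual Y)) ∘ (asc (dual V) (dual U) (dual Y)
    ∘ ((idm (dual V) ⊠ (dual_tens Y U)^†) ∘ (dual_tens (Y ⊗ U) V)^†)).
  apply: (transp_finj (evb_zig (Y ⊗ U ⊗ V))).
    have := transp_comp (transp_dual_tens Y (U ⊗ V)) (transp_eqm (tensA Y U V)).
    by rewrite compm1 => h; exact: h.
  have h1 := transp_nest (transp_id (ev Y))
    (transp_zigzag_l (solution_nest (ev_solution U) (ev_solution V)) (ev_solution (U ⊗ V))).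
  have h2 := transp_nest (transp_dual_tens Y U) (transp_id (ev V)).
  have h3 := transp_comp h2 (transp_dual_tens (Y ⊗ U) V).
  have h4 := transp_comp h1 (transp_comp (transp_asc (ev Y) (ev U) (ev V)) h3).
  move: h4; rewrite !tensm1 !(compm1, comp1m) => h; exact: h.
rewrite -[LHS]compA -tensm_comp comp1m e -{1}[idm (X ⊗ (U ⊗ V))]comp1m tensm_comp compA.
rewrite (insert_coev _ _ (solution_nest (ev_solution U) (ev_solution V)) (ev_solution _)).
  apply: pack_inj.
  transitivity (pack (lw X (cap (evb U) _ ∘ lw U ((dual_tens Y U)^† ∘ cap (evb V) _))
    ∘ lw X (lw U (lw V (dual_tens (Y ⊗ U) V)^†)))).
    by rewrite -cap_nat; wdone.
  by wdone.
Qed.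

(** As for products: here the dual of the unit is identified with the unit. *)
Lemma mact_one X Y (f : mhom A X Y) :
  mcomp (membed A (eqm (tenso1 Y))) (mact f one) = mcomp f (membed A (eqm (tenso1 X))).
Proof.
rewrite mcomp_eqm mcomp_membed /mact -!amap_comp; congr amap.
pose t := zigzag (@dag _ C) (unit_sol : hom one _) (evb one).
have e : (dual_tens Y one)^† ∘ eqm (congr1 dual (esym (tenso1 Y)))
  = (t ⊠ idm (dual Y)) ∘ eqm (esym (tens1o (dual Y))).
  apply: (transp_finj (evb_zig Y)).
    have := transp_comp (transp_dual_tens Y one) (transp_eqm (tenso1 Y)).
    by rewrite compm1 => h; exact: h.
  have h1 := transp_nest (transp_id (ev Y))
    (transp_zigzag_l (@unit_solution R C) (ev_solution one)).
  have h2 := transp_comp h1 (transp_nest_unit (ev Y)).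
  move: h2; rewrite !tensm1 !(compm1, comp1m) => h; exact: h.
rewrite -[LHS]compA -tensm_comp comp1m e -{1}[idm (X ⊗ one)]comp1m tensm_comp compA.
rewrite (insert_coev _ _ unit_solution (ev_solution _)).
by apply: pack_inj; wdone.
Qed.

Definition mdag : dagger (free_modules A) := fun X Y => @mstar R C A X Y.

Lemma mdag_dagger : is_dagger mdag.
Proof. split; [exact: mstar_antilin|exact: mstarK|exact: mstar_comp]. Qed.

End ModuleStar.
Arguments mdag {R C} A [X Y] f.
(** * The C*-category of free modules *)
Section PowerTrick.
Variable R : realType.

Lemma bernoulli (d : R) n : 0 <= d -> 1 + n%:R * d <= (1 + d) ^+ n.
Proof.
move=> d0; elim: n => [|n IH]; first by rewrite mul0r addr0 expr0.
rewrite exprS; apply: le_trans (ler_wpM2l _ IH); last by rewrite addr_ge0.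
rewrite -natr1; have : 0 <= n%:R * (d * d) by rewrite mulr_ge0 ?mulr_ge0.
nra.
Qed.

(** If b < a then (a / b)^(2^n) grows without bound, by Bernoulli's inequality. *)
Lemma power_trick (a b c : R) : 0 <= a -> 0 <= b ->
  (forall n, a ^+ (2 ^ n) <= c * b ^+ (2 ^ n)) -> a <= b.
Proof.
move=> a0 b0 h; rewrite leNgt; apply/negP => ba.
have [b00|bn0] := eqVneq b 0.
  by have := h 0%N; rewrite b00 expn0 !expr1 mulr0 leNgt (le_lt_trans b0 ba).
have bp : 0 < b by rewrite lt_def bn0.
pose d := a / b - 1; have d0 : 0 < d by rewrite subr_gt0 ltr_pdivlMr // mul1r.
have hd n : n%:R * d <= c.
  have := h n; rewrite -ler_pdivrMr ?exprn_gt0 // -expr_div_n.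
  have -> : a / b = 1 + d by rewrite /d addrC subrK.
  move=> hn; apply: le_trans (le_trans (bernoulli _ (ltW d0)) hn).
  by rewrite ler_wpDl // ler_wpM2r ?(ltW d0) // ler_nat ltnW // ltn_expl.
have c0 : 0 <= c by have := hd 0%N; rewrite mul0r.
have := hd (Num.bound (c / d)); apply/negP; rewrite -ltNge.
have := archi_boundP (divr_ge0 c0 (ltW d0)).
by rewrite ltr_pdivrMr.
Qed.

End PowerTrick.

Section FreeCstar.
Variables (R : realType) (C : rigid_Cstar_tensor_category R).
Variable A : pre_Cstar_algebra_object C.
Implicit Types X Y Z U V W : C.
Local Notation fn := (@fiber_norm R C A _).
Local Notation M X Y := (mhom A X Y).

(** Both sides are A(evb Z) (g f h^†). Right composition with f is thus
    an adjointable operator between Hilbert modules over A_0. *)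
Lemma inner0_mcomp_adj X Y Z (g : M Y Z) (f : M X Y) (h : M X Z) :
  inner0 (mcomp g f) h = inner0 g (mcomp h (mstar f)).
Proof. by rewrite !inner0_mcomp mstar_comp mstarK mcompA. Qed.

Lemma mcomp_bound X Y Z : exists2 K, 0 <= K &
  forall (g : M Y Z) (f : M X Y), fn (mcomp g f) <= K * (fn g * fn f).
Proof.
have [K K0 hK] := amap_bound A (insert X (dual Z) (ev Y)); exists K => // g f.
by apply: le_trans (hK _) _; rewrite ler_wpM2l // amul_bound.
Qed.

(** The norm of right composition with f, as an operator between the Hilbert modules
    of morphisms into Z. *)
Definition rnorm Z X Y (f : M X Y) : R :=
  opnorm (fun g : M Y Z => fn g) (fun h : M X Z => fn h) (fun g => mcomp g f).

Lemma rnorm_ge0 Z X Y (f : M X Y) : 0 <= rnorm Z f. Proof. exact: opnorm_ge0. Qed.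

Lemma rnorm_bound Z X Y (f : M X Y) (g : M Y Z) : fn (mcomp g f) <= rnorm Z f * fn g.
Proof.
have [K K0 hK] := mcomp_bound X Y Z.
apply: (opnorm_bound _ g (M := K * fn f)) => [v||v]; first exact: fn_ge0.
  by rewrite mulr_ge0 ?fn_ge0.
by rewrite -mulrA [fn f * _]mulrC.
Qed.

Lemma rnorm_le Z X Y (f : M X Y) k : 0 <= k ->
  (forall g : M Y Z, fn (mcomp g f) <= k * fn g) -> rnorm Z f <= k.
Proof. by move=> k0 h; exact: opnorm_le. Qed.

Lemma rnorm_fiber Z X Y : exists2 K, 0 <= K & forall f : M X Y, rnorm Z f <= K * fn f.
Proof.
have [K K0 hK] := mcomp_bound X Y Z; exists K => // f.
apply: rnorm_le => [|g]; first by rewrite mulr_ge0 ?fn_ge0.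
by rewrite -mulrA [fn f * _]mulrC.
Qed.

Lemma rnorm_comp Z X Y W (g : M Y W) (f : M X Y) :
  rnorm Z (mcomp g f) <= rnorm Z g * rnorm Z f.
Proof.
apply: rnorm_le => [|h]; first by rewrite mulr_ge0 ?rnorm_ge0.
rewrite mcompA (le_trans (rnorm_bound _ _)) // mulrC -mulrA mulrCA.
by rewrite [X in X <= _]mulrC ler_wpM2l ?rnorm_ge0 // rnorm_bound.
Qed.

(** By Cauchy-Schwarz, |g f|^2 is at most |g f f^†| |g|. *)
Lemma rnorm_sqr_le Z X Y (f : M X Y) : rnorm Z f ^+ 2 <= rnorm Z (mcomp f (mstar f)).
Proof.
set s := rnorm Z (mcomp _ _); have s0 : 0 <= s := rnorm_ge0 _ _.
rewrite -[s]sqr_sqrtr // ler_pXn2r ?nnegrE ?rnorm_ge0 ?sqrtr_ge0 //.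
apply: rnorm_le => [|g]; first exact: sqrtr_ge0.
rewrite -(ler_pXn2r (_ : 0 < 2)%N) ?nnegrE ?mulr_ge0 ?fn_ge0 ?sqrtr_ge0 //.
rewrite exprMn [Num.sqrt s ^+ 2]sqr_sqrtr // fn_sqr -ip_st nr_st.
rewrite {1}/ip inner0_mcomp_adj -mcompA (le_trans (cauchy_schwarz _ _)) //.
by rewrite mulrC expr2 mulrA ler_wpM2r ?fn_ge0 // rnorm_bound.
Qed.

Lemma rnorm_star Z X Y (f : M X Y) : rnorm Z (mstar f) = rnorm Z f.
Proof.
have key X' Y' (h : M X' Y') : rnorm Z h <= rnorm Z (mstar h).
  have [->|n0] := eqVneq (rnorm Z h) 0; first exact: rnorm_ge0.
  have p0 : 0 < rnorm Z h by rewrite lt_def n0 rnorm_ge0.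
  rewrite -(ler_pM2l p0) -expr2; apply: le_trans (rnorm_sqr_le _ _) _.
  exact: rnorm_comp.
by apply/eqP; rewrite eq_le key -{2}[f]mstarK key.
Qed.

Lemma rnorm_Cstar Z X Y (f : M X Y) : rnorm Z (mcomp (mstar f) f) = rnorm Z f ^+ 2.
Proof.
apply/eqP; rewrite eq_le; apply/andP; split.
  by rewrite expr2 -{1}(rnorm_star Z f) rnorm_comp.
by rewrite -(rnorm_star Z f) -{3}[f]mstarK rnorm_sqr_le.
Qed.

Lemma fiber_rnorm X Y (f : M X Y) : fn f <= fn (mid A Y) * rnorm Y f.
Proof. by rewrite -{1}[f]mcomp1m mulrC rnorm_bound. Qed.

(** By the C*-identity rnorm Z x ^+ (2 ^ n) is the norm of x ^ (2^n). Up to constants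
    the fiber norm dominates rnorm Z and is dominated by rnorm X, and the constants
    disappear after taking roots. *)
Lemma rnorm_sa_le Z X (x : M X X) : mstar x = x -> rnorm Z x <= rnorm X x.
Proof.
move=> sx.
pose y := fix y n : M X X := if n is n'.+1 then mcomp (y n') (y n') else x.
have sy n : mstar (y n) = y n.
  by elim: n => [|n IH] //=; rewrite mstar_comp IH.
have hy W n : rnorm W (y n) = rnorm W x ^+ (2 ^ n).
  elim: n => [|n IH]; first by rewrite expn0 expr1.
  by rewrite /= -{1}(sy n) rnorm_Cstar IH -exprM -expnSr.
have [K K0 hK] := rnorm_fiber Z X X.
apply: (@power_trick _ _ _ (K * fn (mid A X))); rewrite ?rnorm_ge0 // => n.
rewrite -!hy (le_trans (hK _)) // -mulrA ler_wpM2l //; exact: fiber_rnorm.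
Qed.

Lemma rnorm_src Z X Y (f : M X Y) : rnorm Z f <= rnorm X f.
Proof.
rewrite -(ler_pXn2r (_ : 0 < 2)%N) ?nnegrE ?rnorm_ge0 // -!rnorm_Cstar.
by apply: rnorm_sa_le; rewrite mstar_comp mstarK.
Qed.

(** Among the norms rnorm Z of f, the one with Z the source of f is the largest
    (rnorm_src) and is comparable to the fiber norm. *)
Definition mnorm (X Y : free_modules A) (f : hom X Y) : R := rnorm X (f : M X Y).

Hypothesis hc : forall U, is_complete_norm (@fiber_norm R C A U).

(** On each space of morphisms mnorm is equivalent to the fiber norm. *)
Lemma mnorm_complete (X Y : free_modules A) : is_complete_norm (@mnorm X Y).
Proof.
have [K K0 hK] := rnorm_fiber X X Y.
have le_fn (f : M X Y) : fn f <= fn (mid A Y) * mnorm f.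
  apply: le_trans (fiber_rnorm f) _; rewrite ler_wpM2l ?fn_ge0 //.
  exact: rnorm_src.
apply: complete_norm_intro.
- move=> f g; apply: rnorm_le => [|h]; first by rewrite addr_ge0 ?rnorm_ge0.
  have := mcomp_linr 1 h (f : M X Y) g; rewrite !scale1r => ->.
  by rewrite mulrDl (le_trans (fnD _ _)) // lerD ?rnorm_bound.
- have key k (f : M X Y) : mnorm (k *: f) <= complex.Re `|k| * mnorm f.
    apply: rnorm_le => [|h]; first by rewrite mulr_ge0 ?Re_norm_ge0 ?rnorm_ge0.
    have -> : mcomp h (k *: f) = k *: mcomp h f.
      exact: (@compZr R (free_modules A)).
    by rewrite fnZ -mulrA ler_wpM2l ?Re_norm_ge0 ?rnorm_bound.
  move=> k f; apply/eqP; rewrite eq_le key andTb.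
  have [->|k0] := eqVneq k 0; first by rewrite normr0 mul0r rnorm_ge0.
  rewrite -{1}[f](scalerK k0).
  apply: le_trans (ler_wpM2l (Re_norm_ge0 k) (key _ _)) _.
  by rewrite mulrA -Re_normM mulfV // normr1 mul1r.
- move=> f f0; apply: (nrm_eq0 (hc _)); apply/eqP; rewrite eq_le fn_ge0 andbT.
  by rewrite (le_trans (le_fn f)) // f0 mulr0.
- move=> u hu.
  have cu : cauchy (@fiber_norm R C A (X ⊗ dual Y)) u.
    move=> e e0; pose c := fn (mid A Y) + 1.
    have c0 : 0 < c by rewrite ltr_wpDl ?fn_ge0.
    have [N hN] := hu (e / c) (divr_gt0 e0 c0); exists N => m n hm hn.
    apply: le_lt_trans (le_fn _) _; apply: (@le_lt_trans _ _ (c * mnorm (u m - u n))).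
      by rewrite ler_wpM2r ?rnorm_ge0 // lerDl.
    by rewrite mulrC -ltr_pdivlMr // hN.
  have [v hv] := complete_tends (hc _) cu; exists v => e e0.
  have K1 : 0 < K + 1 by rewrite ltr_wpDl.
  have [N hN] := hv (e / (K + 1)) (divr_gt0 e0 K1); exists N => n hn.
  apply: le_lt_trans (hK _) _; apply: (@le_lt_trans _ _ ((K + 1) * fn (u n - v))).
    by rewrite ler_wpM2r ?fn_ge0 // lerDl.
  by rewrite mulrC -ltr_pdivlMr // hN.
Qed.

Lemma mnorm_comp (X Y Z : free_modules A) (g : hom Y Z) (f : hom X Y) :
  mnorm (g ∘ f) <= mnorm g * mnorm f.
Proof.
apply: le_trans (rnorm_comp _ _ _) _.
by rewrite ler_wpM2r ?rnorm_ge0 //; exact: rnorm_src.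
Qed.

Lemma mnorm_Cstar (X Y : free_modules A) (f : hom X Y) :
  mnorm (mdag A f ∘ f) = mnorm f ^+ 2.
Proof. exact: rnorm_Cstar. Qed.

(** Let h = f^† f, let t be its norm and let t - h = y^2. For every a the element
    <a h, a> = <a f^†, a f^†> is positive, so that t <a, a> - <a y, a y> is, and
    right composition with y has norm at most the square root of t. Hence t - h has
    norm at most t, which means that h is positive. *)
Lemma mdag_positive (X Y : free_modules A) (f : hom X Y) :
  exists g : hom X X, mdag A f ∘ f = mdag A g ∘ g.
Proof.
pose E := end_cstar (mdag_dagger A) mnorm_complete mnorm_comp mnorm_Cstar X.
pose h : celt E := mdag A f ∘ f; pose t := nr h.
have sh : st h = h.
  by rewrite [st h](dag_comp (mdag_dagger A)) (dagK (mdag_dagger A)).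
have t0 : 0 <= t := nr_ge0 _.
have ph : Pos (sr E t - h).
  split; first by rewrite stB st_sr sh.
  by exists t; rewrite // opprB addrCA subrr addr0.
have [y [[sy _] yy _]] := pos_sqrt ph.
have ny : nr y <= Num.sqrt t.
  apply: rnorm_le => [|a]; first exact: sqrtr_ge0.
  rewrite -(ler_pXn2r (_ : 0 < 2)%N) ?nnegrE ?mulr_ge0 ?fn_ge0 ?sqrtr_ge0 //.
  rewrite exprMn [Num.sqrt t ^+ 2]sqr_sqrtr //; apply: fn_ip_le => //.
  have -> : sc t%:C (ip a a) - ip (mcomp a (y : M X X)) (mcomp a (y : M X X))
      = ip (mcomp a (mstar f)) (mcomp a (mstar f)).
    rewrite /ip !inner0_mcomp_adj -!mcompA mstarK.
    change (mstar (y : M X X) = y) in sy.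
    change (mcomp (y : M X X) y = t%:C *: mid A X - mcomp (mstar f) f) in yy.
    rewrite sy yy.
    have -> : mcomp a (t%:C *: mid A X - mcomp (mstar f) f)
        = t%:C *: a - mcomp a (mcomp (mstar f) f).
      have := @compBr R (free_modules A) X X X a (t%:C *: mid A X) (mcomp (mstar f) f).
      have := @compZr R (free_modules A) X X X t%:C a (mid A X).
      by move=> /= -> /= ->; rewrite mcompm1.
    rewrite inner0Dr inner0Zr inner0Nr conj_Creal ?complex_real //.
    by rewrite [sc _ _]/(_ *: _) opprD opprK addrA subrr add0r.
  exact: ip_pos.
have ph' : Pos h.
  split=> //; exists t => //; rewrite -yy (le_trans (nrM _ _)) //.
  by rewrite -[t in leRHS]sqr_sqrtr // expr2 ler_pM ?nr_ge0.
have [g [[sg _] gg _]] := pos_sqrt ph'.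
exists g; rewrite -[LHS]gg.
by change (g * g = st g * g); rewrite sg.
Qed.

Lemma free_Cstar : is_Cstar_category (mdag A) mnorm.
Proof.
split; [exact: (mdag_dagger A)|exact: mnorm_complete|exact: mnorm_comp|exact: mnorm_Cstar|].
exact: mdag_positive.
Qed.

End FreeCstar.

(** * The idempotent completion of a C*-category *)
Section KaroubiCstar.
Variables (R : realType) (D : lincat R) (dg : dagger D).
Variable nm : forall X Y : D, hom X Y -> R.
Hypothesis hD : is_Cstar_category dg nm.
Local Notation K := (idempotent_completion D).
Implicit Types E F G : K.

Let hdg := Cstar_dagger hD.
Let hn := Cstar_norm hD.
Let hsub := Cstar_submul hD.

Let EC X := end_cstar hdg hn hsub (Cstar_identity hD) X.

(** p is the orthogonal projection with the same range as the idempotent. *)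
Definition is_proj E (p : hom (kob E) (kob E)) : Prop :=
  [/\ dg p = p, p ∘ kidem E = kidem E & kidem E ∘ p = p].

Arguments is_proj : clear implicits.

Lemma proj_exists E : exists p, is_proj E p.
Proof. exact: (@range_proj _ (EC (kob E)) (kidem E) (kidemP E)). Qed.

Definition kproj E := sval (cid (proj_exists E)).

Lemma kprojP E : is_proj E (kproj E). Proof. exact: svalP (cid (proj_exists E)). Qed.

Lemma kproj_unique E p : is_proj E p -> kproj E = p.
Proof.
move=> [h1 h2 h3]; have [k1 k2 k3] := kprojP E.
exact: (@range_proj_unique _ (EC (kob E)) _ _ _ k1 k2 k3 h1 h2 h3).
Qed.

Lemma kproj_sa E : dg (kproj E) = kproj E. Proof. by have [] := kprojP E. Qed.
Lemma kproj_idem E : kproj E ∘ kidem E = kidem E. Proof. by have [] := kprojP E. Qed.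
Lemma idem_kproj E : kidem E ∘ kproj E = kproj E. Proof. by have [] := kprojP E. Qed.
Lemma kproj_kproj E : kproj E ∘ kproj E = kproj E.
Proof. by rewrite -{2}idem_kproj compA kproj_idem idem_kproj. Qed.
Lemma kproj_dgidem E : kproj E ∘ dg (kidem E) = kproj E.
Proof. by rewrite -{1}kproj_sa -(dag_comp hdg) idem_kproj kproj_sa. Qed.

Lemma kproj_of_sa E : dg (kidem E) = kidem E -> kproj E = kidem E.
Proof. by move=> h; apply: kproj_unique; split; rewrite ?kidemP. Qed.

Lemma kproj_l E F (h : kar_hom E F) : kproj F ∘ h = h.
Proof. by rewrite -{1}[kmor h]kar_homl compA kproj_idem kar_homl. Qed.
Lemma dg_kproj_r E F (h : kar_hom E F) : dg h ∘ kproj F = dg h.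
Proof. by rewrite -{1}kproj_sa -(dag_comp hdg) kproj_l. Qed.

(** An idempotent e is isomorphic to its range projection p, by means of e and p.
    Under this isomorphism, the adjoint of h : e -> f is p h^† f. *)
Lemma kdag_subproof E F (h : kar_hom E F) :
  kproj E ∘ dg h ∘ kidem F \in @kar_pred R D F E.
Proof. by rewrite inE !compA idem_kproj -!compA kidemP. Qed.
Definition kdag : dagger K := fun E F h => KarHom (@kdag_subproof E F h).

Lemma kdagE E F (h : hom E F) : kmor (kdag h) = kproj E ∘ dg (kmor h) ∘ kidem F.
Proof. by []. Qed.

Lemma kdag_dagger : is_dagger kdag.
Proof.
split.
- move=> E F k f g; apply: val_inj.
  rewrite /= (dag_antilin hdg) comp_linr comp_linl //.
- move=> E F h; apply: val_inj; rewrite /= !(dag_comp hdg) (dagK hdg) kproj_sa.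
  rewrite !compA kproj_dgidem -[_ ∘ kproj E ∘ _]compA kproj_idem.
  by rewrite kproj_l kar_homr.
- move=> E F G g h; apply: val_inj; rewrite /= (dag_comp hdg) !compA.
  by rewrite -[_ ∘ kidem F ∘ _]compA idem_kproj -[_ ∘ dg h ∘ kproj F]compA dg_kproj_r.
Qed.

Lemma kdag_sa E F (h : hom E F) : dg (kidem E) = kidem E -> dg (kidem F) = kidem F ->
  kmor (kdag h) = dg (kmor h).
Proof.
move=> sE sF; rewrite kdagE kproj_of_sa // -{1}sE -sF -!(dag_comp hdg).
by rewrite kar_homr kar_homl.
Qed.

Definition knorm E F (h : hom E F) : R := nm (kmor h ∘ kproj E).

Lemma knorm_complete E F : is_complete_norm (@knorm E F).
Proof.
apply: complete_norm_intro.
- by move=> f g; rewrite /knorm /= compDl; exact: nrm_triangle (hn _ _) _ _.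
- by move=> k f; rewrite /knorm /= compZl; exact: nrm_scale (hn _ _) _ _.
- move=> f f0; have h := nrm_eq0 (hn _ _) f0.
  by apply: val_inj; rewrite /= -[LHS]kar_homr -(kproj_idem E) compA h comp0m.
- move=> u hu; have cu : cauchy (@nm _ _) (fun n => kmor (u n) ∘ kproj E).
    move=> e e0; have [N hN] := hu e e0; exists N => m n hm hn'.
    by have := hN m n hm hn'; rewrite /knorm /= compBl.
  have [x hx] := complete_tends (hn _ _) cu.
  exists (@cut R D E F x) => e e0.
  pose c := nm (kidem F) * nm (kproj E) + 1.
  have c0 : 0 < c by rewrite ltr_wpDl // mulr_ge0 ?(cn_ge0 (hn _ _)).
  have [N hN] := hx (e / c) (divr_gt0 e0 c0); exists N => n hn'.
  have e1 : kmor (u n - @cut R D E F x) ∘ kproj E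
      = kidem F ∘ (kmor (u n) ∘ kproj E - x) ∘ kproj E.
    rewrite /= compBr !compBl !compA kar_homl -[_ ∘ kproj E ∘ kproj E]compA kproj_kproj.
    by rewrite -[_ ∘ kidem E ∘ _]compA idem_kproj.
  rewrite /knorm e1; apply: le_lt_trans (hsub _ _) _.
  apply: le_lt_trans (ler_wpM2r (cn_ge0 (hn _ _) _) (hsub _ _)) _.
  rewrite mulrAC; apply: le_lt_trans (_ : _ <= c * nm (kmor (u n) ∘ kproj E - x)) _.
    by rewrite ler_wpM2r ?(cn_ge0 (hn _ _)) // lerDl.
  by rewrite mulrC -ltr_pdivlMr // hN.
Qed.

Lemma kdag_comp_proj E F (h : hom E F) :
  kmor (kdag h ∘ h) ∘ kproj E = dg (kmor h ∘ kproj E) ∘ (kmor h ∘ kproj E).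
Proof.
by rewrite /= -[_ ∘ kidem F ∘ _]compA kar_homl (dag_comp hdg) kproj_sa !compA.
Qed.

(** The positive square root y of (h p)^† (h p) commutes with p, and g = p y e is an
    endomorphism of e. *)
Lemma karoubi_positive E F (h : hom E F) :
  exists g : hom E E, kdag h ∘ h = kdag g ∘ g.
Proof.
have [g0 hg] := Cstar_positive hD (kmor h ∘ kproj E).
pose a : celt (EC (kob E)) := dg (kmor h ∘ kproj E) ∘ (kmor h ∘ kproj E).
have [y [[sy _] yy yc]] : exists y : celt (EC (kob E)), [/\ Pos y, y * y = a &
    forall x, x * a = a * x -> x * y = y * x].
  by apply: pos_sqrt; rewrite /a hg; exact: (@stM_pos _ (EC (kob E)) g0).
have pa : kproj E ∘ (a : hom _ _) = a.
  by rewrite /a (dag_comp hdg) kproj_sa !compA kproj_kproj.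
have ap : (a : hom _ _) ∘ kproj E = a by rewrite /a -!compA kproj_kproj.
have py : kproj E ∘ (y : hom _ _) = (y : hom _ _) ∘ kproj E.
  by apply: yc; rewrite [LHS]pa [RHS]ap.
change (dg (y : hom (kob E) (kob E)) = y) in sy.
change ((y : hom (kob E) (kob E)) ∘ y = a) in yy.
pose g : hom E E := @cut R D E E (kproj E ∘ (y : hom _ _)).
exists g; apply: val_inj.
have eg : kmor g = kproj E ∘ (y : hom _ _) ∘ kidem E.
  by rewrite /= compA idem_kproj.
have e1 : kmor (kdag g) = kproj E ∘ (y : hom _ _) ∘ kidem E.
  rewrite kdagE eg !(dag_comp hdg) sy kproj_sa !compA kproj_dgidem.
  by rewrite -[_ ∘ kproj E ∘ kidem E]compA kproj_idem.
transitivity ((a : hom _ _) ∘ kidem E).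
  rewrite -[LHS]kar_homr -(kproj_idem E) compA [X in X ∘ _](@kdag_comp_proj E F h).
  by rewrite kproj_idem.
have -> : \val (kdag g ∘ g) = kmor (kdag g) ∘ kmor g by [].
rewrite e1 eg !compA -[_ ∘ kidem E ∘ kproj E]compA.
rewrite idem_kproj -[_ ∘ (y : hom _ _) ∘ kproj E]compA -py compA kproj_kproj.
by rewrite -[_ ∘ (y : hom _ _) ∘ (y : hom _ _)]compA yy pa.
Qed.

Lemma karoubi_Cstar : is_Cstar_category kdag knorm.
Proof.
split; [exact: kdag_dagger|exact: knorm_complete| | |exact: karoubi_positive].
- move=> E F G g h; rewrite /knorm /=.
  by rewrite -{1}(kproj_l h) compA -compA; exact: hsub.
- by move=> E F h; rewrite /knorm kdag_comp_proj (Cstar_identity hD).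
Qed.

(** A unitary that intertwines two idempotents intertwines their adjoints as well. *)
Lemma cut_unitary E F (a : hom (kob E) (kob F)) :
  is_unitary dg a -> a ∘ kidem E = kidem F ∘ a -> is_unitary kdag (@cut R D E F a).
Proof.
move=> [aV Va] ae.
have ea : dg a ∘ kidem F = kidem E ∘ dg a.
  by rewrite -[LHS]compm1 -Va compA -[_ ∘ kidem F ∘ a]compA -ae compA aV comp1m.
have e1 : kmor (@cut R D E F a) = a ∘ kidem E by rewrite /= -ae -compA kidemP.
have e2 : kmor (kdag (@cut R D E F a)) = kidem E ∘ dg a.
  rewrite kdagE e1 (dag_comp hdg) compA kproj_dgidem -compA ea compA.
  by rewrite kproj_idem.
split; apply: val_inj.
  transitivity (kmor (kdag (@cut R D E F a)) ∘ kmor (@cut R D E F a)) => //.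
  by rewrite e1 e2 compA -[_ ∘ dg a ∘ a]compA aV compm1 kidemP.
transitivity (kmor (@cut R D E F a) ∘ kmor (kdag (@cut R D E F a))) => //.
by rewrite e1 e2 compA -[_ ∘ kidem E ∘ kidem E]compA kidemP ae -compA Va compm1.
Qed.

End KaroubiCstar.

(** * The module category of a C*-algebra object *)
Section ModuleDagger.
Variables (R : realType) (C : rigid_Cstar_tensor_category R).
Variable A : star_algebra_object C.
Local Notation D := (free_modules A).
Variable nm : forall X Y : D, hom X Y -> R.
Hypothesis hA : is_Cstar_category (mdag A) nm.
Implicit Types (E F : module_category A) (U V : C).

Local Notation dg := (kdag hA).

(** The range projection is unique, and the action preserves its defining identities. *)
Lemma kproj_act E V : kproj hA (kact_ob E V) = mact (kproj hA E) V.
Proof.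
apply: kproj_unique; split.
- by rewrite [LHS]mstar_mact; exact: (congr1 (fun f => mact f V) (kproj_sa hA E)).
- by rewrite [LHS]mact_comp; exact: (congr1 (fun f => mact f V) (kproj_idem hA E)).
- by rewrite [LHS]mact_comp; exact: (congr1 (fun f => mact f V) (idem_kproj hA E)).
Qed.

Lemma kactE E F (f : hom E F) U V (T : hom U V) :
  kmor (kact f T) = mcomp (membed A (idm (kob F : C) ⊠ T)) (mact (kmor f) U).
Proof.
transitivity (mcomp (mcomp (mact (kidem F) V)
  (mcomp (membed A (idm (kob F : C) ⊠ T)) (mact (kmor f) U))) (mact (kidem E) U)) => //.
rewrite -!mcompA mact_comp.
rewrite [mcomp (kmor f) _](kar_homr f) mact_nat mcompA mact_comp.
by rewrite [mcomp _ (kmor f)](kar_homl f) -mact_nat.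
Qed.

Lemma kdag_act E F (f : hom E F) U V (T : hom U V) :
  dg (kact f T) = kact (dg f) T^†.
Proof.
apply: val_inj; change (kmor (dg (kact f T)) = kmor (kact (dg f) T^†)).
rewrite kdagE !kactE kproj_act.
rewrite [mdag _ _]mstar_comp mstar_mact mstar_membed dag_tens dag1.
transitivity (mcomp (mcomp (mact (kproj hA E) U) (mcomp (mact (mstar (kmor f)) U)
  (membed A (idm (kob F : C) ⊠ T^†)))) (mact (kidem F) V)) => //.
rewrite mact_nat -!mcompA mact_nat !mcompA !mact_comp.
by [].
Qed.

Lemma eqm_unitary (X Y : C) (e : X = Y) :
  is_unitary (mdag A) (membed A (eqm e) : hom (X : D) Y).
Proof.
have h : mstar (membed A (eqm e)) = membed A (eqm (esym e)).
  by rewrite mstar_membed dag_eqm.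
split; rewrite [mdag A _]h.
  transitivity (mcomp (membed A (eqm (esym e))) (membed A (eqm e))) => //.
  by rewrite -membed_comp eqmV membed1.
transitivity (mcomp (membed A (eqm e)) (membed A (eqm (esym e)))) => //.
by rewrite -membed_comp eqmVr membed1.
Qed.

Lemma module_dagger : is_module_dagger dg.
Proof.
split.
- by move=> E F f sE sF; exact: (kdag_sa hA f sE sF).
- by move=> E F f U V T; exact: kdag_act.
- by move=> E U V; apply: cut_unitary; [exact: eqm_unitary|rewrite [LHS]mact_tens].
- by move=> E; apply: cut_unitary; [exact: eqm_unitary|rewrite [LHS]mact_one].
Qed.

End ModuleDagger.

Theorem theoremA3 (R : realType) (C : rigid_Cstar_tensor_category R)
    (A : pre_Cstar_algebra_object C) :
  (exists (B : star_algebra_object C) (iota : forall U : C, A U -> B U)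
     (nm : forall U : C, B U -> R), is_fiberwise_completion iota nm)
  /\ (forall (B : star_algebra_object C) (iota : forall U : C, A U -> B U)
        (nm : forall U : C, B U -> R),
        is_fiberwise_completion iota nm -> is_Cstar_algebra_object B).
Proof.
split; first exact: completion_exists.
move=> B iota nm hB.
have hc U : is_complete_norm (@fiber_norm R C (completion_pre hB) U).
  have -> : @fiber_norm R C (completion_pre hB) U = nm U.
    by apply/funext => b; exact: completion_fiber_norm.
  exact: (completion_norm hB).
have hD := free_Cstar hc.
exists (kdag hD), (knorm hD); split; first exact: karoubi_Cstar.
exact: module_dagger.
Qed.
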